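(* Let $\mathit{pa}(n)$ denote the number of unlimited parity alternating partitions of the positive integer $n$. Then, as $n\to\infty$, $$\mathit{pa}(n)\sim \frac{\sqrt{A}}{2\pi n}e^{2\sqrt{An}},\qquad\text{where } A=\frac{\pi^2}{12}+2\left(\log \frac{1+\sqrt{5}}{2}\right)^2.$$
   Context: A partition of a positive integer $n$ is a weakly decreasing sequence of positive integers with sum $n$. An unlimited parity alternating partition is a partition whose different parts alternate in parity: if the distinct part sizes are $d_1>d_2>\cdots>d_r$, then $d_i$ and $d_{i+1}$ have different parities for every $i$ (parts may be repeated; e.g. $3+2+2+1+1$ is such a partition of $9$). $\mathit{pa}(n)$ is the number of such partitions of $n$. *)

(* Defs.v *)
From mathcomp Require Import all_boot all_order all_algebra.
From mathcomp Require Import all_classical all_reals all_analysis.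

Set Implicit Arguments.
Unset Strict Implicit.
Unset Printing Implicit Defensive.

Import Order.TTheory GRing.Theory Num.Theory.
Import numFieldNormedType.Exports.

Local Open Scope nat_scope.

Definition is_partition (n : nat) (s : seq nat) : bool :=
  [&& sorted geq s, all (leq 1) s & sumn s == n].

(* On a weakly decreasing s, undup s is the list d_1 > ... > d_r of the
   distinct part sizes. *)
Definition parity_alternating (s : seq nat) : bool :=
  sorted (fun a b => odd a != odd b) (undup s).

Definition is_upa_partition (n : nat) (s : seq nat) : bool :=
  is_partition n s && parity_alternating s.

(* A partition of n has at most n parts, each at most n, so restricting to
   sequences of length <= n with entries <= n loses nothing; see paE. *)
Definition pa (n : nat) : nat :=
  #|[set t : n.-bseq 'I_n.+1 | is_upa_partition n (map val t)]|.

Lemma is_partition_bounds (n : nat) (s : seq nat) :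
  is_partition n s -> size s <= n /\ all (fun x => x < n.+1) s.
Proof.
case/and3P=> _ s0 /eqP <-; split.
  by elim: s s0 => //= x s IHs /andP[x0 /IHs]; apply: (leq_add x0).
apply/allP => x xs; rewrite ltnS.
by rewrite (perm_sumn (perm_to_rem xs)) /= leq_addr.
Qed.

Lemma paE (n : nat) (l : seq (seq nat)) :
  uniq l -> (forall s, (s \in l) = is_upa_partition n s) -> pa n = size l.
Proof.
move=> ul lE; rewrite /pa cardE.
set e := enum _.
rewrite -(size_map (fun t : n.-bseq 'I_n.+1 => map val t) e).
apply/perm_size/uniq_perm => //.
  rewrite map_inj_uniq ?enum_uniq// => t u /(inj_map val_inj).
  exact: val_inj.
move=> s; rewrite lE; apply/mapP/idP => [[t]|su].
  by rewrite mem_enum inE => + ->.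
have [szs /allP sn] := is_partition_bounds (proj1 (andP su)).
have sE : map val (map (@inord n) s) = s.
  by rewrite -map_comp map_id_in// => x /sn xn /=; rewrite inordK.
have szs' : size (map (@inord n) s) <= n by rewrite size_map.
exists (Bseq szs'); last by rewrite /= sE.
by rewrite mem_enum inE /= sE.
Qed.

Local Open Scope ring_scope.

Definition A (R : realType) : R :=
  pi ^+ 2 / 12 + 2 * ln ((1 + Num.sqrt 5) / 2) ^+ 2.

(* Main.v *)
Require Import Defs.
From mathcomp Require Import all_boot all_order all_algebra.
From mathcomp Require Import all_classical all_reals all_analysis.
From mathcomp Require Import measurable_realfun complex.
From mathcomp Require Import ring lra zify.

Set Implicit Arguments.
Unset Strict Implicit.
Unset Printing Implicit Defensive.

Import Order.TTheory GRing.Theory Num.Theory.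
Import numFieldNormedType.Exports.

(** * Conjugation and the generating function *)

Local Open Scope nat_scope.

(** Passing from the parts to their successive differences (conjugation) makes parity alternation a
    local condition: every difference is zero or odd, except that the last one, the smallest part,
    is any positive number. For [m.+1] parts the generating function is thus x^(m+1)/(1-x^(m+1))
    times the product over 1 <= j <= m of 1 + x^j/(1-x^(2j)). All work is done with the polynomial
    [upa_poly n], truncated at exponents of size n, whose n-th coefficient is [pa n] ([pa_cnt],
    [upa_polyE]).

    Put x = e^-t, f(y) = 1 + e^-y/(1-e^(-2y)), and let P(m) be the product of f(jt) over 1 <= j <=
    m. Since y/(1-y) = (1+y) y/(1-y^2), the m-th term is (1+x^(m+1)) (P(m+1)-P(m)) up to truncation.
    The increments concentrate where mt is large and x^(m+1) is negligible, so the sum telescopes to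
    P(n) asymptotically ([upa_poly_cvg]). The factorisation 1+y-y^2 = (1-y/a)(1+ay), a the golden
    ratio, gives ln f a dilogarithmic primitive whose total increment over the half line is A. With
    f(y) ~ 1/(2y) at 0 and Stirling's formula this yields P ~ sqrt(t/pi) e^(A/t) ([upa_prod_cvg]).

    The coefficient is extracted by a local limit theorem. Give k the mass (k-th coefficient)
    e^(-kt) / (sqrt(t/pi) e^(A/t)) at the saddle point t = sqrt(A/n). The real asymptotics at nearby
    t show that the rescaled Laplace transforms tend to e^(s^2) ([mgf_cvg]); through moments, the
    cosine transforms tend to e^(-u^2) ([sum_cos_cvg]). Off the real axis only an upper bound
    enters, to dominate the Fourier integral ([saddle_bound]). Dominated convergence in
    [local_limit] then gives the mass at k = n. *)

Definition parity_step (a b : nat) := (b <= a) && ((a == b) || odd (a - b)).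

(** On a weakly decreasing list, equal neighbours are exactly what [undup] removes, and two numbers
    have different parities exactly when their difference is odd. This trades [undup] for a
    condition on neighbours. *)
Lemma parity_alternatingE s : sorted geq s ->
  parity_alternating s = sorted parity_step s.
Proof.
elim: s => [//|x [//|y s] IHs] xs.
have /andP[yx ys] : (y <= x) && path geq y s by [].
have IH := IHs ys.
(* [undup] keeps the last copy of an element, so the head of the result is not given by computation;
   sortedness makes all copies of [y] adjacent. *)
have yh : exists u, undup (y :: s) = y :: u.
  elim: s y ys {xs yx IHs IH} => [|z s IHs] y /=; first by exists [::].
  move=> /andP[zy zs]; have [u uE] := IHs z zs.
  case: ifPn => [|_]; last by eexists.
  move=> yin; have yz : y = z.
    apply/eqP; rewrite eqn_leq zy andbT.
    move: yin; rewrite inE => /orP[/eqP->//|yin].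
    have := zs; rewrite path_sortedE; last by move=> a b c /= h1 h2; exact: leq_trans h2 h1.
    by move=> /andP[/allP/(_ _ yin)].
  by rewrite -yz in uE *; exists u; rewrite -uE /= .
rewrite /parity_alternating in IH *.
rewrite [in RHS]/= -[path _ _ _]/(sorted parity_step (y :: s)) -IH.
rewrite [undup _]/= -[if y \in s then _ else _]/(undup (y :: s)).
have [u uE] := yh.
case: ifPn => xin.
  have xy : x = y.
    apply/eqP; rewrite eqn_leq yx andbT.
    move: xin; rewrite inE => /orP[/eqP->//|xin].
    have := ys; rewrite path_sortedE; last by move=> a b c /= h1 h2; exact: leq_trans h2 h1.
    by move=> /andP[/allP/(_ _ xin)].
  by rewrite xy /parity_step leqnn eqxx.
have xny : x != y by move: xin; rewrite inE negb_or => /andP[].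
rewrite uE /= /parity_step yx (negbTE xny)/= oddB//.
by rewrite -negb_eqb.
Qed.

(* The differences of s, the last part being compared with 0 *)
Fixpoint diffs (s : seq nat) : seq nat :=
  if s is x :: s' then (x - head 0 s') :: diffs s' else [::].

(** Inverse of [diffs] on sorted lists. Entry [i] of [e] is the multiplicity of the part [i.+1] in
    the conjugate partition. *)
Fixpoint tails_sum (e : seq nat) : seq nat :=
  if e is x :: e' then sumn e :: tails_sum e' else [::].

Lemma size_tails_sum e : size (tails_sum e) = size e.
Proof. by elim: e => //= x e ->. Qed.

Lemma head_tails_sum e : head 0 (tails_sum e) = sumn e.
Proof. by case: e. Qed.

Lemma tails_sumK : cancel tails_sum diffs.
Proof. by elim=> //= x e IHe; rewrite IHe head_tails_sum addnK. Qed.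

Lemma sumn_tails_sum e :
  sumn (tails_sum e) = \sum_(i < size e) i.+1 * nth 0 e i.
Proof.
elim: e => [|x e IHe]; first by rewrite big_ord0.
rewrite /= big_ord_recl /= mul1n IHe -addnA; congr (_ + _).
rewrite sumnE (big_nth 0) big_mkord -big_split/=; apply: eq_bigr => i _.
by rewrite /bump /= add1n !mulSn addnA.
Qed.

Lemma diffsK s : sorted geq s -> tails_sum (diffs s) = s.
Proof.
elim: s => //= x s IHs xs.
have ss : sorted geq s by case: s xs {IHs} => //= y s /andP[].
have -> : sumn (diffs s) = head 0 s by rewrite -head_tails_sum IHs.
rewrite IHs//; congr (_ :: _).
by case: s xs {IHs ss} => [|y s] /=; [lia|move=> /andP[h _]; rewrite subnK].
Qed.

Definition odd_or_zero k := (k == 0) || odd k.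

Lemma last_le_sumn x e : last x e <= x + sumn e.
Proof.
elim: e x => [|y e IHe] x /=; first by rewrite addn0.
by rewrite (leq_trans (IHe y))// leq_addl.
Qed.

(** Neighbouring suffix sums differ by one entry of [e], so the parity condition splits into one
    condition per entry; the last entry is the smallest part and carries the positivity of all
    parts. *)
Lemma upa_tails_sum n e : e != [::] -> is_upa_partition n (tails_sum e) =
  [&& sumn (tails_sum e) == n, 0 < last 0 e & all odd_or_zero (take (size e).-1 e)].
Proof.
case: e => // x e _; rewrite /is_upa_partition /is_partition.
have st : sorted geq (tails_sum (x :: e)).
  elim: e x => //= y e IHe x; have := IHe y; rewrite /= => ->.
  by rewrite andbT leq_addl.
rewrite st andTb parity_alternatingE//.
have -> : all (leq 1) (tails_sum (x :: e)) = (0 < last x e).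
  elim: e x {st} => [|y e IHe] x; first by rewrite /= addn0 andbT.
  rewrite [LHS]/= -[X in _ && X]/(all (leq 1) (tails_sum (y :: e))) IHe /=.
  have := last_le_sumn y e; case: (ltnP 0 (last y e)) => h1 h2; rewrite ?andbF//.
  by rewrite andbT (leq_trans h1)// (leq_trans h2)// leq_addl.
have -> : sorted parity_step (tails_sum (x :: e)) = all odd_or_zero (take (size e) (x :: e)).
  elim: e x {st} => [|y e IHe] x //.
  rewrite -[RHS]/(odd_or_zero x && all odd_or_zero (take (size e) (y :: e))) -IHe /=.
  congr (_ && _); rewrite /parity_step leq_addl addnK /odd_or_zero /=.
  by rewrite -{2}[y + sumn e]add0n eqn_add2r.
by rewrite /= andbC andbA [X in _ = X]andbCA; case: (0 < last x e); rewrite ?andbT ?andbF//= andbC.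
Qed.

Section GF.
Variable n : nat.

Definition digit_ok (m : nat) (j k : nat) : bool :=
  if j == m then 0 < k else odd_or_zero k.

Definition configs (m : nat) : {set {ffun 'I_m.+1 -> 'I_n.+1}} :=
  [set f : {ffun 'I_m.+1 -> 'I_n.+1} | [forall j : 'I_m.+1, digit_ok m j (f j)]].

Definition weight (m : nat) (f : {ffun 'I_m.+1 -> 'I_n.+1}) : nat :=
  \sum_(j < m.+1) j.+1 * f j.

(** Here [m.+1] is the number of parts. Bounding it and every difference by [n] keeps everything
    finite; nothing is lost for [k <= n], while larger [k] may be undercounted. *)
Definition cnt (k : nat) : nat :=
  \sum_(m < n) #|[set f in configs m | weight f == k]|.

Definition seq_of (m : nat) (f : {ffun 'I_m.+1 -> 'I_n.+1}) : seq nat :=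
  [seq nat_of_ord (f j) | j <- enum 'I_m.+1].

Lemma size_seq_of m (f : {ffun 'I_m.+1 -> 'I_n.+1}) : size (seq_of f) = m.+1.
Proof. by rewrite size_map size_enum_ord. Qed.

Lemma nth_seq_of m (f : {ffun 'I_m.+1 -> 'I_n.+1}) (j : 'I_m.+1) :
  nth 0 (seq_of f) j = f j.
Proof. by rewrite (nth_map j) ?size_enum_ord// nth_ord_enum. Qed.

Lemma seq_of_inj m : injective (@seq_of m).
Proof.
move=> f g fg; apply/ffunP => j; apply: val_inj => /=.
by rewrite -!nth_seq_of fg.
Qed.

Lemma weight_seq_of m (f : {ffun 'I_m.+1 -> 'I_n.+1}) :
  weight f = sumn (tails_sum (seq_of f)).
Proof.
rewrite sumn_tails_sum size_seq_of; apply: eq_bigr => j _.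
by rewrite nth_seq_of.
Qed.

Lemma configs_upa m (f : {ffun 'I_m.+1 -> 'I_n.+1}) k :
  (f \in configs m) && (weight f == k) =
  is_upa_partition k (tails_sum (seq_of f)).
Proof.
have ne : seq_of f != [::] by rewrite -size_eq0 size_seq_of.
rewrite upa_tails_sum// -weight_seq_of andbC; congr (_ && _).
rewrite inE -nth_last size_seq_of /=.
have nE (j : nat) (jm : j < m.+1) : nth 0 (seq_of f) j = f (Ordinal jm).
  by rewrite -[j]/(nat_of_ord (Ordinal jm)) nth_seq_of.
apply/forallP/andP => [h|[h1 /(all_nthP 0) h2] j].
  split; first by have := h ord_max; rewrite /digit_ok eqxx -nth_seq_of.
  apply/(all_nthP 0) => j; rewrite size_take size_seq_of ltnSn => jm.
  rewrite nth_take// (nE _ (ltnW jm)); have := h (Ordinal (ltnW jm : j < m.+1)).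
  by rewrite /digit_ok /= ltn_eqF.
rewrite /digit_ok; case: eqP => [jm|/eqP jm]; first by rewrite -nth_seq_of jm.
have jl : j < m by rewrite ltn_neqAle jm -ltnS ltn_ord.
by have := h2 j; rewrite size_take size_seq_of ltnSn nth_take// nth_seq_of; apply.
Qed.

Lemma pa_cnt : 0 < n -> pa n = cnt n.
Proof.
move=> n0.
pose L (m : 'I_n) := [seq seq_of f | f <- enum [set f in configs m | weight f == n]].
rewrite (@paE n [seq tails_sum e | m <- enum 'I_n, e <- L m]).
- rewrite size_allpairs_dep sumnE big_map big_enum; apply: eq_bigr => m _.
  by rewrite size_map -cardE.
- apply: allpairs_uniq_dep; first exact: enum_uniq.
    by move=> m _; rewrite map_inj_uniq ?enum_uniq//; exact: seq_of_inj.
  move=> _ _ /allpairsPdep[m1 [e1 [_ e1L ->]]] /allpairsPdep[m2 [e2 [_ e2L ->]]] /=.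
  move=> /(can_inj tails_sumK) e12.
  have m12 : m1 = m2.
    move: e1L e2L => /mapP[f1 _ e1E] /mapP[f2 _ e2E]; apply: val_inj.
    by apply: succn_inj; rewrite -(size_seq_of f1) -(size_seq_of f2) -e1E -e2E e12.
  by rewrite -e12 -m12.
move=> s; apply/allpairsPdep/idP => [[m [e [_ /mapP[f fin ->] ->]]]|sp].
  by move: fin; rewrite mem_enum inE configs_upa.
have /andP[/and3P[ss s0 /eqP sn] _] := sp.
have [szs _] := is_partition_bounds (proj1 (andP sp)).
have sE := diffsK ss.
have szd : size (diffs s) = size s by rewrite -[in RHS]sE size_tails_sum.
have szs0 : 0 < size s by case: s sn {ss s0 sp szs sE szd} => //= sn; move: n0; rewrite -sn.
have mn : (size s).-1 < n by rewrite prednK.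
have dn j : nth 0 (diffs s) j < n.+1.
  have [jl|jl] := ltnP j (size (diffs s)); last by rewrite nth_default.
  have h1 : nth 0 (diffs s) j <= sumn (diffs s).
    by rewrite (perm_sumn (perm_to_rem (mem_nth 0 jl))) /= leq_addr.
  have h2 : sumn (diffs s) <= sumn s.
    by rewrite -head_tails_sum sE; case: (s) => //= a r; rewrite leq_addr.
  by rewrite ltnS -sn (leq_trans h1).
pose f : {ffun 'I_(size s).-1.+1 -> 'I_n.+1} := [ffun j => Ordinal (dn (nat_of_ord j))].
have fE : seq_of f = diffs s.
  apply: (@eq_from_nth _ 0); rewrite size_seq_of prednK ?szd// => j jl.
  have jl' : j < (size s).-1.+1 by rewrite prednK.
  by rewrite -[j in LHS]/(nat_of_ord (Ordinal jl')) nth_seq_of ffunE.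
exists (Ordinal mn), (diffs s); split; rewrite ?mem_enum//.
apply/mapP; exists f => //.
by rewrite mem_enum inE configs_upa fE sE.
Qed.

Lemma weight_lt m (f : {ffun 'I_m.+1 -> 'I_n.+1}) : m < n -> weight f < (n * (n * n)).+1.
Proof.
move=> mn; rewrite ltnS.
apply: (@leq_trans (\sum_(j < m.+1) n * n)).
  by apply: leq_sum => j _; rewrite leq_mul// ?(leq_trans (ltn_ord j))// -ltnS.
by rewrite sum_nat_const card_ord leq_mul2r mn orbT.
Qed.

End GF.

Local Open Scope ring_scope.

(** * The generating polynomial *)

(** With y = x^(j+1), this and [top_factor] truncate the series of 1 + y/(1-y^2) and y/(1-y). The
    ring is left general because x will be real as well as complex. *)
Definition odd_factor (R : comPzRingType) (n : nat) (x : R) (j : nat) : R :=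
  \sum_(k < n.+1 | odd_or_zero k) x ^+ (j.+1 * k).

Definition top_factor (R : comPzRingType) (n : nat) (x : R) (m : nat) : R :=
  \sum_(k < n.+1 | (0 < k)%N) x ^+ (m.+1 * k).

Definition upa_poly (R : comPzRingType) (n : nat) (x : R) : R :=
  \sum_(m < n) top_factor n x m * \prod_(j < m) odd_factor n x j.

Lemma upa_polyE (R : comPzRingType) n (x : R) :
  upa_poly n x = \sum_(k < (n * (n * n)).+1) (cnt n k)%:R * x ^+ k.
Proof.
transitivity (\sum_(m < n) \sum_(f in configs n m) x ^+ weight f).
  apply: eq_bigr => m _.
  transitivity (\prod_(j < m.+1) \sum_(k < n.+1 | digit_ok m j k) x ^+ (j.+1 * k)).
    rewrite big_ord_recr mulrC /=; congr (_ * _).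
      apply: eq_bigr => j _; apply: eq_bigl => k.
      by rewrite /digit_ok /= ltn_eqF.
    by apply: eq_bigl => k; rewrite /digit_ok eqxx.
  rewrite bigA_distr_big_dep; apply: eq_big => [f|f _].
    by rewrite [RHS]inE; apply/familyP/forallP => h j; exact: h.
  by rewrite /weight; elim/big_rec2: _ => [|j a b _ ->]; rewrite ?expr0// exprD.
under eq_bigr => m _.
  rewrite (partition_big (fun f => inord (weight f) : 'I_(n * (n * n)).+1) predT)//=.
  over.
rewrite exchange_big/=; apply: eq_bigr => k _.
rewrite /cnt natr_sum mulr_suml; apply: eq_bigr => m _.
rewrite -sum1_card natr_sum mulr_suml; apply: eq_big => [f|f].
  by rewrite inE; congr (_ && _); rewrite -val_eqE/= inordK// weight_lt.
by move=> /andP[_ /eqP <-]; rewrite mul1r inordK// weight_lt.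
Qed.

Local Open Scope classical_set_scope.
Local Open Scope ring_scope.

(** * From Laplace transforms to characteristic functions *)

(** Beyond index [m] each factor [r ^+ k] is at most [r ^+ m]. With [c] a hyperbolic cosine or
    exponential series this bounds Taylor remainders by the value of a transform. *)
Lemma series_tail_le (R : realType) (e c : nat -> R) (E C r : R) (m : nat) :
  0 <= r <= 1 -> (forall k, 0 <= c k) -> (forall k, `|e k| <= c k * r ^+ k) ->
  series e @ \oo --> E -> series c @ \oo --> C ->
  `|E - \sum_(0 <= k < m) e k| <= r ^+ m * C.
Proof.
move=> /andP[r0 r1] c0 ec eE cC.
have cv : (fun n => `|series e n - \sum_(0 <= k < m) e k|) @ \oo -->
    `|E - \sum_(0 <= k < m) e k|.
  by apply: cvg_norm; apply: cvgB => //; exact: cvg_cst.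
rewrite -(cvg_lim _ cv)//; apply: limr_le; first by apply/cvg_ex; eexists; exact: cv.
have cle n : series c n <= C.
  rewrite -(cvg_lim _ cC)//; apply: nondecreasing_cvgn_le.
    by apply/nondecreasing_seqP => i; rewrite /series/= big_nat_recr//= lerDl.
  by apply/cvg_ex; eexists; exact: cC.
near=> n.
have mn : (m <= n)%N by near: n; exact: nbhs_infty_ge.
rewrite /series/= (big_cat_nat (n:=m))//= addrAC subrr add0r.
apply: (le_trans (ler_norm_sum _ _ _)).
apply: (@le_trans _ _ (\sum_(m <= k < n) r ^+ m * c k)).
  rewrite [leLHS]big_nat_cond [leRHS]big_nat_cond.
  apply: ler_sum => k /andP[/andP[mk _] _].
  rewrite (le_trans (ec k))// mulrC ler_wpM2r//.
  by rewrite ler_wiXn2l.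
rewrite -mulr_sumr ler_wpM2l ?exprn_ge0//.
apply: le_trans (cle n); rewrite /series/= [leRHS](big_cat_nat (n:=m))//= lerDr.
exact: sumr_ge0.
Unshelve. all: by end_near. Qed.

Lemma expR_series (R : realType) (x : R) :
  series (fun k => x ^+ k / k`!%:R) @ \oo --> expR x.
Proof. exact: is_cvg_series_exp_coeff. Qed.

Lemma cosh_series (R : realType) (x : R) :
  series (fun k => x ^+ k.*2 / (k.*2)`!%:R) @ \oo -->
  ((expR x + expR (- x)) / 2 : R).
Proof.
have h : (fun n => (series (fun k => x ^+ k / k`!%:R) n +
    series (fun k => (- x) ^+ k / k`!%:R) n) / 2) @ \oo -->
    ((expR x + expR (- x)) / 2).
  by apply: cvgMr_tmp; apply: cvgD; exact: expR_series.
have hs : (fun n : nat => n.*2) @ \oo --> \oo.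
  move=> P [N _ PN]; exists N => // n /= Nn; apply: PN => /=.
  by rewrite (leq_trans Nn)// -addnn leq_addr.
have := cvg_comp _ _ hs h.
apply: cvg_trans; apply: near_eq_cvg; apply: nearW => n /=.
rewrite /series/=.
elim: n => [|n IHn]; first by rewrite !big_geq// addr0 mul0r.
rewrite doubleS !big_nat_recr//= -IHn !exprS exprNn -signr_odd odd_double expr0.
rewrite mul1r; set a := \sum_(0 <= _ < _) _; set b := \sum_(0 <= _ < _) _.
by set c := _`!%:R^-1; set d := _`!%:R^-1; set y := x ^+ _; field.
Qed.

Lemma cvg_sumr (R : realType) (I : Type) (r : seq I) (P : pred I)
    (f : I -> nat -> R) (l : I -> R) :
  (forall i, P i -> f i @ \oo --> l i) ->
  (fun n => \sum_(i <- r | P i) f i n) @ \oo --> \sum_(i <- r | P i) l i.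
Proof. by move=> h; apply: cvg_big => //; exact: add_continuous. Qed.

Lemma squeeze_cvgn (R : realType) (f g h : nat -> R) (l : R) :
  (\forall n \near \oo, f n <= g n <= h n) ->
  f @ \oo --> l -> h @ \oo --> l -> g @ \oo --> l.
Proof. by move=> fgh fl hl; exact: (squeeze_cvgr fgh fl hl). Qed.

Lemma cvgn_ge (R : realType) (u : nat -> R) (l x : R) :
  u @ \oo --> l -> (\forall n \near \oo, x <= u n) -> x <= l.
Proof.
move=> ul xu; rewrite -(cvg_lim _ ul)//; apply: limr_ge => //.
by apply/cvg_ex; eexists; exact: ul.
Qed.

Lemma cvgn_le (R : realType) (u : nat -> R) (l x : R) :
  u @ \oo --> l -> (\forall n \near \oo, u n <= x) -> l <= x.
Proof.
move=> ul xu; rewrite -(cvg_lim _ ul)//; apply: limr_le => //.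
by apply/cvg_ex; eexists; exact: ul.
Qed.

Lemma cvgn_comp (R : realType) (h : R -> R) (u : nat -> R) (a : R) :
  {for a, continuous h} -> u @ \oo --> a -> (fun n => h (u n)) @ \oo --> h a.
Proof. by move=> ch ua; exact: (cvg_comp _ _ ua ch). Qed.

Lemma cvgn_exp (R : realType) (u : nat -> R) (a : R) (N : nat) :
  u @ \oo --> a -> (fun n => u n ^+ N) @ \oo --> a ^+ N.
Proof. apply: (@cvgn_comp R (fun x => x ^+ N)); exact: exprn_continuous. Qed.

Lemma cvgn_approx (R : realType) (f : nat -> R) (l : R) :
  (forall eps : R, 0 < eps -> exists g l', [/\ g @ \oo --> l', `|l - l'| <= eps &
     \forall n \near \oo, `|f n - g n| <= eps]) ->
  f @ \oo --> l.
Proof.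
move=> h; apply/cvgrPdist_le => eps eps0.
have e3 : 0 < eps / 3 by lra.
have [g [l' [gl ll fg]]] := h _ e3.
near=> n.
have h1 : `|l' - g n| <= eps / 3 by near: n; exact: cvgr_dist_le gl _ e3.
have h2 : `|f n - g n| <= eps / 3 by near: n.
rewrite (_ : l - f n = (l - l') + (l' - g n) - (f n - g n)); last by ring.
have := ler_normB (l - l' + (l' - g n)) (f n - g n).
have := ler_normD (l - l') (l' - g n); lra.
Unshelve. all: by end_near. Qed.

Lemma exprn_double_ge0 (R : realDomainType) (x : R) k : 0 <= x ^+ k.*2.
Proof. by rewrite -mul2n exprM exprn_ge0 ?sqr_ge0. Qed.

Lemma exprn_sqr_ge0 (R : realDomainType) (x : R) k : 0 <= (x ^+ 2) ^+ k.
Proof. by rewrite -exprM mul2n exprn_double_ge0. Qed.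

(** Method of moments. Averaging the hypothesis at s and -s gives the cosh transforms; their Taylor
    coefficients, the even moments over (2m)!, are shown to tend to 1/m!, and the truncated cosine
    series then tends to the truncated series of e^(-u^2). *)
Lemma sum_cos_cvg (R : realType) (N : nat -> nat) (w y : nat -> nat -> R) (u : R) :
  (forall n k, 0 <= w n k) ->
  (forall s, (fun n => \sum_(k < N n) w n k * expR (s * y n k)) @ \oo -->
     expR (s ^+ 2)) ->
  (fun n => \sum_(k < N n) w n k * cos (u * y n k)) @ \oo --> expR (- u ^+ 2).
Proof.
move=> w0 mgf.
pose ch (x : R) := (expR x + expR (- x)) / 2.
pose H n r := \sum_(k < N n) w n k * ch (r * y n k).
pose a n m := \sum_(k < N n) w n k * (y n k ^+ m.*2 / (m.*2)`!%:R).
have Hcv r : H ^~ r @ \oo --> expR (r ^+ 2).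
  have -> : expR (r ^+ 2) = (expR (r ^+ 2) + expR ((- r) ^+ 2)) / 2.
    by rewrite sqrrN; field.
  have h : (fun n => (\sum_(k < N n) w n k * expR (r * y n k) +
      \sum_(k < N n) w n k * expR (- r * y n k)) / 2) @ \oo -->
      ((expR (r ^+ 2) + expR ((- r) ^+ 2)) / 2).
    by apply: cvgMr_tmp; apply: cvgD; exact: mgf.
  apply: cvg_trans h; apply: near_eq_cvg; apply: nearW => n /=.
  rewrite /H -big_split/= mulr_suml; apply: eq_bigr => k _.
  by rewrite /ch mulNr; field.
have Hle r : \forall n \near \oo, H n r <= expR (r ^+ 2) + 1.
  near=> n.
  have : `|H n r - expR (r ^+ 2)| <= 1 by near: n; exact: cvgr_distC_le (Hcv r) _ ltr01.
  by rewrite ler_norml => /andP[_]; lra.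
(* If a series is dominated termwise by that of cosh(xz) with an extra ratio r^2, its weighted
   remainder of order m costs r^(2m) times the cosh transform at x, which is bounded for large n. *)
have tail (e : R -> nat -> R) (E : R -> R) (x r : R) n m : 0 <= r <= 1 ->
   (forall z k, `|e z k| <= (x * z) ^+ k.*2 / (k.*2)`!%:R * (r ^+ 2) ^+ k) ->
   (forall z, series (e z) @ \oo --> E z) ->
   `|\sum_(k < N n) w n k * E (y n k) -
     \sum_(0 <= i < m) \sum_(k < N n) w n k * e (y n k) i| <=
     (r ^+ 2) ^+ m * H n x.
  move=> r01 he hE.
  rewrite exchange_big/= -sumrB /H mulr_sumr.
  apply: (le_trans (ler_norm_sum _ _ _)); apply: ler_sum => k _.
  rewrite -mulr_sumr -mulrBr normrM ger0_norm// mulrCA ler_wpM2l//.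
  have r201 : 0 <= r ^+ 2 <= 1 by rewrite sqr_ge0 expr_le1//; lra.
  apply: series_tail_le r201 _ (he _) (hE _) (@cosh_series _ _) => i.
  by rewrite divr_ge0 ?exprn_double_ge0.
have gtail (e : nat -> R) (E x r : R) m : 0 <= r <= 1 ->
   (forall k, `|e k| <= (x ^+ 2) ^+ k / k`!%:R * (r ^+ 2) ^+ k) ->
   (series e @ \oo --> E) ->
   `|E - \sum_(0 <= i < m) e i| <= (r ^+ 2) ^+ m * expR (x ^+ 2).
  move=> r01 he hE.
  have r201 : 0 <= r ^+ 2 <= 1 by rewrite sqr_ge0 expr_le1//; lra.
  apply: series_tail_le r201 _ he hE (@expR_series _ _) => i.
  by rewrite divr_ge0 ?exprn_sqr_ge0.
have coefE (c : nat -> R) n m : \sum_(0 <= i < m) \sum_(k < N n)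
    w n k * (c i * (y n k ^+ i.*2 / (i.*2)`!%:R)) = \sum_(0 <= i < m) c i * a n i.
  apply: eq_bigr => i _; rewrite /a mulr_sumr; apply: eq_bigr => k _.
  by rewrite mulrCA.
have e1 : 0 < expR 1 :> R by exact: expR_gt0.
(* Strong induction: removing the known lower moments from [H n r] and dividing by r^(2m) isolates
   [a n m] up to O(r^2), uniformly for large n. *)
have acv m : a ^~ m @ \oo --> (m`!%:R^-1 : R).
  elim/ltn_ind: m => m IHm.
  apply: cvgn_approx => eps eps0.
  (* [expR 1 + 1] eventually bounds [H n 1]; as r <= 1, r^2 <= r and the error r^2 (e+1) stays below
     [eps]. *)
  pose r : R := Num.min 1 (eps / (expR 1 + 1)).
  have rp : 0 < r by rewrite /r lt_min ltr01 divr_gt0//; lra.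
  have r01 : 0 <= r <= 1 by rewrite ltW//= ge_min lexx.
  have re : r ^+ 2 * (expR 1 + 1) <= eps.
    apply: (@le_trans _ _ (r * (expR 1 + 1))).
      by rewrite ler_wpM2r ?expr2 ?ger_pMl//; lra.
    by rewrite -ler_pdivlMr ?ge_min ?lexx ?orbT//; lra.
  have rm : 0 < (r ^+ 2) ^+ m by rewrite !exprn_gt0.
  exists (fun n => (H n r - \sum_(0 <= i < m) (r ^+ 2) ^+ i * a n i) / (r ^+ 2) ^+ m).
  exists ((expR (r ^+ 2) - \sum_(0 <= i < m) (r ^+ 2) ^+ i * i`!%:R^-1) / (r ^+ 2) ^+ m).
  split.
  - apply: cvgMr_tmp; apply: cvgB (Hcv r) _.
    under eq_fun do rewrite big_mkord; rewrite big_mkord.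
    apply: cvg_sumr => i _; apply: cvgMl_tmp; exact: IHm.
  - have b k : `|(r ^+ 2) ^+ k / k`!%:R| <= (1 ^+ 2) ^+ k / k`!%:R * (r ^+ 2) ^+ k.
      by rewrite !expr1n mul1r mulrC ger0_norm// mulr_ge0 ?invr_ge0 ?exprn_sqr_ge0.
    have h := gtail _ _ _ _ m.+1 r01 b (@expR_series _ _).
    rewrite big_nat_recr//= expr1n [(r ^+ 2) ^+ m.+1]exprS in h.
    rewrite -(ler_pM2r rm) -[X in _ * X <= _](gtr0_norm rm) -normrM mulrBl divfK ?gt_eqF//.
    rewrite distrC [_ * (r ^+ 2) ^+ m]mulrC.
    move: h; rewrite opprD addrA => /le_trans; apply.
    rewrite mulrAC.
    by rewrite ler_wpM2r ?(ltW rm)//; nra.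
  - near=> n.
    have Hn : H n 1 <= expR (1 ^+ 2) + 1 by near: n; exact: Hle.
    rewrite expr1n in Hn.
    have X z k : (r * z) ^+ k.*2 / (k.*2)`!%:R = (r ^+ 2) ^+ k * (z ^+ k.*2 / (k.*2)`!%:R) :> R.
      by rewrite exprMn -exprM mul2n mulrA.
    have b (z : R) k : `|(r ^+ 2) ^+ k * (z ^+ k.*2 / (k.*2)`!%:R)| <=
        (1 * z) ^+ k.*2 / (k.*2)`!%:R * (r ^+ 2) ^+ k.
      rewrite mul1r mulrC ger0_norm// mulr_ge0 ?exprn_sqr_ge0//.
      by rewrite divr_ge0 ?exprn_double_ge0.
    have c (v : R) : series (fun k => (r ^+ 2) ^+ k * (v ^+ k.*2 / (k.*2)`!%:R)) @ \oo -->
        ch (r * v).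
      by under eq_fun do rewrite -X; exact: cosh_series.
    have h := tail _ _ _ _ n m.+1 r01 b c.
    rewrite coefE big_nat_recr//= in h.
    rewrite -(ler_pM2r rm) -[X in _ * X <= _](gtr0_norm rm) -normrM mulrBl divfK ?gt_eqF//.
    rewrite distrC [_ * (r ^+ 2) ^+ m]mulrC.
    move: h; rewrite opprD addrA => /le_trans; apply.
    by rewrite [(r ^+ 2) ^+ m.+1]exprS mulrAC ler_wpM2r ?(ltW rm)//; nra.
apply: cvgn_approx => eps eps0.
(* The cosine series at u is compared with the cosh series at 2u: each order gains a factor 1/4, so
   the remainder is geometric in m. *)
have q : (fun m => (expR ((2 * u) ^+ 2) + 1) * ((2^-1 ^+ 2) ^+ m) : R) @ \oo --> (0 : R).
  rewrite -[X in _ --> X](mulr0 (expR ((2 * u) ^+ 2) + 1)); apply: cvgMl_tmp.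
  by apply: cvg_expr; rewrite ger0_norm; lra.
have [m _ /(_ m)/=] := cvgr0_norm_le _ q _ eps0.
rewrite leqnn => /(_ isT) hm; rewrite ger0_norm in hm; last first.
  by rewrite mulr_ge0 ?exprn_ge0// addr_ge0 ?expR_ge0.
have p0 : 0 <= (2^-1 ^+ 2 : R) ^+ m by rewrite exprn_ge0.
have h01 : 0 <= (2^-1 : R) <= 1 by lra.
exists (fun n => \sum_(0 <= i < m) (-1) ^+ i * (u ^+ 2) ^+ i * a n i).
exists (\sum_(0 <= i < m) (-1) ^+ i * (u ^+ 2) ^+ i * i`!%:R^-1); split.
- apply: cvg_sumr => i _; exact: cvgMl_tmp.
- have b k : `|(- u ^+ 2) ^+ k / k`!%:R| <=
      ((2 * u) ^+ 2) ^+ k / k`!%:R * (2^-1 ^+ 2) ^+ k.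
    rewrite exprNn -mulrA normrM normrX normrN1 expr1n mul1r.
    rewrite ger0_norm ?divr_ge0 ?exprn_sqr_ge0//.
    rewrite mulrAC -exprMn (_ : (2 * u) ^+ 2 * 2^-1 ^+ 2 = u ^+ 2)//.
    by rewrite exprMn mulrAC -exprMn mulfV// expr1n mul1r.
  have h := gtail _ _ _ _ m h01 b (@expR_series _ _).
  under eq_bigr do rewrite -exprMn mulN1r.
  by rewrite (le_trans h)// (le_trans _ hm)// mulrC ler_wpM2r//; lra.
- near=> n.
  have Hn : H n (2 * u) <= expR ((2 * u) ^+ 2) + 1 by near: n; exact: Hle.
  have X z k : cos_coeff' (u * z) k = (-1) ^+ k * (u ^+ 2) ^+ k * (z ^+ k.*2 / (k.*2)`!%:R).
    by rewrite /cos_coeff' exprMn -exprM mul2n -exprnP -!mulrA.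
  have b (z : R) k : `|(-1) ^+ k * (u ^+ 2) ^+ k * (z ^+ k.*2 / (k.*2)`!%:R)| <=
      (2 * u * z) ^+ k.*2 / (k.*2)`!%:R * (2^-1 ^+ 2) ^+ k.
    rewrite -mulrA normrM normrX normrN1 expr1n mul1r.
    rewrite ger0_norm ?mulr_ge0 ?divr_ge0 ?exprn_sqr_ge0 ?exprn_double_ge0//.
    rewrite mulrA [leRHS]mulrAC ler_wpM2r ?invr_ge0// -!mul2n !exprM -!exprMn.
    by rewrite (_ : 2 * u * z * 2^-1 = u * z)//; field.
  have c (v : R) : series (fun k => (-1) ^+ k * (u ^+ 2) ^+ k * (v ^+ k.*2 / (k.*2)`!%:R))
      @ \oo --> cos (u * v).
    by under eq_fun do rewrite -X; exact: cvg_cos_coeff'.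
  have h := tail _ _ _ _ n m h01 b c.
  rewrite coefE in h.
  by rewrite (le_trans h)// (le_trans _ hm)// mulrC ler_wpM2r//; lra.
Unshelve. all: by end_near. Qed.

(** * A local limit theorem *)

Lemma deriveD1 (R : realType) (f g : R -> R) (x df dg : R) :
  is_derive x 1 f df -> is_derive x 1 g dg ->
  is_derive x 1 (fun y => f y + g y) (df + dg).
Proof. exact: is_deriveD. Qed.

Lemma deriveN1 (R : realType) (f : R -> R) (x df : R) :
  is_derive x 1 f df -> is_derive x 1 (fun y => - f y) (- df).
Proof. exact: is_deriveN. Qed.

Lemma deriveB1 (R : realType) (f g : R -> R) (x df dg : R) :
  is_derive x 1 f df -> is_derive x 1 g dg ->
  is_derive x 1 (fun y => f y - g y) (df - dg).
Proof. exact: is_deriveB. Qed.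

Lemma deriveM1 (R : realType) (f g : R -> R) (x df dg : R) :
  is_derive x 1 f df -> is_derive x 1 g dg ->
  is_derive x 1 (fun y => f y * g y) (df * g x + f x * dg).
Proof.
move=> h1 h2; apply: is_derive_eq (is_deriveM h1 h2) _.
by rewrite addrC; congr (_ + _); exact: mulrC.
Qed.

Lemma deriveC1 (R : realType) (c x : R) : is_derive x 1 (fun=> c) 0.
Proof. exact: is_derive_cst. Qed.

Lemma deriveZ1 (R : realType) (c : R) (f : R -> R) (x df : R) :
  is_derive x 1 f df -> is_derive x 1 (fun y => c * f y) (c * df).
Proof. exact: is_deriveZ. Qed.

Lemma deriveO1 (R : realType) (f g : R -> R) (x df dg : R) :
  is_derive (g x) 1 f df -> is_derive x 1 g dg ->
  is_derive x 1 (fun y => f (g y)) (df * dg).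
Proof. exact: is_derive1_comp. Qed.

Lemma deriveX1 (R : realType) (n : nat) (f : R -> R) (x df : R) :
  is_derive x 1 f df ->
  is_derive x 1 (fun y => f y ^+ n.+1) (n.+1%:R * f x ^+ n * df).
Proof.
move=> h; elim: n => [|n IHn]; first by rewrite expr0 mulr1 mul1r.
under eq_fun do rewrite exprS.
apply: is_derive_eq (deriveM1 h IHn) _.
by rewrite -[in RHS]natr1 !exprS; ring.
Qed.

Lemma deriveV1 (R : realType) (f : R -> R) (x df : R) :
  is_derive x 1 f df -> f x != 0 ->
  is_derive x 1 (fun y => (f y)^-1) (- (f x) ^- 2 * df).
Proof. by move=> h fx; exact: is_deriveV fx h. Qed.

Lemma derivable_continuous1 (R : realType) (f : R -> R) (x df : R) :
  is_derive x 1 f df -> {for x, continuous f}.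
Proof.
by move=> h; apply/differentiable_continuous/derivable1_diffP; exact: ex_derive.
Qed.

Lemma deriveS1 (R : realType) (I : Type) (r : seq I) (f : I -> R -> R)
    (df : I -> R) (x : R) :
  (forall i, is_derive x 1 (f i) (df i)) ->
  is_derive x 1 (fun y => \sum_(i <- r) f i y) (\sum_(i <- r) df i).
Proof.
move=> h; elim: r => [|i r IHr].
  by under eq_fun do rewrite big_nil; rewrite big_nil; exact: deriveC1.
by under eq_fun do rewrite big_cons; rewrite big_cons; exact: deriveD1.
Qed.

Lemma continuous_FTC2_is_derive (R : realType) (F f : R -> R) (a b : R) :
  a < b -> (forall x : R, is_derive x 1 F (f x)) -> continuous f ->
  (\int[lebesgue_measure]_(x in `[a, b]) (f x)%:E = (F b - F a)%:E)%E.
Proof.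
move=> ab dF cf.
rewrite (@continuous_FTC2 _ _ F)//.
- exact: continuous_subspaceT.
- split.
  + by move=> x _; exact: ex_derive.
  + by apply: cvg_at_right_filter; exact: derivable_continuous1 (dF a).
  + by apply: cvg_at_left_filter; exact: derivable_continuous1 (dF b).
- by move=> x _; rewrite derive1E; apply: derive_val.
Qed.

Lemma continuous_cos_sum (R : realType) (I : finType) (w c : I -> R) :
  continuous (fun u : R => \sum_i w i * cos (u * c i)).
Proof.
move=> u; apply: (@derivable_continuous1 _ _ _ (\sum_i w i * (- sin (u * c i) * (1 * c i + u * 0)))).
apply: deriveS1 => i; apply: deriveZ1; apply: deriveO1.
by apply: deriveM1.
Qed.

Lemma integral_cos_sum (R : realType) (I : finType) (w c : I -> R) (b : R) :
  0 < b -> (forall i, c i != 0 -> sin (b * c i) = 0) ->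
  (\int[lebesgue_measure]_(u in `[0%R, b]) (\sum_i w i * cos (u * c i))%:E)%E =
  (b * \sum_(i | c i == 0) w i)%:E.
Proof.
move=> b0 sc.
pose F (i : I) (u : R) := w i * (if c i == 0 then u else sin (u * c i) / c i).
have dF i (u : R) : is_derive u 1 (F i) (w i * cos (u * c i)).
  apply: deriveZ1; case: eqP => [->|/eqP c0].
    by rewrite mulr0 cos0; exact: is_derive_id.
  have h : is_derive u 1 (fun u : R => sin (u * c i) * (c i)^-1)
      (cos (u * c i) * (1 * c i + u * 0) * (c i)^-1 + sin (u * c i) * 0).
    apply: deriveM1.
    by apply: deriveO1; apply: deriveM1.
  by apply: is_derive_eq h _; rewrite !mulr0 !addr0 mul1r mulfK.
have dS (u : R) : is_derive u 1 (fun u => \sum_i F i u) (\sum_i w i * cos (u * c i)).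
  by apply: deriveS1.
rewrite (continuous_FTC2_is_derive b0 dS (@continuous_cos_sum _ _ w c)).
congr (_%:E); rewrite -sumrB mulr_sumr [RHS]big_mkcond/=; apply: eq_bigr => i _.
rewrite /F; case: ifPn => [|c0]; first by rewrite mulr0 subr0 mulrC.
by rewrite sc// [0 * c i]mul0r sin0 mul0r mulr0 subrr.
Qed.

Lemma sin_pi_int (R : realType) (m : int) : sin (pi * m%:~R) = 0 :> R.
Proof.
have h (k : nat) : sin (pi * k%:R) = 0 :> R.
  rewrite mulr_natr -[pi *+ k]add0r (alternatingn (@sinDpi R)).
  by rewrite sin0 mulr0.
by case: m => k; rewrite ?NegzE -?pmulrn ?rmorphN/= ?mulrN ?sinN h ?oppr0.
Qed.

(** Fourier inversion: by orthogonality, the integral of the cosine transform over [0, pi/nu] is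
    exactly pi w(n)/nu. The transform tends to e^(-u^2) and is dominated by B/(1+u^2), so the limit
    is the half Gaussian integral sqrt(pi)/2, and division by pi gives the constant. *)
Lemma local_limit (R : realType) (N : nat -> nat) (w : nat -> nat -> R)
    (nu : nat -> R) (B : R) :
  (forall n k, 0 <= w n k) -> (forall n, 0 < nu n) -> nu @ \oo --> 0 ->
  (\forall n \near \oo, (n < N n)%N) ->
  (forall s, (fun n => \sum_(k < N n) w n k * expR (s * (nu n * (k%:R - n%:R))))
     @ \oo --> expR (s ^+ 2)) ->
  (\forall n \near \oo, forall u, 0 <= u <= pi / nu n ->
     `|\sum_(k < N n) w n k * cos (u * (nu n * (k%:R - n%:R)))| <=
     B / oneDsqr u) ->
  (fun n => w n n / nu n) @ \oo --> (2 * Num.sqrt pi)^-1.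
Proof.
move=> w0 nu0 nucv nN mgf [n0 _ dom].
pose T n u := \sum_(k < N n) w n k * cos (u * (nu n * (k%:R - n%:R))).
pose D : set R := `[0%R, +oo[%classic.
(* The range of integration grows with n. Extension by zero puts every integral on the half line,
   and the shift by [n0] below makes the domination hold for every index. *)
pose f n : R -> \bar R := EFin \o (T n \_ `[0%R, pi / nu n]%classic).
have ctsT n : continuous (T n) by exact: continuous_cos_sum.
have cv : (\int[lebesgue_measure]_(x in D) f (n + n0)%N x @[n --> \oo] -->
   \int[lebesgue_measure]_(x in D) (gauss_fun x)%:E)%E.
  apply: (@dominated_cvg _ (measurableTypeR R) R (@lebesgue_measure R) D _ (fun n => f (n + n0)%N)
    (fun x => (gauss_fun x)%:E) (fun x => (`|B| * (oneDsqr x)^-1)%:E)).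
  - exact: measurable_itv.
  - move=> n; rewrite /D; apply/measurable_EFinP; apply/measurable_restrict => //.
    apply: measurable_funTS; exact: continuous_measurable_fun.
  - move=> x; rewrite /D/= in_itv/= andbT => x0.
    apply/fine_cvgP; split.
      by apply: nearW.
    have h : (fun n => T n x) @ \oo --> gauss_fun x.
      exact: (@sum_cos_cvg R N w (fun n k => nu n * (k%:R - n%:R)) x w0 mgf).
    rewrite -(cvg_shiftn n0) in h.
    apply: cvg_trans h; apply: near_eq_cvg; near=> n.
    rewrite /=/f patchE mem_set//= in_itv/= x0 ler_pdivlMr//.
    near: n.
    have : (fun n => x * nu (n + n0)%N) @ \oo --> x * 0.
      by apply: cvgMl_tmp; rewrite (cvg_shiftn n0 nu).
    rewrite mulr0 => /cvgr0_norm_le/(_ _ (pi_gt0 R)); apply: filterS => n.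
    by rewrite ger0_norm// mulr_ge0// ltW.
  - by [].
  - under eq_fun do rewrite EFinM.
    apply: integrableZl; first exact: measurable_itv.
    apply/integrableP; split.
      apply: measurable_funTS; apply/measurable_EFinP.
      by apply: continuous_measurable_fun; exact: continuous_oneDsqrV.
    under eq_integral do rewrite abse_EFin ger0_norm ?invr_ge0//.
    by rewrite integral0y_oneDsqr ltry.
  - move=> n x; rewrite /D/= in_itv/= andbT => x0.
    rewrite /f/= patchE; case: ifPn => [|_].
      rewrite inE/= in_itv/= => /andP[_ xle].
      rewrite lee_fin (le_trans (dom (n + n0)%N _ _ _))//=.
        by rewrite leq_addl.
      by rewrite x0.
      by rewrite ler_wpM2r ?ler_norm// invr_ge0.
    by rewrite normr0 lee_fin mulr_ge0// invr_ge0.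
rewrite integral0y_gauss (cvg_shiftn n0 (fun n => \int[lebesgue_measure]_(x in D) f n x)%E) in cv.
have intE : \forall n \near \oo, (\int[lebesgue_measure]_(x in D) f n x)%E =
    (pi * (w n n / nu n))%:E.
  near=> n.
  have nNn : (n < N n)%N by near: n.
  have b0 : 0 < pi / nu n by rewrite divr_gt0// pi_gt0.
  rewrite /f -restrict_EFin -integral_mkcondr (_ : D `&` _ = `[0%R, pi / nu n]%classic); last first.
    rewrite eqEsubset; split => x /=; first by case.
    by rewrite /D/= !in_itv/= => /andP[-> ->].
  rewrite /T/= integral_cos_sum//; last first.
    move=> k _; rewrite mulrA divfK ?gt_eqF//.
    rewrite -(@sin_pi_int _ (Posz k - Posz n)); congr (sin (pi * _)).
    by rewrite rmorphB/= -!pmulrn.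
  congr (_%:E); rewrite (big_pred1 (Ordinal nNn)) /=; last first.
    move=> k; rewrite mulf_eq0 gt_eqF//= subr_eq0 eqr_nat.
    by apply/eqP/eqP => [kn|->//]; exact: val_inj.
  by rewrite mulrAC mulrA.
have {}cv : (fun n => pi * (w n n / nu n)) @ \oo --> Num.sqrt pi / 2.
  have /fine_cvgP[_] := cv; apply: cvg_trans; apply: near_eq_cvg.
  by apply: filterS intE => n /= ->.
have pi0 : pi != 0 :> R by rewrite gt_eqF ?pi_gt0.
have -> : (2 * Num.sqrt pi)^-1 = pi^-1 * (Num.sqrt pi / 2) :> R.
  rewrite -[X in _ = X^-1 * _](@sqr_sqrtr _ pi) ?pi_ge0//; field.
  by rewrite gt_eqF// sqrtr_gt0 pi_gt0.
have h : (fun n => pi^-1 * (pi * (w n n / nu n))) @ \oo --> pi^-1 * (Num.sqrt pi / 2).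
  exact: cvgMl_tmp.
by apply: cvg_trans h; apply: near_eq_cvg; apply: nearW => n; rewrite /= mulKf.
Unshelve. all: by end_near. Qed.

(** * The midpoint rule and Stirling's formula *)

Lemma mean_value (R : realType) (f df : R -> R) (a b : R) : a < b ->
  (forall y, a <= y <= b -> is_derive y 1 f (df y)) ->
  exists2 c, a < c < b & f b - f a = df c * (b - a).
Proof.
move=> ab d.
have [||c] := @MVT R f df a b ab.
- by move=> y; rewrite in_itv/= => /andP[ay yb]; apply: d; rewrite !ltW.
- apply: derivable_within_continuous => y; rewrite in_itv/= => h.
  by have := d _ h => -[].
by rewrite in_itv/= => cab e; exists c.
Qed.

(** The derivative of G(x+v) - G(x-v) in v is g(x+v) + g(x-v), which by the symmetric convexity
    hypothesis lies between its values at v = 0 and v = h; the mean value theorem does the rest. *)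
Lemma midpoint_error (R : realType) (G g : R -> R) (x h : R) : 0 < h ->
  (forall y, x - h <= y <= x + h -> is_derive y 1 G (g y)) ->
  (forall u v, 0 <= u -> u <= v -> v <= h ->
     g (x - u) + g (x + u) <= g (x - v) + g (x + v)) ->
  0 <= G (x + h) - G (x - h) - 2 * h * g x <=
  h * (g (x - h) + g (x + h) - 2 * g x).
Proof.
move=> h0 dG cvx.
have d y : 0 <= y <= h ->
    is_derive y 1 (fun v => G (x + v) - G (x - v)) (g (x + y) + g (x - y)).
  move=> yh.
  have h1 : is_derive y 1 (fun v => G (x + v)) (g (x + y) * (0 + 1)).
    by apply: deriveO1; apply: dG; lra.
  have h2 : is_derive y 1 (fun v => G (x - v)) (g (x - y) * (0 - 1)).
    by apply: deriveO1; apply: dG; lra.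
  apply: is_derive_eq (deriveB1 h1 h2) _; ring.
have [c ch] := mean_value h0 d.
rewrite !(addr0, subr0) subrr subr0 => ->.
have := cvx 0 c; have := cvx c h; rewrite addr0 subr0.
move=> /(_ _ _ _) h1 /(_ _ _ _) h2.
have {}h1 : g (x - c) + g (x + c) <= g (x - h) + g (x + h) by apply: h1; lra.
have {}h2 : g x + g x <= g (x - c) + g (x + c) by apply: h2; lra.
by apply/andP; split; nra.
Qed.

(** * Wallis integrals and the constant in Stirling's formula *)

Definition wallis (R : realType) (m : nat) : R :=
  (\int[lebesgue_measure]_(x in `[0%R, pi]) (sin x ^+ m))%R.

Lemma continuous_sinX (R : realType) m : continuous (fun x : R => sin x ^+ m).
Proof.
case: m => [|m] x; first by under [X in continuous_at _ X]eq_fun do rewrite expr0; exact: cst_continuous.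
by apply: (@derivable_continuous1 _ _ _ (m.+1%:R * sin x ^+ m * cos x)); exact: deriveX1.
Qed.

Lemma integrable_sinX (R : realType) (c : R) m :
  lebesgue_measure.-integrable `[0%R, pi] (EFin \o (fun x : R => c * sin x ^+ m)).
Proof.
apply: continuous_compact_integrable; first exact: segment_compact.
by apply: continuous_subspaceT => x; apply: cvgMl_tmp; exact: continuous_sinX.
Qed.

Lemma integrable_sinX1 (R : realType) m :
  lebesgue_measure.-integrable `[0%R, pi] (EFin \o (fun x : R => sin x ^+ m)).
Proof.
rewrite (_ : (fun x => sin x ^+ m) = fun x => 1 * sin x ^+ m).
  exact: integrable_sinX.
by apply/funext => x; rewrite mul1r.
Qed.

(** The difference of the two sides is the integral of the derivative of cos x sin^(m+1) x, a
    function vanishing at 0 and at pi. *)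
Lemma wallisS (R : realType) m :
  m.+1%:R * wallis R m = m.+2%:R * wallis R m.+2.
Proof.
apply/eqP; rewrite -subr_eq0; apply/eqP.
rewrite /wallis -!RintegralZl//; try exact: integrable_sinX1.
rewrite -RintegralB//; last 2 first.
  exact: integrable_sinX.
  exact: integrable_sinX.
have d (x : R) : is_derive x 1 (fun x => cos x * sin x ^+ m.+1)
   (m.+1%:R * sin x ^+ m - m.+2%:R * sin x ^+ m.+2).
  have dX : is_derive x 1 (fun x : R => sin x ^+ m.+1) (m.+1%:R * sin x ^+ m * cos x).
    exact: deriveX1.
  apply: is_derive_eq (deriveM1 (is_derive_cos x) dX) _.
  rewrite mulrA [cos x * _]mulrC -mulrA -mulrA -expr2 cos2sin2 !exprS -natr1.
  by ring.
rewrite /Rintegral (continuous_FTC2_is_derive (pi_gt0 R) d).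
  by rewrite sinpi sin0 !expr0n !mulr0 subrr.
move=> x; apply: cvgB; apply: cvgMl_tmp; exact: continuous_sinX.
Qed.

Lemma wallis_le (R : realType) m : wallis R m.+1 <= wallis R m.
Proof.
apply: le_Rintegral => //; try exact: integrable_sinX1.
move=> x; rewrite /= in_itv/= => xpi.
by rewrite exprSr ler_piMr ?sin_le1// exprn_ge0// sin_ge0_pi.
Qed.

Lemma wallis0 (R : realType) : wallis R 0 = pi.
Proof.
have d (x : R) : is_derive x 1 id (sin x ^+ 0) by exact: is_derive_id.
rewrite /wallis /Rintegral (continuous_FTC2_is_derive (pi_gt0 R) d) ?subr0//.
exact: continuous_sinX.
Qed.

Lemma wallis1 (R : realType) : wallis R 1 = 2.
Proof.
have d (x : R) : is_derive x 1 (fun x => - cos x) (sin x ^+ 1).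
  by apply: is_derive_eq (deriveN1 (is_derive_cos x)) _; rewrite opprK.
rewrite /wallis /Rintegral (continuous_FTC2_is_derive (pi_gt0 R) d) ?subr0//.
  by rewrite cospi cos0 /=; ring.
exact: continuous_sinX.
Qed.

Lemma wallis_prod (R : realType) m :
  m.+1%:R * (wallis R m * wallis R m.+1) = 2 * pi.
Proof.
elim: m => [|m IHm]; first by rewrite wallis0 wallis1 mul1r mulrC.
by rewrite mulrCA -wallisS mulrCA [wallis _ _ * _]mulrC IHm.
Qed.

Lemma wallis_gt0 (R : realType) m : 0 < wallis R m.
Proof.
have ge0 k : 0 <= wallis R k.
  by apply: Rintegral_ge0 => x; rewrite /= in_itv/= => xpi; rewrite exprn_ge0// sin_ge0_pi.
rewrite lt_neqAle ge0 andbT; apply/eqP => m0.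
have := wallis_prod R m; rewrite -m0 mul0r mulr0 => /esym/eqP.
by rewrite mulf_eq0 pnatr_eq0/= gt_eqF// pi_gt0.
Qed.

Lemma wallis_even (R : realType) n :
  wallis R n.*2 * (4 ^+ n * n`!%:R ^+ 2) = pi * (n.*2)`!%:R.
Proof.
elim: n => [|n IHn]; first by rewrite double0 fact0 expr0 expr1n !mulr1 wallis0.
rewrite doubleS; apply: (@mulfI _ (n.*2.+2%:R)); first by rewrite pnatr_eq0.
rewrite [LHS]mulrA -wallisS !factS exprS !natrM.
transitivity (n.*2.+1%:R * (4 * n.+1%:R ^+ 2) * (wallis R n.*2 * (4 ^+ n * n`!%:R ^+ 2))).
  by ring.
rewrite IHn (_ : 4 * n.+1%:R ^+ 2 = n.*2.+2%:R * n.*2.+2%:R); first by ring.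
by rewrite -doubleS -mul2n natrM; ring.
Qed.

(** In [wallis_prod] the odd integral is squeezed between its two even neighbours, whose ratio is
    known from [wallisS]. *)
Lemma wallis_bounds (R : realType) n :
  2 * pi <= n.*2.+1%:R * wallis R n.*2 ^+ 2 <= 2 * pi * (1 + n.*2.+1%:R^-1).
Proof.
have n0 : (0 : R) < n.*2.+1%:R by rewrite ltr0n.
have w0 := wallis_gt0 R n.*2; have w1 := wallis_gt0 R n.*2.+1.
have p := wallis_prod R n.*2.
have l1 := wallis_le R n.*2; have l2 := wallis_le R n.*2.+1.
apply/andP; split.
  by rewrite -p ler_pM2l// expr2 ler_pM2l.
have e := wallisS R n.*2.
rewrite -p -mulrA ler_pM2l// expr2 -mulrA ler_pM2l//.
apply: (@le_trans _ _ (wallis R n.*2.+2 * (1 + n.*2.+1%:R^-1))); last first.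
  by rewrite ler_pM2r// addr_gt0// invr_gt0.
have -> : wallis R n.*2.+2 = n.*2.+1%:R / n.*2.+2%:R * wallis R n.*2.
  by rewrite mulrAC e mulrAC mulfV ?mul1r// pnatr_eq0.
rewrite -[n.*2.+2]addn1 natrD.
rewrite le_eqVlt; apply/orP; left; apply/eqP; field.
have h : (0 : R) <= n.*2%:R by [].
by apply/andP; split; apply: lt0r_neq0; lra.
Qed.

Lemma cvg_invn (R : realType) : (fun n => (n.+1%:R)^-1 : R) @ \oo --> (0 : R).
Proof. exact: cvg_harmonic. Qed.

Lemma ln_ge_1BV (R : realType) (x : R) : 0 < x -> 1 - x^-1 <= ln x.
Proof.
move=> x0; have := @le_ln1Dx R (x^-1 - 1); rewrite addrCA subrr addr0 lnV//.
have : 0 < x^-1 by rewrite invr_gt0.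
by move=> ? /(_ _); lra.
Qed.

Lemma ln_le_B1 (R : realType) (x : R) : 0 < x -> ln x <= x - 1.
Proof.
by move=> x0; have := @le_ln1Dx R (x - 1); rewrite addrCA subrr addr0; apply; lra.
Qed.

Lemma is_derive_lnx (R : realType) (y : R) : 0 < y ->
  is_derive y 1 (fun x => x - x * ln x) (- ln y).
Proof.
move=> y0; have h := deriveM1 (is_derive_id y 1) (is_derive1_ln y0).
apply: is_derive_eq (deriveB1 (is_derive_id y 1) h) _.
by rewrite mulfV ?gt_eqF//; ring.
Qed.

(** Difference between ln n! and the integral of ln over [0, n + 1/2]: the accumulated error of the
    midpoint rule at the integers. *)
Definition stirling_seq (R : realType) (n : nat) : R :=
  ln n`!%:R + ((n%:R + 2^-1) - (n%:R + 2^-1) * ln (n%:R + 2^-1)).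

(** Midpoint rule for the convex function -ln on [n + 1/2, n + 3/2]. The upper bound is a
    telescoping difference, so the sequence is monotone and bounded. *)
Lemma stirling_seqS (R : realType) n : 0 <= stirling_seq R n.+1 - stirling_seq R n
  <= 8^-1 / (n%:R + 2^-1) - 8^-1 / (n.+1%:R + 2^-1).
Proof.
have n0 : (0 : R) <= n%:R by [].
have h2 : (0 : R) < 2^-1 by lra.
have S : n.+1%:R = n%:R + 1 :> R by rewrite natr1.
have dG (y : R) : n.+1%:R - 2^-1 <= y <= n.+1%:R + 2^-1 ->
    is_derive y 1 (fun x : R => x - x * ln x) (- ln y).
  by rewrite S => yb; apply: is_derive_lnx; lra.
have cvx (u v : R) : 0 <= u -> u <= v -> v <= 2^-1 ->
   - ln (n.+1%:R - u) - ln (n.+1%:R + u) <= - ln (n.+1%:R - v) - ln (n.+1%:R + v) :> R.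
  rewrite S => u0 uv vh; rewrite -!opprD lerN2 -!lnM ?posrE; try lra.
  by rewrite ler_ln ?posrE; nra.
have := midpoint_error h2 dG cvx.
have x0 : (0 : R) < n%:R + 2^-1 by lra.
have -> : stirling_seq R n.+1 - stirling_seq R n = n.+1%:R + 2^-1 -
    (n.+1%:R + 2^-1) * ln (n.+1%:R + 2^-1) - (n.+1%:R - 2^-1 -
    (n.+1%:R - 2^-1) * ln (n.+1%:R - 2^-1)) - 2 * 2^-1 * - ln n.+1%:R :> R.
  rewrite /stirling_seq factS natrM lnM ?posrE ?ltr0n ?fact_gt0//.
  by rewrite S (_ : n%:R + 1 - 2^-1 = n%:R + 2^-1 :> R); lra.
move=> /andP[-> /=] /le_trans; apply.
set z : R := n%:R in x0 n0 S *.
have -> : - ln (n.+1%:R - 2^-1) - ln (n.+1%:R + 2^-1) - 2 * - ln n.+1%:R =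
    ln ((z + 1) ^+ 2 / ((z + 2^-1) * (z + 1 + 2^-1))) :> R.
  rewrite ln_div ?lnM ?expr2 ?lnM ?posrE; try nra.
  by rewrite S (_ : z + 1 - 2^-1 = z + 2^-1); lra.
apply: (@le_trans _ _ (2^-1 * ((z + 1) ^+ 2 / ((z + 2^-1) * (z + 1 + 2^-1)) - 1))).
  rewrite ler_pM2l//; apply: ln_le_B1; rewrite divr_gt0 ?exprn_gt0 ?mulr_gt0//; lra.
rewrite S le_eqVlt; apply/orP; left; apply/eqP; field; rewrite -!natr1.
by apply/andP; split; apply: lt0r_neq0; lra.
Qed.

Lemma cvg_half_ln (R : realType) :
  (fun n => (n.*2%:R + 2^-1) * ln ((n.*2%:R + 2^-1) / n.*2.+1%:R) : R) @ \oo -->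
  (- 2^-1 : R).
Proof.
apply: (@squeeze_cvgn _ (fun=> - 2^-1) _
  (fun n => - 2^-1 + 4^-1 * n.*2.+1%:R^-1)).
- apply: nearW => n.
  have n0 : (0 : R) <= n.*2%:R by [].
  have -> : n.*2.+1%:R = n.*2%:R + 1 :> R by rewrite natr1.
  set z : R := n.*2%:R in n0 *.
  have z1 : 0 < z + 2^-1 by lra.
  have q0 : 0 < (z + 2^-1) / (z + 1) by rewrite divr_gt0//; lra.
  apply/andP; split.
    have h := ler_wpM2l (ltW z1) (ln_ge_1BV q0); apply: le_trans h.
    rewrite le_eqVlt; apply/orP; left; apply/eqP; field.
    by apply/andP; split; apply: lt0r_neq0; lra.
  have h := ler_wpM2l (ltW z1) (ln_le_B1 q0); apply: (le_trans h).
  rewrite le_eqVlt; apply/orP; left; apply/eqP; field.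
  by apply: lt0r_neq0; lra.
- exact: cvg_cst.
- rewrite -[X in _ --> X]addr0 -[X in _ --> _ + X](mulr0 4^-1).
  apply: cvgD; first exact: cvg_cst.
  apply: cvgMl_tmp.
  apply: (@squeeze_cvgn _ (fun=> 0) _ (fun n => n.+1%:R^-1)).
  + apply: nearW => n; rewrite invr_ge0 ler0n/= lef_pV2 ?posrE ?ltr0n//.
    by rewrite ler_nat ltnS -addnn leq_addr.
  + exact: cvg_cst.
  + exact: cvg_invn.
Qed.

Lemma cvg_comp_double (R : realType) (u : nat -> R) (l : R) :
  u @ \oo --> l -> (fun n => u n.*2) @ \oo --> l.
Proof.
apply: cvg_comp => P [N _ PN]; exists N => // n /= Nn; apply: PN => /=.
by rewrite (leq_trans Nn)// -addnn leq_addr.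
Qed.

(** Once a limit L exists, 2 a(n) - a(2n) also tends to L; in this combination the factorials form a
    central binomial coefficient, which [wallis_even] expresses by a Wallis integral. *)
Lemma stirling_cvg (R : realType) :
  stirling_seq R @ \oo --> ln (2 * pi) / 2.
Proof.
have [L aL] : exists L : R, stirling_seq R @ \oo --> L.
  apply/cvg_ex; apply: nondecreasing_is_cvgn.
    by apply/nondecreasing_seqP => n; have /andP[] := stirling_seqS R n; lra.
  exists (stirling_seq R 0 + 8^-1 / (0%:R + 2^-1)) => _ [n _ <-].
  suff : stirling_seq R n + 8^-1 / (n%:R + 2^-1) <=
      stirling_seq R 0 + 8^-1 / (0%:R + 2^-1).
    apply: le_trans; rewrite lerDl divr_ge0// addr_ge0//.
  elim: n => // n; apply: le_trans.
  by have /andP[_] := stirling_seqS R n; lra.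
have pi0 := pi_gt0 R.
have a2L : (fun n => 2 * stirling_seq R n - stirling_seq R n.*2) @ \oo --> L.
  rewrite [X in _ --> X](_ : L = 2 * L - L); last by ring.
  by apply: cvgB; [exact: cvgMl_tmp|exact: cvg_comp_double].
have wcv : (fun n => n.*2.+1%:R * wallis R n.*2 ^+ 2) @ \oo --> 2 * pi.
  apply: (@squeeze_cvgn _ (fun=> 2 * pi) _ (fun n => 2 * pi * (1 + n.*2.+1%:R^-1))).
  - by apply: nearW => n; exact: wallis_bounds.
  - exact: cvg_cst.
  - rewrite [X in _ --> X](_ : _ = 2 * pi * (1 + 0)); last by ring.
    apply: cvgMl_tmp; apply: cvgD; first exact: cvg_cst.
    exact: (@cvg_comp_double _ (fun n => n.+1%:R^-1) 0 (@cvg_invn R)).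
have lwcv : (fun n => ln (n.*2.+1%:R * wallis R n.*2 ^+ 2)) @ \oo --> ln (2 * pi).
  apply: continuous_cvg => //; apply: continuous_ln; lra.
have E n : 2 * stirling_seq R n - stirling_seq R n.*2 =
   ln pi + ln 2 - 2^-1 * ln (n.*2.+1%:R * wallis R n.*2 ^+ 2) + 2^-1 +
   (n.*2%:R + 2^-1) * ln ((n.*2%:R + 2^-1) / n.*2.+1%:R).
  have n0 : (0 : R) <= n%:R by [].
  have w0 := wallis_gt0 R n.*2.
  have f0 k : (0 : R) < k`!%:R by rewrite ltr0n fact_gt0.
  have S : n.*2.+1%:R = 2 * (n%:R + 2^-1) :> R.
    by rewrite -natr1 -muln2 natrM; field.
  have D : n.*2%:R = 2 * n%:R :> R by rewrite -mul2n natrM.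
  have p1 : (0 : R) < 4 ^+ n by rewrite exprn_gt0.
  have p2 : (0 : R) < n`!%:R ^+ 2 by rewrite exprn_gt0.
  have W : ln (wallis R n.*2) + (ln 2 *+ 2 *+ n + ln n`!%:R *+ 2) =
      ln pi + ln (n.*2)`!%:R :> R.
    rewrite -!lnXn ?exprn_gt0//.
    rewrite (_ : 2 ^+ 2 = 4 :> R); last by ring.
    rewrite -[in LHS]lnM ?posrE// -[in LHS]lnM ?posrE ?mulr_gt0//.
    by rewrite wallis_even lnM ?posrE.
  rewrite /stirling_seq S D ln_div ?posrE; try lra.
  rewrite !lnM ?posrE ?exprn_gt0 ?lnXn//; try lra.
have b : (fun n => 2 * stirling_seq R n - stirling_seq R n.*2) @ \oo --> ln (2 * pi) / 2.
  under eq_fun do rewrite E.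
  rewrite (_ : ln (2 * pi) / 2 = ln pi + ln 2 - 2^-1 * ln (2 * pi) + 2^-1 + - 2^-1).
    apply: cvgD; last exact: cvg_half_ln.
    apply: cvgD; last exact: cvg_cst.
    by apply: cvgB; [exact: cvg_cst|exact: cvgMl_tmp].
  by rewrite lnM ?posrE//; field.
by rewrite -(cvg_unique _ a2L b).
Qed.

(** * The dilogarithm and a primitive of the logarithm of the factors *)

Lemma sin_le_id (R : realType) (x : R) : 0 < x -> sin x <= x.
Proof.
move=> x0; have d (y : R) : 0 <= y <= x -> is_derive y 1 sin (cos y).
  by move=> _; exact: is_derive_sin.
have [c _] := mean_value x0 d; rewrite sin0 !subr0 => ->.
by rewrite ger_pMl// cos_le1.
Qed.

Lemma id_le_tan (R : realType) (x : R) : 0 < x < pi / 2 -> x <= tan x.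
Proof.
move=> /andP[x0 xpi].
have c0 (y : R) : 0 <= y <= x -> 0 < cos y.
  by move=> yx; apply: cos_gt0_pihalf; have := pi_gt0 R; lra.
have d (y : R) : 0 <= y <= x -> is_derive y 1 tan ((cos y)^-2).
  by move=> yx; apply: is_derive_tan; rewrite gt_eqF// c0.
have [c cx] := mean_value x0 d; rewrite tan0 !subr0 => ->.
have cc : 0 < cos c by apply: c0; lra.
rewrite ler_peMl ?(ltW x0)// invf_ge1 ?exprn_gt0//.
all: by rewrite expr_le1// ?cos_le1// ltW.
Qed.

(** This is sin x <= x <= tan x, read through 1/sin^2 = 1 + cot^2. *)
Lemma inv_sin2_bounds (R : realType) (x : R) : 0 < x < pi / 2 ->
  (x ^+ 2)^-1 <= (sin x ^+ 2)^-1 <= 1 + (x ^+ 2)^-1.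
Proof.
move=> xpi; have /andP[x0 x1] := xpi.
have s0 : 0 < sin x by exact: sin_gt0_pihalf.
have c0 : 0 < cos x by apply: cos_gt0_pihalf; lra.
have h1 := sin_le_id x0; have := id_le_tan xpi.
rewrite /tan ler_pdivlMr// => h2.
rewrite lef_pV2 ?posrE ?exprn_gt0// lerXn2r ?nnegrE ?(ltW s0) ?(ltW x0) ?h1//=.
have -> : (sin x ^+ 2)^-1 = 1 + (cos x / sin x) ^+ 2.
  transitivity ((cos x ^+ 2 + sin x ^+ 2) / sin x ^+ 2).
    by rewrite cos2Dsin2 mul1r.
  by rewrite expr_div_n; field; rewrite gt_eqF.
rewrite lerD2l -exprVn lerXn2r ?nnegrE ?divr_ge0 ?invr_ge0 ?(ltW s0) ?(ltW x0) ?(ltW c0)//.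
by rewrite ler_pdivrMr// [leRHS]mulrC ler_pdivlMr// mulrC.
Qed.

Lemma inv_sin2_half (R : realType) (x : R) : 0 < x < pi ->
  (sin (x / 2) ^+ 2)^-1 + (sin ((pi - x) / 2) ^+ 2)^-1 = 4 * (sin x ^+ 2)^-1.
Proof.
move=> xpi; have -> : (pi - x) / 2 = - (x / 2) + pi / 2 by field.
rewrite sinDpihalf cosN.
have -> : sin x = 2 * (cos (x / 2) * sin (x / 2)).
  by rewrite mulr_natl -sin_mulr2n; congr sin; rewrite -mulr_natr; field.
have s0 : 0 < sin (x / 2) by apply: sin_gt0_pihalf; lra.
have c0 : 0 < cos (x / 2) by apply: cos_gt0_pihalf; lra.
have /(canRL (addrK _)) e := cos2Dsin2 (x / 2).
transitivity ((cos (x / 2) ^+ 2 + sin (x / 2) ^+ 2) / (cos (x / 2) * sin (x / 2)) ^+ 2).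
  by field; rewrite !gt_eqF.
by rewrite cos2Dsin2; field; rewrite !gt_eqF.
Qed.

Lemma sum_fold (V : nmodType) (M : nat) (F : nat -> V) :
  \sum_(0 <= k < M + M) F k = \sum_(0 <= k < M) (F k + F (M + M - k.+1)%N).
Proof.
rewrite (big_cat_nat (n := M))//= ?leq_addr// big_split/=; congr (_ + _).
rewrite big_nat_rev/= -{1}[M]add0n big_addn addnK.
by apply: eq_big_nat => i /andP[_ iM]; congr F; lia.
Qed.

(** Folding the sum for [n.+1] pairs each index with its mirror image, giving the angles x/2 and
    (pi-x)/2 for x an angle of the sum for [n]; by [inv_sin2_half] the sum is multiplied by 4. *)
Lemma sum_inv_sin2 (R : realType) n : \sum_(0 <= k < 2 ^ n)
  (sin (pi * k.*2.+1%:R / 2 ^+ n.+2 : R) ^+ 2)^-1 = 2 * 4 ^+ n.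
Proof.
have p := pi_gt0 R.
elim: n => [|n IHn].
  rewrite expn0 big_nat1 expr0 mulr1 double0.
  have e : (pi * 1 / 2 ^+ 2 : R) = (pi / 2) / 2 by field.
  have h : (0 < (pi / 2 : R)) && ((pi / 2 : R) < pi) by lra.
  have := inv_sin2_half h; rewrite sin_pihalf expr1n invr1 e.
  by rewrite (_ : (pi - pi / 2) / 2 = pi / 2 / 2 :> R); [lra|field].
rewrite expnS mul2n -addnn sum_fold [4 ^+ n.+1]exprS mulrCA -IHn mulr_sumr.
apply: eq_big_nat => k /andP[_ kn].
have k2 : (k.*2.+1 < 2 ^ n.+2)%N by rewrite !expnS; lia.
have q : (0 : R) < 2 ^+ n.+2 by rewrite exprn_gt0.
have x1 : (0 < (pi * k.*2.+1%:R / 2 ^+ n.+2 : R)) && ((pi * k.*2.+1%:R / 2 ^+ n.+2 : R) < pi).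
  apply/andP; split; first by rewrite divr_gt0// mulr_gt0// ltr0n.
  by rewrite ltr_pdivrMr// ltr_pM2l// -natrX ltr_nat.
rewrite -(inv_sin2_half x1); congr ((sin _ ^+ 2)^-1 + (sin _ ^+ 2)^-1).
  by rewrite [2 ^+ n.+3]exprS invfM [2^-1 * _]mulrC mulrA.
have -> : ((2 ^ n + 2 ^ n - k.+1).*2.+1 = 2 ^ n.+2 - k.*2.+1)%N by rewrite !expnS; lia.
rewrite natrB 1?ltnW// natrX [2 ^+ n.+3]exprS; field.
by rewrite gt_eqF.
Qed.

(** At the 2^n angles of [sum_inv_sin2], replacing 1/sin^2 by 1/x^2 changes each term by at most 1,
    hence the sum 2 * 4^n by at most 2^n. *)
Lemma sum_inv_odd_sqr_bounds (R : realType) n :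
  (pi ^+ 2 / 8 - pi ^+ 2 / 16 * 2^-1 ^+ n : R) <=
  \sum_(0 <= k < 2 ^ n) (k.*2.+1%:R ^+ 2)^-1 <= (pi ^+ 2 / 8 : R).
Proof.
have p := pi_gt0 R.
pose x k : R := pi * k.*2.+1%:R / 2 ^+ n.+2.
have q : (0 : R) < 2 ^+ n.+2 by rewrite exprn_gt0.
have q4 : (0 : R) < 4 ^+ n by rewrite exprn_gt0.
have e42 : 4 ^+ n = 2 ^+ n * 2 ^+ n :> R by rewrite -exprMn; congr (_ ^+ _); ring.
have xb k : (k < 2 ^ n)%N -> 0 < x k < pi / 2.
  move=> kn; apply/andP; split; first by rewrite divr_gt0// mulr_gt0// ltr0n.
  rewrite ltr_pdivrMr// -mulrA ltr_pM2l//.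
  rewrite exprS mulKf// -natrX ltr_nat expnS; lia.
have E : \sum_(0 <= k < 2 ^ n) (k.*2.+1%:R ^+ 2)^-1 =
    pi ^+ 2 / (16 * 4 ^+ n) * \sum_(0 <= k < 2 ^ n) (x k ^+ 2)^-1 :> R.
  rewrite mulr_sumr; apply: eq_bigr => k _.
  have k0 : (0 : R) < k.*2.+1%:R by rewrite ltr0n.
  have e2 : 2 ^+ n.+2 = 4 * 2 ^+ n :> R by rewrite 2!exprS; ring.
  have a0 : (0 : R) < 2 ^+ n by rewrite exprn_gt0.
  have id (P u v : R) : 0 < P -> 0 < u -> 0 < v ->
      (v ^+ 2)^-1 = P ^+ 2 / (16 * (u * u)) * ((P * v / (4 * u)) ^+ 2)^-1.
    by move=> P0 u0 v0; field; rewrite !gt_eqF.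
  by rewrite /x e2 e42; exact: id.
have S := sum_inv_sin2 R n.
have u : \sum_(0 <= k < 2 ^ n) (x k ^+ 2)^-1 <= 2 * 4 ^+ n.
  rewrite -S [leLHS]big_nat [leRHS]big_nat; apply: ler_sum => k /andP[_ kn].
  by have /andP[] := inv_sin2_bounds (xb _ kn).
have l : 2 * 4 ^+ n <= 2 ^+ n + \sum_(0 <= k < 2 ^ n) (x k ^+ 2)^-1.
  have -> : 2 ^+ n = \sum_(0 <= k < 2 ^ n) 1 :> R.
    by rewrite big_const_nat subn0 iter_addr_0 natrX.
  rewrite -S -big_split/= [leLHS]big_nat [leRHS]big_nat.
  apply: ler_sum => k /andP[_ kn].
  by have /andP[] := inv_sin2_bounds (xb _ kn).
have c0 : 0 < pi ^+ 2 / (16 * 4 ^+ n) :> R by rewrite divr_gt0 ?exprn_gt0// mulr_gt0.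
have a0 : (0 : R) < 2 ^+ n by rewrite exprn_gt0.
have id1 (P v : R) : 0 < v ->
    P ^+ 2 / 8 - P ^+ 2 / 16 * v^-1 = P ^+ 2 / (16 * (v * v)) * (2 * (v * v) - v).
  by move=> v0; field; rewrite gt_eqF.
have id2 (P v : R) : 0 < v -> P ^+ 2 / 8 = P ^+ 2 / (16 * v) * (2 * v).
  by move=> v0; field; rewrite gt_eqF.
rewrite E exprVn; apply/andP; split; last by rewrite (id2 _ _ q4) ler_pM2l.
by rewrite (id1 _ _ a0) -e42 ler_pM2l//; lra.
Qed.

Lemma sum_inv_sqr_double (R : realType) N :
  \sum_(0 <= k < N.*2) (k.+1%:R ^+ 2)^-1 =
  \sum_(0 <= k < N) (k.*2.+1%:R ^+ 2)^-1 +
  4^-1 * \sum_(0 <= k < N) (k.+1%:R ^+ 2)^-1 :> R.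
Proof.
elim: N => [|N IHN]; first by rewrite !big_geq// mulr0 addr0.
rewrite doubleS !big_nat_recr//= IHN mulrDr.
have -> : (N.*2.+2%:R ^+ 2)^-1 = 4^-1 * (N.+1%:R ^+ 2)^-1 :> R.
  by rewrite -doubleS -mul2n natrM exprMn invfM; congr (_^-1 * _); ring.
ring.
Qed.

(** Splitting by parity of the denominators gives L = pi^2/8 + L/4. The same splitting bounds the
    partial sums, and limits are taken along powers of 2, where the odd sums are controlled. *)
Lemma zeta2 (R : realType) :
  series (fun k => (k.+1%:R ^+ 2)^-1) @ \oo --> (pi ^+ 2 / 6 : R).
Proof.
pose T N : R := \sum_(0 <= k < N) (k.+1%:R ^+ 2)^-1.
pose O N : R := \sum_(0 <= k < N) (k.*2.+1%:R ^+ 2)^-1.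
have T0 i : 0 <= (i.+1%:R ^+ 2 : R)^-1 by rewrite invr_ge0 exprn_ge0.
have ndT : nondecreasing_seq T.
  by apply/nondecreasing_seqP => i; rewrite /T big_nat_recr//= lerDl.
have ndO : nondecreasing_seq O.
  by apply/nondecreasing_seqP => i; rewrite /O big_nat_recr//= lerDl invr_ge0 exprn_ge0.
have Ole N : O N <= pi ^+ 2 / 8.
  have /andP[_] := sum_inv_odd_sqr_bounds R N; apply: le_trans.
  by apply: ndO; rewrite ltnW// ltn_expl.
have Tle N : T N <= pi ^+ 2 / 6.
  have h := sum_inv_sqr_double R N; have o := Ole N.
  have : T N <= T N.*2 by apply: ndT; rewrite -addnn leq_addr.
  rewrite -/(T _) -/(O _) -/(T _) in h; rewrite h; lra.
have [L TL] : exists L : R, T @ \oo --> L.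
  by apply/cvg_ex; apply: nondecreasing_is_cvgn => //; exists (pi ^+ 2 / 6) => _ [n _ <-].
have p2 : (fun n => (2 ^ n)%N) @ \oo --> \oo.
  move=> P [N _ PN]; exists N => // n /= Nn; apply: PN => /=.
  by rewrite (leq_trans Nn)// ltnW// ltn_expl.
have O2 : (fun n => O (2 ^ n)%N) @ \oo --> pi ^+ 2 / 8.
  apply: (@squeeze_cvgn _ (fun n => pi ^+ 2 / 8 - pi ^+ 2 / 16 * 2^-1 ^+ n) _ (fun=> pi ^+ 2 / 8)).
  - by apply: nearW => n; exact: sum_inv_odd_sqr_bounds.
  - rewrite [X in _ --> X](_ : _ = pi ^+ 2 / 8 - pi ^+ 2 / 16 * 0); last by ring.
    apply: cvgB; first exact: cvg_cst.
    by apply: cvgMl_tmp; apply: cvg_expr; rewrite ger0_norm; lra.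
  - exact: cvg_cst.
have T1 : (fun n => T (2 ^ n)%N) @ \oo --> L by apply: cvg_comp TL.
have T2 : (fun n => T (2 ^ n).*2%N) @ \oo --> L.
  apply: cvg_comp TL; move=> P [N _ PN]; exists N => // n /= Nn; apply: PN => /=.
  by have := ltn_expl n (ltnSn 1); lia.
have T3 : (fun n => T (2 ^ n).*2%N) @ \oo --> pi ^+ 2 / 8 + 4^-1 * L.
  under eq_fun do rewrite /T sum_inv_sqr_double.
  by apply: cvgD => //; exact: cvgMl_tmp.
have e : L = pi ^+ 2 / 8 + 4^-1 * L by exact: (cvg_unique _ T2 T3).
have <- : L = pi ^+ 2 / 6 by move: e; set P : R := pi ^+ 2; lra.
exact: TL.
Qed.

(** * The dilogarithm on [0, 1) *)

Lemma bounded_pseries_cvg (R : realType) (c : nat -> R) (x : R) :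
  (forall k, `|c k| <= 1) -> `|x| < 1 -> cvgn (pseries c x).
Proof.
move=> c1 x1; apply: normed_cvg.
apply: (@series_le_cvg _ _ (fun k => `|x| ^+ k)).
- by move=> k /=.
- by move=> k /=; rewrite exprn_ge0.
- by move=> k /=; rewrite normrM normrX ler_piMl ?exprn_ge0.
- have := @is_cvg_geometric_series R 1 `|x|; rewrite normr_id => /(_ x1).
  by rewrite /geometric/=; under eq_fun do rewrite mul1r.
Qed.

(** The term of index 0 vanishes because the inverse of 0 is 0, so this is the usual series of
    Li_2. *)
Definition dilog (R : realType) (x : R) : R :=
  limn (pseries (fun k => (k%:R ^+ 2)^-1) x).

Lemma invn_norm_le1 (R : realType) (k : nat) : `|k%:R^-1 : R| <= 1.
Proof.
rewrite ger0_norm ?invr_ge0//; case: k => [|k]; first by rewrite invr0.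
by rewrite invf_le1 ?ltr0n// ler1n.
Qed.

Lemma invn2_norm_le1 (R : realType) (k : nat) : `|(k%:R ^+ 2)^-1 : R| <= 1.
Proof. by rewrite -exprVn normrX expr_le1// invn_norm_le1. Qed.

(** The remainder vanishes at 0 and has derivative y^n/(1-y), by the finite geometric sum; the mean
    value theorem bounds it. *)
Lemma ln_series_bounds (R : realType) (x : R) n : 0 < x < 1 ->
  0 <= - ln (1 - x) - \sum_(0 <= k < n) k.+1%:R^-1 * x ^+ k.+1 <= x ^+ n / (1 - x).
Proof.
move=> /andP[x0 x1].
pose E (y : R) := - ln (1 - y) - \sum_(0 <= k < n) k.+1%:R^-1 * y ^+ k.+1.
have d (y : R) : 0 <= y <= x -> is_derive y 1 E (y ^+ n / (1 - y)).
  move=> yx; have y1 : 0 < 1 - y by lra.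
  have h2 : is_derive y 1 (fun y => ln (1 - y)) ((1 - y)^-1 * (0 - 1)).
    by apply: deriveO1; exact: is_derive1_ln.
  have h3 : is_derive y 1 (fun y => \sum_(0 <= k < n) k.+1%:R^-1 * y ^+ k.+1)
      (\sum_(0 <= k < n) k.+1%:R^-1 * (k.+1%:R * y ^+ k * 1)).
    by apply: deriveS1 => k; apply: deriveZ1; exact: (deriveX1 k (is_derive_id y 1)).
  apply: is_derive_eq (deriveB1 (deriveN1 h2) h3) _.
  under eq_bigr do rewrite mulr1 mulrA mulVf ?pnatr_eq0// mul1r.
  rewrite big_mkord; have := subrX1 y n; set S := \sum_(i < n) _ => e.
  have -> : y ^+ n = 1 + (y - 1) * S by rewrite -e; ring.
  by field; rewrite gt_eqF.
have [c cx] := mean_value x0 d.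
have -> : E 0 = 0.
  rewrite /E subr0 ln1 oppr0 big1 ?subr0// => k _.
  by rewrite expr0n mulr0.
rewrite !subr0 /E => ->.
have c1 : 0 < 1 - c by lra.
have cn : 0 <= c ^+ n by rewrite exprn_ge0; lra.
apply/andP; split; first by rewrite mulr_ge0 ?divr_ge0//; lra.
have c2 : c ^+ n <= x ^+ n by rewrite lerXn2r ?nnegrE; lra.
apply: (@le_trans _ _ (c ^+ n / (1 - c))).
  by rewrite ger_pMr ?divr_gt0 ?exprn_gt0//; lra.
by rewrite ler_pM ?invr_ge0 ?lef_pV2 ?posrE//; lra.
Qed.

Lemma pseries_ln (R : realType) (x : R) : 0 < x < 1 ->
  (fun n => \sum_(0 <= k < n) k.+1%:R^-1 * x ^+ k.+1) @ \oo --> - ln (1 - x).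
Proof.
move=> x01; have /andP[x0 x1] := x01.
apply: (@squeeze_cvgn _ (fun n => - ln (1 - x) - x ^+ n / (1 - x)) _ (fun=> - ln (1 - x))).
- by apply: nearW => n; have /andP[] := ln_series_bounds n x01; lra.
- rewrite [X in _ --> X](_ : _ = - ln (1 - x) - 0 / (1 - x)); last by rewrite mul0r subr0.
  apply: cvgB; first exact: cvg_cst.
  by apply: cvgMr_tmp; apply: cvg_expr; rewrite ger0_norm; lra.
- exact: cvg_cst.
Qed.

Lemma is_derive_dilog (R : realType) (x : R) : 0 < x < 1 ->
  is_derive x 1 (@dilog R) (- ln (1 - x) / x).
Proof.
move=> /andP[x0 x1].
pose K : R := (1 + x) / 2.
have K1 : `|K| < 1 by rewrite ger0_norm /K; lra.
have e : pseries_diffs (fun k => (k%:R ^+ 2)^-1) = (fun k => k.+1%:R^-1) :> (nat -> R).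
  by apply/funext => k; rewrite /pseries_diffs expr2 invfM mulrA mulfV ?mul1r// pnatr_eq0.
have h : is_derive x 1 (@dilog R) (limn (pseries (pseries_diffs (fun k => (k%:R ^+ 2)^-1)) x)).
  apply: (@pseries_snd_diffs _ _ K).
  - by apply: bounded_pseries_cvg => // k; exact: invn2_norm_le1.
  - by rewrite e; apply: bounded_pseries_cvg => // k; exact: invn_norm_le1.
  - rewrite e; apply: bounded_pseries_cvg => // k; rewrite /pseries_diffs.
    rewrite ger0_norm ?divr_ge0// ler_pdivrMr ?ltr0n// mul1r ler_nat//.
  - by rewrite ger0_norm ?[X in _ < X]ger0_norm /K; lra.
apply: is_derive_eq h _; rewrite e.
apply: (@mulIf _ x); first by rewrite gt_eqF.
rewrite divfK ?gt_eqF//.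
have cv : pseries (fun k => k.+1%:R^-1) x @ \oo --> limn (pseries (fun k => k.+1%:R^-1) x).
  by apply: bounded_pseries_cvg => [k|]; [exact: invn_norm_le1|rewrite ger0_norm; lra].
have x01 : 0 < x < 1 by rewrite x0.
have h2 : (fun n => \sum_(0 <= k < n) k.+1%:R^-1 * x ^+ k.+1) @ \oo -->
    limn (pseries (fun k => k.+1%:R^-1) x) * x.
  have h3 : (fun n => pseries (fun k => k.+1%:R^-1) x n * x) @ \oo -->
    limn (pseries (fun k => k.+1%:R^-1) x) * x by exact: cvgMr_tmp.
  apply: cvg_trans h3; apply: near_eq_cvg; apply: nearW => n /=.
  rewrite /pseries /series /= mulr_suml.
  by apply: eq_bigr => k _; rewrite exprSr mulrA.
exact: (cvg_unique _ h2 (pseries_ln x01)).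
Qed.

(** Crude bounds that stand in for Abel's theorem at 1: for the lower one keep N terms and lower
    every power to x^N, for the upper one raise every power to x. *)
Lemma dilog_bounds (R : realType) (x : R) (N : nat) : 0 <= x < 1 ->
  x ^+ N * \sum_(0 <= k < N) (k.+1%:R ^+ 2)^-1 <= dilog x <= x * (pi ^+ 2 / 6).
Proof.
move=> /andP[x0 x1].
have cv : pseries (fun k => (k%:R ^+ 2)^-1) x @ \oo --> dilog x.
  by apply: bounded_pseries_cvg => [k|]; [exact: invn2_norm_le1|rewrite ger0_norm; lra].
rewrite -cvg_shiftS in cv.
have E n : pseries (fun k => (k%:R ^+ 2)^-1) x n.+1 =
    \sum_(0 <= k < n) (k.+1%:R ^+ 2)^-1 * x ^+ k.+1 :> R.
  by rewrite /pseries /series/= big_nat_recl//= expr0n/= invr0 mul0r add0r.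
have T0 i : 0 <= (i.+1%:R ^+ 2 : R)^-1 by rewrite invr_ge0 exprn_ge0.
have zle n : \sum_(0 <= k < n) (k.+1%:R ^+ 2)^-1 <= (pi ^+ 2 / 6 : R).
  have z := @zeta2 R.
  rewrite -(cvg_lim (@Rhausdorff R) z); apply: (@nondecreasing_cvgn_le _ (series _)).
    by apply/nondecreasing_seqP => i; rewrite /series/= big_nat_recr//= lerDl.
  by apply/cvg_ex; eexists; exact: z.
have {}cv : (fun n => \sum_(0 <= k < n) (k.+1%:R ^+ 2)^-1 * x ^+ k.+1) @ \oo --> dilog x.
  by apply: cvg_trans cv; apply: near_eq_cvg; apply: nearW => n /=; rewrite E.
apply/andP; split.
  apply: (cvgn_ge cv); near=> n.
  have Nn : (N <= n)%N by near: n; exact: nbhs_infty_ge.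
  apply: (@le_trans _ _ (\sum_(0 <= k < N) (k.+1%:R ^+ 2)^-1 * x ^+ k.+1)).
    rewrite mulr_sumr [leLHS]big_nat [leRHS]big_nat; apply: ler_sum => k /andP[_ kN].
    by rewrite mulrC ler_wpM2l// ler_wiXn2l// ltW.
  rewrite [leRHS](big_cat_nat (n := N))//= lerDl sumr_ge0// => k _.
  by rewrite mulr_ge0// exprn_ge0.
apply: (cvgn_le cv); near=> n.
apply: le_trans (ler_wpM2l x0 (zle n)); rewrite mulr_sumr.
apply: ler_sum => k _.
by rewrite mulrC ler_wpM2r// exprS ler_piMr// exprn_ile1// ltW.
Unshelve. all: by end_near. Qed.

Lemma dilog_cvg1 (R : realType) (y : nat -> R) : (forall n, 0 <= y n < 1) ->
  y @ \oo --> (1 : R) -> (fun n => dilog (y n)) @ \oo --> (pi ^+ 2 / 6 : R).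
Proof.
move=> y01 y1; apply/cvgrPdist_le => eps eps0.
have e2 : 0 < eps / 2 by lra.
have [N _ /(_ N)/=] := cvgr_dist_le _ _ (@zeta2 R) _ e2.
rewrite leqnn => /(_ isT); rewrite /series/=; set S := \sum_(0 <= k < N) _ => hS.
have yS : (fun n => y n ^+ N * S) @ \oo --> S.
  rewrite -[X in _ --> X]mul1r -(expr1n R N); apply: cvgMr_tmp.
  exact: cvgn_exp.
near=> n.
have h1 : `|S - y n ^+ N * S| <= eps / 2 by near: n; exact: cvgr_dist_le yS _ e2.
have /andP[h2 h3] := dilog_bounds N (y01 n).
have p0 : 0 <= (pi ^+ 2 / 6 : R) by rewrite divr_ge0// sqr_ge0.
have h4 : y n * (pi ^+ 2 / 6) <= pi ^+ 2 / 6.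
  by rewrite ler_piMl//; have := y01 n; lra.
rewrite -/S in h2; move: hS h1; rewrite !ler_norml => /andP[a1 a2] /andP[b1 b2].
by apply/andP; split; lra.
Unshelve. all: by end_near. Qed.

(** * The golden ratio factorisation and the primitive of the logarithm of a factor *)

Definition golden (R : realType) : R := (1 + Num.sqrt 5) / 2.

Lemma golden_sqr (R : realType) : golden R ^+ 2 = golden R + 1.
Proof.
rewrite /golden; have : Num.sqrt 5 ^+ 2 = 5 :> R by rewrite sqr_sqrtr.
by move: (Num.sqrt 5) => s; lra.
Qed.

Lemma golden_bounds (R : realType) : 1 < golden R < 2.
Proof.
have g := golden_sqr R.
have g0 : 2^-1 <= golden R by rewrite /golden; have := sqrtr_ge0 (5 : R); lra.
by apply/andP; split; nra.
Qed.

(** The full series 1 + y + y^3 + y^5 + ... at y = e^-x, of which [odd_factor] is a truncation. *)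
Definition upa_factor (R : realType) (x : R) : R :=
  1 + expR (- x) / (1 - expR (- x) ^+ 2).

(** The three logarithms of (1-y/a)(1+ay)/(1-y^2) are integrated separately. The middle one calls
    for Li_2(-ay), but ay exceeds 1 for small x, outside the disc of the series; Landen's
    transformation replaces it by -Li_2(ay/(1+ay)) - ln(1+ay)^2/2. *)
Definition upa_prim (R : realType) (x : R) : R :=
  let y := expR (- x) in let a := golden R in
  dilog (y / a) - 2^-1 * ln (1 + a * y) ^+ 2 - dilog (a * y / (1 + a * y))
  - 2^-1 * dilog (y ^+ 2).

Lemma is_derive_upa_prim (R : realType) (x : R) : 0 < x ->
  is_derive x 1 (@upa_prim R) (ln (upa_factor x)).
Proof.
move=> x0; have /andP[a1 a2] := golden_bounds R; have asq := golden_sqr R.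
rewrite /upa_prim /upa_factor; set a := golden R in a1 a2 asq *.
set y := expR (- x).
have y0 : 0 < y by exact: expR_gt0.
have y1 : y < 1 by rewrite expR_lt1; lra.
have dy : is_derive x 1 (fun x => expR (- x)) (- y).
  have h : is_derive x 1 (fun x : R => expR (- x)) (expR (- x) * - 1).
    by apply: deriveO1; solve [exact: is_derive_expR | exact: deriveN1].
  by apply: is_derive_eq h _; rewrite mulrN1.
have b1 : 0 < y / a < 1 by rewrite divr_gt0 ?ltr_pdivrMr//=; nra.
have p0 : 0 < 1 + a * y by nra.
have b2 : 0 < a * y / (1 + a * y) < 1.
  by rewrite divr_gt0 ?ltr_pdivrMr ?mulr_gt0//=; nra.
have b3 : 0 < y ^+ 2 < 1 by rewrite exprn_gt0//=; nra.
have d1 : is_derive x 1 (fun x => dilog (expR (- x) / a))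
    (- ln (1 - y / a) / (y / a) * (- y * a^-1 + y * 0)).
  apply: deriveO1; first exact: is_derive_dilog.
  by apply: deriveM1; solve [exact: dy | exact: deriveC1].
have dp : is_derive x 1 (fun x => 1 + a * expR (- x)) (0 + a * - y).
  by apply: deriveD1; solve [exact: deriveC1 | exact: deriveZ1].
have d2 : is_derive x 1 (fun x => 2^-1 * ln (1 + a * expR (- x)) ^+ 2)
    (2^-1 * (2%:R * ln (1 + a * y) ^+ 1 * ((1 + a * y)^-1 * (0 + a * - y)))).
  apply: deriveZ1; apply: deriveX1.
  by apply: deriveO1; solve [exact: is_derive1_ln | exact: dp].
have nz : 1 + a * expR (- x) != 0 by rewrite gt_eqF.
have d3 : is_derive x 1 (fun x => dilog (a * expR (- x) / (1 + a * expR (- x))))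
    (- ln (1 - a * y / (1 + a * y)) / (a * y / (1 + a * y)) *
     (a * - y * (1 + a * y)^-1 + a * y * (- (1 + a * y) ^- 2 * (0 + a * - y)))).
  have h := deriveM1 (deriveZ1 a dy) (deriveV1 dp nz).
  exact: (@deriveO1 R (@dilog R) (fun x => a * expR (- x) / (1 + a * expR (- x))) x _ _
    (is_derive_dilog b2) h).
have d4 : is_derive x 1 (fun x => 2^-1 * dilog (expR (- x) ^+ 2))
    (2^-1 * (- ln (1 - y ^+ 2) / y ^+ 2 * (2%:R * y ^+ 1 * - y))).
  apply: deriveZ1; apply: deriveO1; first exact: is_derive_dilog.
  exact: (deriveX1 1 dy).
apply: is_derive_eq (deriveB1 (deriveB1 (deriveB1 d1 d2) d3) d4) _.
have -> : 1 - a * y / (1 + a * y) = (1 + a * y)^-1 by field; rewrite gt_eqF.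
rewrite lnV ?posrE//.
have q1 : 0 < 1 - y / a by lra.
have q2 : 0 < 1 - y ^+ 2 by lra.
have -> : 1 + y / (1 - y ^+ 2) = (1 - y / a) * (1 + a * y) / (1 - y ^+ 2).
  have -> : (1 - y / a) * (1 + a * y) = 1 + y - y ^+ 2.
    have -> : a^-1 = a - 1.
      by apply: (@mulfI _ a); rewrite ?mulfV ?gt_eqF//; lra.
    transitivity (1 + y - (a ^+ 2 - a) * y ^+ 2); first by ring.
    by rewrite asq; ring.
  by field; rewrite gt_eqF.
rewrite ln_div ?lnM ?posrE ?mulr_gt0//.
have a0 : 0 < a by lra.
by move: (ln _) (ln _) (ln _) => u1 u2 u3; field; rewrite !gt_eqF.
Qed.

Lemma upa_prim_bound (R : realType) (x : R) : 0 < x ->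
  `|upa_prim x| <= (3 + pi ^+ 2) * expR (- x).
Proof.
move=> x0; have /andP[a1 a2] := golden_bounds R.
rewrite /upa_prim; set a := golden R in a1 a2 *; set y := expR (- x).
have y0 : 0 < y by exact: expR_gt0.
have y1 : y < 1 by rewrite expR_lt1; lra.
have p0 : 0 < 1 + a * y by nra.
have b1 : 0 <= y / a < 1 by rewrite divr_ge0 ?ltr_pdivrMr//=; nra.
have b2 : 0 <= a * y / (1 + a * y) < 1.
  by rewrite divr_ge0 ?ltr_pdivrMr ?mulr_ge0//=; nra.
have b3 : 0 <= y ^+ 2 < 1 by rewrite exprn_ge0//=; nra.
have B (z : R) : 0 <= z < 1 -> 0 <= dilog z <= z * (pi ^+ 2 / 6).
  by move=> /(@dilog_bounds _ z 0); rewrite big_geq// mulr0.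
have := B _ b1; have := B _ b2; have := B _ b3.
have l0 : 0 <= ln (1 + a * y) by apply: ln_ge0; nra.
have l1 : ln (1 + a * y) <= a * y by apply: le_ln1Dx; nra.
have : 0 <= (pi ^+ 2 / 6 : R) by rewrite divr_ge0// sqr_ge0.
have -> : 3 + pi ^+ 2 = 3 + 6 * (pi ^+ 2 / 6) :> R by field.
move: (pi ^+ 2 / 6 : R) (dilog _) (dilog _) (dilog _) => P u v w P0.
have c1 : y / a <= y by rewrite ler_pdivrMr ?ler_peMr//; lra.
have c2 : a * y / (1 + a * y) <= 2 * y.
  by rewrite ler_pdivrMr//; nra.
have c3 : y ^+ 2 <= y by nra.
move=> /andP[w0 w1] /andP[v0 v1] /andP[u0 u1].
have {}u1 : u <= y * P by rewrite (le_trans u1)// ler_wpM2r.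
have {}v1 : v <= 2 * y * P by rewrite (le_trans v1)// ler_wpM2r.
have {}w1 : w <= y * P by rewrite (le_trans w1)// ler_wpM2r.
have l2 : ln (1 + a * y) ^+ 2 <= 4 * y by nra.
have l3 : 0 <= ln (1 + a * y) ^+ 2 by exact: sqr_ge0.
have yP : 0 <= y * P by rewrite mulr_ge0// ltW.
by rewrite ler_norml; apply/andP; split; nra.
Qed.

(** At y = 1, a^2 = a+1 gives a/(1+a) = 1/a, so two dilogarithms cancel; ln(1+a) = 2 ln a leaves -2
    (ln a)^2, and the last term is -pi^2/12. *)
Lemma upa_prim_cvg0 (R : realType) (e : nat -> R) : (forall n, 0 < e n) ->
  e @ \oo --> (0 : R) -> (fun n => upa_prim (e n)) @ \oo --> - A R.
Proof.
move=> e0 ecv; have /andP[a1 a2] := golden_bounds R; have asq := golden_sqr R.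
have ycv : (fun n => expR (- e n)) @ \oo --> (1 : R).
  rewrite -(expR0 R) -[X in expR X]oppr0.
  by apply: cvgn_comp; [exact: continuous_expR|exact: cvgN].
have -> : - A R = dilog (1 / golden R) - 2^-1 * ln (1 + golden R * 1) ^+ 2 -
    dilog (golden R * 1 / (1 + golden R * 1)) - 2^-1 * (pi ^+ 2 / 6).
  have -> : golden R * 1 / (1 + golden R * 1) = 1 / golden R.
    rewrite !mulr1 [1 + _]addrC -asq; field; rewrite gt_eqF//; lra.
  rewrite mulr1 [1 + _]addrC -asq lnXn; last lra.
  by rewrite /A -/(golden R); lra.
have dd (z : R) : 0 < z < 1 -> {for z, continuous (@dilog R)}.
  by move=> z01; exact: derivable_continuous1 (is_derive_dilog z01).
rewrite /upa_prim /=; apply: cvgB; last first.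
  apply: cvgMl_tmp; apply: dilog_cvg1.
    move=> n; have := expR_gt0 (- e n); have : expR (- e n) < 1.
      by rewrite expR_lt1; have := e0 n; lra.
    by move=> h1 h2; apply/andP; split; nra.
  by rewrite -(expr1n R 2); exact: cvgn_exp.
apply: cvgB; last first.
  apply: cvgn_comp.
    have a0 : 0 < golden R by lra.
    apply: dd; rewrite mulr1; apply/andP; split; first by rewrite divr_gt0//; lra.
    by rewrite ltr_pdivrMr ?mul1r; lra.
  have p0 : 1 + golden R * 1 != 0 by rewrite gt_eqF//; lra.
  apply: cvgM; first exact: cvgMl_tmp.
  by apply: cvgV => //; apply: cvgD; [exact: cvg_cst|exact: cvgMl_tmp].
apply: cvgB.
  apply: cvgn_comp; last exact: cvgMr_tmp.
  have a0 : 0 < golden R by lra.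
  apply: dd; apply/andP; split; first by rewrite divr_gt0.
  by rewrite ltr_pdivrMr ?mul1r.
apply: cvgMl_tmp.
apply: cvgn_exp.
apply: cvgn_comp; first by apply: continuous_ln; lra.
by apply: cvgD; [exact: cvg_cst|exact: cvgMl_tmp].
Qed.

(** * Asymptotics of the product on the positive axis *)

Lemma expRN_lt1 (R : realType) (x : R) : 0 < x -> 0 < expR (- x) < 1.
Proof. by move=> x0; rewrite expR_gt0 expR_lt1 oppr_lt0. Qed.

Lemma upa_factor_gt1 (R : realType) (x : R) : 0 < x -> 1 < upa_factor x.
Proof.
move=> /expRN_lt1/andP[y0 y1]; rewrite /upa_factor ltrDl divr_gt0//; nra.
Qed.

Lemma upa_factor_le (R : realType) (x z : R) : 0 < x -> x <= z ->
  upa_factor z <= upa_factor x.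
Proof.
move=> x0 xz; have /andP[y0 y1] := expRN_lt1 x0.
have /andP[w0 w1] : 0 < expR (- z) < 1 by apply: expRN_lt1; lra.
have wy : expR (- z) <= expR (- x) by rewrite ler_expR; lra.
rewrite /upa_factor lerD2l ler_pM ?invr_ge0 ?lef_pV2 ?posrE//; nra.
Qed.

(** The factor is (1+y-y^2)/(1-y^2) with numerator near 1 and denominator near 2x. The 5 comes from
    (1+x)(1+2x) - 1 <= 5x on (0, 1]. *)
Lemma ln_upa_factor_near0 (R : realType) (x : R) : 0 < x <= 1 ->
  0 <= ln (upa_factor x) + ln (2 * x) <= 5 * x.
Proof.
move=> /andP[x0 x1]; have /andP[y0 y1] := expRN_lt1 x0.
have f1 := upa_factor_gt1 x0.
rewrite -lnM ?posrE; [|lra|lra].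
rewrite /upa_factor; set y := expR (- x) in y0 y1 *.
have h1 : 1 - x <= y by have := expR_ge1Dx (- x); rewrite -/y; lra.
have ey : y ^+ 2 = expR (- (2 * x)) by rewrite -expRM_natl; congr expR; ring.
have h2 : 1 - 2 * x <= y ^+ 2 by rewrite ey; have := expR_ge1Dx (- (2 * x)); lra.
have h3 : y ^+ 2 * (1 + 2 * x) <= 1.
  rewrite ey expRN mulrC ler_pdivrMr ?expR_gt0// mul1r; exact: expR_ge1Dx.
have D0 : 0 < 1 - y ^+ 2 by nra.
have E : (1 + y / (1 - y ^+ 2)) * (2 * x) = (1 + y - y ^+ 2) * (2 * x) / (1 - y ^+ 2).
  by field; rewrite gt_eqF.
apply/andP; split.
  by apply: ln_ge0; rewrite E ler_pdivlMr//; nra.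
apply: (@le_trans _ _ ((1 + y / (1 - y ^+ 2)) * (2 * x) - 1)).
  by apply: ln_le_B1; rewrite E divr_gt0// mulr_gt0//; nra.
have : (1 + y / (1 - y ^+ 2)) * (2 * x) <= (1 + x) * (1 + 2 * x).
  rewrite E ler_pdivrMr//.
  have a1 : 1 + y - y ^+ 2 <= 1 + x by nra.
  have a2 : 2 * x <= (1 + 2 * x) * (1 - y ^+ 2) by nra.
  rewrite -mulrA; apply: ler_pM => //; nra.
nra.
Qed.

(** The product of the factors at x-w and x+w depends on w only through s = e^w + e^-w; by the
    identity [E] it is an increasing function of s, and s increases with w. *)
Lemma ln_upa_factor_convex (R : realType) (x u v : R) :
  0 <= u -> u <= v -> v < x ->
  ln (upa_factor (x - u)) + ln (upa_factor (x + u)) <=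
  ln (upa_factor (x - v)) + ln (upa_factor (x + v)).
Proof.
move=> u0 uv vx.
have p (w : R) : 0 <= w -> w < x -> 0 < upa_factor (x - w) /\ 0 < upa_factor (x + w).
  move=> w0 wx; have := @upa_factor_gt1 R (x - w); have := @upa_factor_gt1 R (x + w).
  by move=> h1 h2; split; [have /h2 : 0 < x - w by lra|have /h1 : 0 < x + w by lra]; lra.
have ux : u < x by lra.
have v0 : 0 <= v by lra.
have [p1 p2] := p _ u0 ux; have [p3 p4] := p _ v0 vx.
rewrite -!lnM ?posrE// ler_ln ?posrE ?mulr_gt0//.
pose y := expR (- x); pose s (w : R) := expR w + expR (- w).
have y0 : 0 < y by exact: expR_gt0.
have y1 : y < 1 by rewrite expR_lt1; lra.
have E (w : R) : 0 <= w -> w < x -> upa_factor (x - w) * upa_factor (x + w) =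
    1 + (y * s w * (1 - y ^+ 2) + y ^+ 2) / ((1 + y ^+ 2) ^+ 2 - y ^+ 2 * s w ^+ 2)
    /\ 0 < (1 + y ^+ 2) ^+ 2 - y ^+ 2 * s w ^+ 2.
  move=> w0 wx.
  have /andP[a0 a1] : 0 < expR (- (x - w)) < 1 by apply: expRN_lt1; lra.
  have /andP[b0 b1] : 0 < expR (- (x + w)) < 1 by apply: expRN_lt1; lra.
  rewrite /upa_factor /s.
  have ea : expR (- (x - w)) = y * expR w by rewrite /y -expRD; congr expR; ring.
  have eb : expR (- (x + w)) = y * expR (- w) by rewrite /y -expRD; congr expR; ring.
  have ee : expR (- (x - w)) * expR (- (x + w)) = y ^+ 2.
    by rewrite ea eb mulrACA expRxMexpNx_1 mulr1 expr2.
  have -> : y * (expR w + expR (- w)) = expR (- (x - w)) + expR (- (x + w)).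
    by rewrite ea eb; ring.
  have -> : y ^+ 2 * (expR w + expR (- w)) ^+ 2 =
      (expR (- (x - w)) + expR (- (x + w))) ^+ 2 by rewrite ea eb; ring.
  move: ee a0 a1 b0 b1; move: (expR (- (x - w))) (expR (- (x + w))) => c d <- c0 c1 d0 d1.
  have D : (1 + c * d) ^+ 2 - (c + d) ^+ 2 = (1 - c ^+ 2) * (1 - d ^+ 2) by ring.
  have C1 : 0 < 1 - c ^+ 2 by nra.
  have D1 : 0 < 1 - d ^+ 2 by nra.
  rewrite D; split; last exact: mulr_gt0.
  by field; rewrite !gt_eqF.
have [-> Du] := E _ u0 ux; have [-> Dv] := E _ v0 vx.
have suv : s u <= s v.
  rewrite /s; have [->//|uv'] := eqVneq u v.
  have e1 : 1 <= expR u by rewrite -expR0 ler_expR.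
  have e2 : expR u <= expR v by rewrite ler_expR.
  rewrite !expRN; move: e1 e2; move: (expR u) (expR v) => c d c1 cd.
  have c0 : 0 < c by lra.
  have d0 : 0 < d by lra.
  rewrite -subr_ge0 (_ : _ - _ = (d - c) * (c * d - 1) / (c * d)).
    by rewrite divr_ge0 ?mulr_ge0//; nra.
  by field; rewrite !gt_eqF.
have s0 : 0 < s u by rewrite addr_gt0 ?expR_gt0.
rewrite lerD2l ler_pM ?invr_ge0 ?lef_pV2 ?posrE//; try exact: ltW.
- by rewrite addr_ge0 ?sqr_ge0// !mulr_ge0 ?ltW//; nra.
- by rewrite lerD2r ler_wpM2r// ?ler_pM2l//; nra.
- by rewrite lerD2l lerN2 ler_wpM2l ?sqr_ge0// lerXn2r ?nnegrE//; lra.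
Qed.

(** From z to z+h, the numerator 1+y-y^2 shrinks by a ratio of at most e^h, and the denominator
    1-e^(-2z) grows by at most (z+h)/z. *)
Lemma ln_upa_factor_diff (R : realType) (z h : R) : 0 < z -> 0 < h ->
  0 <= ln (upa_factor z) - ln (upa_factor (z + h)) <= h + h / z.
Proof.
move=> z0 h0; have zh : 0 < z + h by lra.
have f1 := upa_factor_gt1 z0; have f2 := upa_factor_gt1 zh.
have f12 : upa_factor (z + h) <= upa_factor z by apply: upa_factor_le => //; lra.
apply/andP; split.
  by rewrite subr_ge0 ler_ln ?posrE//; lra.
have /andP[y0 y1] := expRN_lt1 z0; have /andP[w0 w1] := expRN_lt1 zh.
have e : h + h / z = ln (expR h) + h / z by rewrite expRK.
rewrite e lerBlDr.
apply: (@le_trans _ _ (ln (expR h) + ln (1 + h / z) + ln (upa_factor (z + h)))); last first.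
  rewrite lerD2r lerD2l; apply: le_ln1Dx.
  have : 0 < h / z by rewrite divr_gt0.
  lra.
have hz : 0 < h / z by rewrite divr_gt0.
rewrite -!lnM ?posrE ?mulr_gt0 ?expR_gt0//; try lra.
rewrite ler_ln ?posrE ?mulr_gt0 ?expR_gt0//; try lra.
have ew : expR (- z) = expR h * expR (- (z + h)) by rewrite -expRD; congr expR; ring.
have eh1 : 1 <= expR h by rewrite -expR0 ler_expR ltW.
rewrite /upa_factor.
have k1 : (1 - expR (- (z + h)) ^+ 2) * z <= (1 - expR (- z) ^+ 2) * (z + h).
  have e2 : expR (- z) ^+ 2 = expR (- (2 * z)) by rewrite -expRM_natl; congr expR; ring.
  have e3 : expR (- (z + h)) ^+ 2 = expR (- (2 * z)) * expR (- (2 * h)).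
    by rewrite -expRM_natl -expRD; congr expR; ring.
  have g1 : expR (- (2 * z)) * (1 + 2 * z) <= 1.
    by rewrite expRN mulrC ler_pdivrMr ?expR_gt0// mul1r expR_ge1Dx.
  have g2 := expR_ge1Dx (- (2 * h)).
  have g3 := expR_gt0 (- (2 * z)).
  rewrite e2 e3; move: g1 g2 g3; move: (expR (- (2 * z))) (expR (- (2 * h))) => c d g1 g2 g3.
  have g4 : c * (1 - d) * z <= (1 - c) * h.
    have : c * (1 - d) * z <= c * (2 * h) * z by rewrite ler_pM2r// ler_pM2l//; lra.
    nra.
  nra.
have y3 : 0 < 1 - expR (- z) ^+ 2 by nra.
have w3 : 0 < 1 - expR (- (z + h)) ^+ 2 by nra.
move: ew k1 eh1 y0 y1 w0 w1 y3 w3.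
move: (expR h) (expR (- z)) (expR (- (z + h))) => c y w ew k1 c1 y0 y1 w0 w1 y3 w3.
have E1 : 1 + y / (1 - y ^+ 2) = (1 + y - y ^+ 2) / (1 - y ^+ 2) by field; rewrite gt_eqF.
have E2 : 1 + w / (1 - w ^+ 2) = (1 + w - w ^+ 2) / (1 - w ^+ 2) by field; rewrite gt_eqF.
have E3 : 1 + h / z = (z + h) / z by field; rewrite gt_eqF.
rewrite E1 E2 E3 ler_pdivrMr//.
have n1 : 1 + y - y ^+ 2 <= c * (1 + w - w ^+ 2).
  by rewrite ew; nra.
have n2 : 1 <= (z + h) / z * (1 - y ^+ 2) / (1 - w ^+ 2).
  rewrite ler_pdivlMr// mul1r mulrAC ler_pdivlMr//; lra.
have n0 : 0 < c * (1 + w - w ^+ 2) by rewrite mulr_gt0//; nra.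
apply: (le_trans n1).
rewrite [leRHS](_ : _ = c * (1 + w - w ^+ 2) * ((z + h) / z * (1 - y ^+ 2) / (1 - w ^+ 2))); last by ring.
by rewrite ler_peMr// ltW.
Qed.

(** Integrated form of [ln_upa_factor_near0], the constant of integration -A being supplied by
    [upa_prim_cvg0]. *)
Lemma upa_prim_near0 (R : realType) (x : R) : 0 < x <= 1 ->
  0 <= upa_prim x + A R - (x - x * ln (2 * x)) <= 5 * x ^+ 2.
Proof.
move=> /andP[x0 x1].
pose E (z : R) := upa_prim z - (z - z * ln (2 * z)).
have dE (z : R) : 0 < z -> is_derive z 1 E (ln (upa_factor z) + ln (2 * z)).
  move=> z0; have z2 : 0 < 2 * z by lra.
  have h : is_derive z 1 (fun z : R => ln (2 * z)) ((2 * z)^-1 * (2 * 1)).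
    exact: (@deriveO1 R (@ln R) (fun z => 2 * z) z _ _ (is_derive1_ln z2)
      (deriveZ1 2 (is_derive_id z 1))).
  have h2 := deriveB1 (is_derive_id z 1) (deriveM1 (is_derive_id z 1) h).
  apply: is_derive_eq (deriveB1 (is_derive_upa_prim z0) h2) _.
  by rewrite mul1r mulr1; field; rewrite gt_eqF.
(* The lower endpoint will be the square [d n ^+ 2]: then d^2 ln(d^2) = 2d (d ln d) tends to 0 by
   the crude bound d ln d >= -1. *)
pose d n : R := x / 2 * n.+1%:R^-1.
have d0 n : 0 < d n by rewrite /d mulr_gt0 ?invr_gt0 ?ltr0n//; lra.
have dx n : d n <= x / 2.
  by rewrite /d ler_piMr ?invf_le1 ?ltr0n ?ler1n//; lra.
have dcv : d @ \oo --> (0 : R).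
  by rewrite -(mulr0 (x / 2)); apply: cvgMl_tmp; exact: cvg_invn.
have d2cv : (fun n => d n ^+ 2) @ \oo --> (0 : R).
  by rewrite -[X in _ --> X](expr0n R 2); exact: cvgn_exp.
have lcv : (fun n => d n ^+ 2 * ln (2 * d n ^+ 2)) @ \oo --> (0 : R).
  apply: (@squeeze_cvgn _ (fun n => d n ^+ 2 * ln 2 - 2 * d n) _ (fun n => d n ^+ 2 * ln 2)).
  - apply: nearW => n; rewrite lnM ?posrE ?exprn_gt0// lnXn// -mulr_natl.
    have l1 : ln (d n) <= 0 by apply: ln_le0; have := dx n; lra.
    have l2 := ln_ge_1BV (d0 n).
    have l3 : - (1 : R) <= d n * ln (d n).
      apply: (@le_trans _ _ (d n * (1 - (d n)^-1))); last by rewrite ler_pM2l.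
      by rewrite mulrBr mulfV ?gt_eqF//; have := d0 n; lra.
    have l4 : d n * - (1) <= d n * (d n * ln (d n)) by rewrite ler_pM2l.
    have l5 : d n ^+ 2 * ln (d n) <= 0 by rewrite mulr_ge0_le0 ?sqr_ge0.
    by apply/andP; split; lra.
  - rewrite [X in _ --> X](_ : _ = 0 * ln 2 - 2 * 0); last by ring.
    by apply: cvgB; [exact: cvgMr_tmp|exact: cvgMl_tmp].
  - by rewrite -[X in _ --> X](mul0r (ln 2)); exact: cvgMr_tmp.
have ecv : (fun n => E x - E (d n ^+ 2)) @ \oo --> E x + A R.
  rewrite -[A R]opprK; apply: cvgB; first exact: cvg_cst.
  rewrite [X in _ --> X](_ : _ = - A R - (0 - 0)); last by rewrite !subr0.
  apply: cvgB; last exact: cvgB.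
  by apply: upa_prim_cvg0 => // n; rewrite exprn_gt0.
have b n : 0 <= E x - E (d n ^+ 2) <= 5 * x ^+ 2.
  have q0 : 0 < d n ^+ 2 by rewrite exprn_gt0.
  have qx : d n ^+ 2 < x by have := dx n; have := d0 n; nra.
  have dd (y : R) : d n ^+ 2 <= y <= x ->
      is_derive y 1 E (ln (upa_factor y) + ln (2 * y)).
    by move=> yy; apply: dE; lra.
  have [c cx ->] := mean_value qx dd.
  have c01 : 0 < c <= 1 by lra.
  have /andP[k1 k2] := ln_upa_factor_near0 c01.
  by apply/andP; split; nra.
have -> : upa_prim x + A R - (x - x * ln (2 * x)) = E x + A R by rewrite /E; ring.
apply/andP; split.
  by apply: (cvgn_ge ecv); apply: nearW => n; have /andP[] := b n.
by apply: (cvgn_le ecv); apply: nearW => n; have /andP[] := b n.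
Qed.

Lemma sum_ln_head (R : realType) (t : R) J : 0 < t -> J%:R * t <= 1 ->
  0 <= \sum_(0 <= j < J) ln (upa_factor (j.+1%:R * t)) +
       (J%:R * ln (2 * t) + ln J`!%:R) <= 5 * J%:R ^+ 2 * t.
Proof.
move=> t0; elim: J => [_|J IHJ Jt].
  by rewrite big_geq// fact0 ln1 !mul0r expr0n mulr0 mul0r !addr0 lexx.
have J0 : (0 : R) <= J%:R by [].
have SJ : J.+1%:R = J%:R + 1 :> R by rewrite natr1.
have /IHJ/andP[h1 h2] : J%:R * t <= 1 by rewrite SJ in Jt; nra.
have xJ : 0 < J.+1%:R * t <= 1 by rewrite Jt andbT mulr_gt0// ltr0n.
have /andP[k1 k2] := ln_upa_factor_near0 xJ.
rewrite big_nat_recr//= factS natrM [ln (J.+1%:R * _)]lnM ?posrE ?ltr0n ?fact_gt0//.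
rewrite (_ : 2 * (J.+1%:R * t) = J.+1%:R * (2 * t)) in k1 k2; last by ring.
rewrite lnM ?posrE ?ltr0n// in k1 k2; last by rewrite mulr_gt0.
have e1 : J.+1%:R * ln (2 * t) = J%:R * ln (2 * t) + ln (2 * t) by rewrite SJ; ring.
have e2 : 5 * J.+1%:R ^+ 2 * t = 5 * J%:R ^+ 2 * t + 10 * (J%:R * t) + 5 * t.
  by rewrite SJ; ring.
have e3 : 5 * (J.+1%:R * t) = 5 * (J%:R * t) + 5 * t by rewrite SJ; ring.
have Jt0 : 0 <= J%:R * t by rewrite mulr_ge0// ltW.
rewrite e1 e2; rewrite e3 in k2.
by apply/andP; split; lra.
Qed.

(** Midpoint rule of step t. The error at x is at most t/2 (d(x-t/2) - d(x)), where d is the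
    decrease of ln f over t/2; convexity gives d(x) >= d(x+t/2), so the errors telescope and only
    the end at J counts. *)
Lemma sum_ln_tail (R : realType) (t : R) J n : 0 < t -> (J <= n)%N ->
  0 <= upa_prim ((n%:R + 2^-1) * t) - upa_prim ((J%:R + 2^-1) * t) -
       t * \sum_(J <= j < n) ln (upa_factor (j.+1%:R * t))
    <= t / 2 * (t / 2 + (t / 2) / ((J%:R + 2^-1) * t)).
Proof.
move=> t0 Jn.
pose d (z : R) := ln (upa_factor z) - ln (upa_factor (z + t / 2)).
have h0 : 0 < t / 2 by lra.
suff : 0 <= upa_prim ((n%:R + 2^-1) * t) - upa_prim ((J%:R + 2^-1) * t) -
       t * \sum_(J <= j < n) ln (upa_factor (j.+1%:R * t))
    <= t / 2 * (d ((J%:R + 2^-1) * t) - d ((n%:R + 2^-1) * t)).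
  move=> /andP[-> h]; apply: (le_trans h); rewrite ler_pM2l//.
  have p (m : nat) : 0 < (m%:R + 2^-1) * t by rewrite mulr_gt0// ltr_wpDl.
  have /andP[_ h1] := ln_upa_factor_diff (p J) h0.
  have /andP[h2 _] := ln_upa_factor_diff (p n) h0.
  by rewrite -/(d _) in h1; rewrite -/(d _) in h2; lra.
elim: n Jn => [|n IHn].
  by rewrite leqn0 => /eqP ->; rewrite big_geq// !subrr mulr0 subr0 mulr0 lexx.
rewrite leq_eqVlt => /predU1P[->|Jn].
  by rewrite big_geq// !subrr mulr0 subr0 mulr0 lexx.
have /andP[i1 i2] := IHn Jn.
rewrite big_nat_recr//=.
have n0 : (0 : R) <= n%:R by [].
have Sn : n.+1%:R = n%:R + 1 :> R by rewrite natr1.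
have x1 : n.+1%:R * t - t / 2 = (n%:R + 2^-1) * t by rewrite Sn; field.
have x2 : n.+1%:R * t + t / 2 = (n.+1%:R + 2^-1) * t by field.
have x3 : (n%:R + 2^-1) * t + t / 2 = n.+1%:R * t by rewrite Sn; field.
have dG (y : R) : n.+1%:R * t - t / 2 <= y <= n.+1%:R * t + t / 2 ->
    is_derive y 1 (@upa_prim R) (ln (upa_factor y)).
  move=> /andP[yb _]; apply: is_derive_upa_prim; apply: lt_le_trans yb.
  by rewrite x1 mulr_gt0// ltr_wpDl.
have cvx (u v : R) : 0 <= u -> u <= v -> v <= t / 2 ->
   ln (upa_factor (n.+1%:R * t - u)) + ln (upa_factor (n.+1%:R * t + u)) <=
   ln (upa_factor (n.+1%:R * t - v)) + ln (upa_factor (n.+1%:R * t + v)).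
  move=> u0 uv vt; apply: ln_upa_factor_convex => //; apply: (le_lt_trans vt).
  by rewrite Sn; nra.
have /andP[m1 m2] := midpoint_error h0 dG cvx.
have c2 : d ((n.+1%:R + 2^-1) * t) <= d (n.+1%:R * t).
  have q : 0 <= t / 2 by exact: ltW.
  have := @ln_upa_factor_convex R ((n.+1%:R + 2^-1) * t) 0 (t / 2) (lexx 0) q.
  rewrite subr0 addr0 -x2 addrK => h.
  have {}h := h (_ : t / 2 < n.+1%:R * t + t / 2).
  have : t / 2 < n.+1%:R * t + t / 2 by rewrite ltrDr mulr_gt0// ltr0n.
  by move=> /h; rewrite /d; lra.
have e3 : d ((n%:R + 2^-1) * t) = ln (upa_factor ((n%:R + 2^-1) * t)) -
    ln (upa_factor (n.+1%:R * t)) by rewrite /d x3.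
have e4 : d (n.+1%:R * t) = ln (upa_factor (n.+1%:R * t)) -
    ln (upa_factor ((n.+1%:R + 2^-1) * t)) by rewrite /d x2.
rewrite x1 x2 in m1 m2; rewrite e4 in c2; rewrite e3 in i2.
rewrite (_ : 2 * (t / 2) = t) in m1 m2; last by field.
have c3 : t / 2 * d ((n.+1%:R + 2^-1) * t) <= t / 2 * (ln (upa_factor (n.+1%:R * t)) -
    ln (upa_factor ((n.+1%:R + 2^-1) * t))) by rewrite ler_pM2l.
rewrite mulrDr; move: i1 i2 m1 m2 c3.
set a1 := \sum_(J <= j < n) _; set a2 := d (_ * _); set a3 := d (_ * _).
set a4 := ln (upa_factor (n.+1%:R * t)); set a5 := ln _; set a6 := ln _.
set b1 := upa_prim _; set b2 := upa_prim _; set b3 := upa_prim _.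
by move=> i1 i2 m1 m2 c3; apply/andP; split; lra.
Qed.

(** The singular part of ln f at 0 is summed exactly up to J and by the midpoint rule beyond; the
    J-dependent main terms assemble into [stirling_seq]. For fixed J the error tends to 1/(J+1/2) as
    t tends to 0 (with the last term vanishing), and J is sent to infinity afterwards. *)
Lemma sum_ln_upa_factor (R : realType) (t : R) (J n : nat) :
  0 < t -> (J <= n)%N -> (J%:R + 2^-1) * t <= 1 ->
  `|\sum_(0 <= j < n) ln (upa_factor (j.+1%:R * t)) - A R / t - 2^-1 * ln t -
    (2^-1 * ln 2 - stirling_seq R J)| <=
  5 * J%:R ^+ 2 * t + 5 * (J%:R + 2^-1) ^+ 2 * t + t + (J%:R + 2^-1)^-1 +
  (3 + pi ^+ 2) * (expR (- (n%:R * t)) / t).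
Proof.
move=> t0 Jn Jt.
have J0 : (0 : R) <= J%:R by [].
have Jt1 : J%:R * t <= 1 by nra.
have p0 : 0 < J%:R + 2^-1 :> R by lra.
have x01 : 0 < (J%:R + 2^-1) * t <= 1 by rewrite Jt andbT mulr_gt0.
have n0 : (0 : R) <= n%:R by [].
have /andP[h1 h2] := sum_ln_head t0 Jt1.
have /andP[k1 k2] := sum_ln_tail t0 Jn.
have /andP[l1 l2] := upa_prim_near0 x01.
have q : 0 < (n%:R + 2^-1) * t by rewrite mulr_gt0//; lra.
have b := upa_prim_bound q.
have b' : (3 + pi ^+ 2) * expR (- ((n%:R + 2^-1) * t)) <= (3 + pi ^+ 2) * expR (- (n%:R * t)).
  rewrite ler_wpM2l ?ler_expR; [by []|by have := sqr_ge0 (pi : R); lra|by nra].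
have {b'}b := le_trans b b'.
rewrite (big_cat_nat (n := J))//=.
have e1 : ln (2 * ((J%:R + 2^-1) * t)) = ln 2 + ln t + ln (J%:R + 2^-1).
  by rewrite [_ * t]mulrC mulrA !lnM ?posrE ?mulr_gt0.
have e2 : ln (2 * t) = ln 2 + ln t by rewrite lnM ?posrE.
rewrite e1 in l1 l2; rewrite e2 in h1 h2.
have ti : 0 < t^-1 by rewrite invr_gt0.
have tt : t * t^-1 = 1 by rewrite mulfV ?gt_eqF.
rewrite /stirling_seq.
have K1 : 0 <= t^-1 * (upa_prim ((n%:R + 2^-1) * t) - upa_prim ((J%:R + 2^-1) * t)) -
    \sum_(J <= j < n) ln (upa_factor (j.+1%:R * t)).
  by rewrite -(pmulr_rge0 _ t0) mulrBr mulrA tt mul1r.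
have K2 : t^-1 * (upa_prim ((n%:R + 2^-1) * t) - upa_prim ((J%:R + 2^-1) * t)) -
    \sum_(J <= j < n) ln (upa_factor (j.+1%:R * t)) <= t + (J%:R + 2^-1)^-1.
  rewrite -(ler_pM2l t0) mulrBr mulrA tt mul1r (le_trans k2)//.
  rewrite invfM (_ : t / 2 * (t / 2 + t / 2 * ((J%:R + 2^-1)^-1 / t)) =
    t * (t / 4 + (J%:R + 2^-1)^-1 / 4)); last by field; rewrite !gt_eqF.
  rewrite ler_pM2l//; have : 0 < (J%:R + 2^-1 : R)^-1 by rewrite invr_gt0.
  lra.
have L1 : 0 <= t^-1 * upa_prim ((J%:R + 2^-1) * t) + A R / t - ((J%:R + 2^-1) -
    (J%:R + 2^-1) * (ln 2 + ln t + ln (J%:R + 2^-1))).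
  rewrite -(pmulr_rge0 _ t0); apply: (le_trans l1); rewrite le_eqVlt; apply/orP; left.
  by apply/eqP; field; rewrite gt_eqF.
have L2 : t^-1 * upa_prim ((J%:R + 2^-1) * t) + A R / t - ((J%:R + 2^-1) -
    (J%:R + 2^-1) * (ln 2 + ln t + ln (J%:R + 2^-1))) <= 5 * (J%:R + 2^-1) ^+ 2 * t.
  rewrite -(ler_pM2l t0); apply: le_trans (_ : 5 * ((J%:R + 2^-1) * t) ^+ 2 <= _).
    apply: le_trans l2; rewrite le_eqVlt; apply/orP; left.
    by apply/eqP; field; rewrite gt_eqF.
  by rewrite le_eqVlt; apply/orP; left; apply/eqP; ring.
have B : `|t^-1 * upa_prim ((n%:R + 2^-1) * t)| <=
    (3 + pi ^+ 2) * (expR (- (n%:R * t)) / t).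
  by rewrite normrM (gtr0_norm ti) mulrA [leRHS]mulrC ler_pM2l.
move: B; rewrite !ler_norml => /andP[B1 B2].
move: h1 h2 K1 K2 L1 L2 B1 B2.
set s1 := \sum_(0 <= j < J) _; set s2 := \sum_(J <= j < n) _.
set u1 := upa_prim _; set u2 := upa_prim _.
set v := (3 + pi ^+ 2) * _.
by move=> h1 h2 K1 K2 L1 L2 B1 B2; apply/andP; split; lra.
Qed.

(** * Real bounds for the generating function *)

Lemma upa_sum_cvg (R : realType) (t : nat -> R) : (forall n, 0 < t n) ->
  t @ \oo --> (0 : R) -> (fun n => expR (- (n%:R * t n)) / t n) @ \oo --> (0 : R) ->
  (fun n => \sum_(0 <= j < n) ln (upa_factor (j.+1%:R * t n)) - A R / t n
     - 2^-1 * ln (t n)) @ \oo --> (- (ln pi / 2) : R).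
Proof.
move=> t0 tcv ecv; apply: cvgn_approx => eps eps0.
have scv : (fun J => 2^-1 * ln 2 - stirling_seq R J) @ \oo --> (- (ln pi / 2) : R).
  rewrite [X in _ --> X](_ : _ = 2^-1 * ln 2 - ln (2 * pi) / 2).
    by apply: cvgB; [exact: cvg_cst|exact: stirling_cvg].
  by rewrite lnM ?posrE ?pi_gt0//; field.
have icv : (fun J => (J%:R + 2^-1 : R)^-1) @ \oo --> (0 : R).
  apply: (@squeeze_cvgn _ (fun=> 0) _ (fun J => 2 * J.+1%:R^-1)).
  - apply: nearW => J; have J0 : (0 : R) <= J%:R by [].
    rewrite invr_ge0 addr_ge0//= ler_pdivlMr ?ltr0n// mulrC ler_pdivrMr; last lra.
    by rewrite -natr1; lra.
  - exact: cvg_cst.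
  - by rewrite -[X in _ --> X](mulr0 2); apply: cvgMl_tmp; exact: cvg_invn.
have e2 : 0 < eps / 2 by lra.
have [J [J1 J2]] : exists J : nat, `|- (ln pi / 2) - (2^-1 * ln 2 - stirling_seq R J)| <= eps / 2
    /\ `|(J%:R + 2^-1 : R)^-1| <= eps / 2.
  near \oo => J; exists J; split; near: J.
  - exact: cvgr_dist_le scv _ e2.
  - exact: cvgr0_norm_le icv _ e2.
exists (fun=> 2^-1 * ln 2 - stirling_seq R J), (2^-1 * ln 2 - stirling_seq R J).
split; [exact: cvg_cst|lra|].
have bcv : (fun n => 5 * J%:R ^+ 2 * t n + 5 * (J%:R + 2^-1) ^+ 2 * t n + t n +
  (3 + pi ^+ 2) * (expR (- (n%:R * t n)) / t n)) @ \oo --> (0 : R).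
  rewrite [X in _ --> X](_ : _ = 5 * J%:R ^+ 2 * 0 + 5 * (J%:R + 2^-1) ^+ 2 * 0 + 0 +
    (3 + pi ^+ 2) * 0); last by ring.
  by do !apply: cvgD => //; exact: cvgMl_tmp.
have tJ : (fun n => (J%:R + 2^-1) * t n) @ \oo --> (0 : R).
  by rewrite -[X in _ --> X](mulr0 (J%:R + 2^-1)); exact: cvgMl_tmp.
near=> n.
have b : `|5 * J%:R ^+ 2 * t n + 5 * (J%:R + 2^-1) ^+ 2 * t n + t n +
  (3 + pi ^+ 2) * (expR (- (n%:R * t n)) / t n)| <= eps / 2.
  by near: n; exact: cvgr0_norm_le bcv _ e2.
have Jn : (J <= n)%N by near: n; exact: nbhs_infty_ge.
have Jt : `|(J%:R + 2^-1) * t n| <= 1 by near: n; exact: cvgr0_norm_le tJ _ ltr01.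
have {}Jt : (J%:R + 2^-1) * t n <= 1 by exact: le_trans (ler_norm _) Jt.
apply: (le_trans (sum_ln_upa_factor (t0 n) Jn Jt)).
have := ler_norm (5 * J%:R ^+ 2 * t n + 5 * (J%:R + 2^-1) ^+ 2 * t n + t n +
  (3 + pi ^+ 2) * (expR (- (n%:R * t n)) / t n)).
have := ler_norm ((J%:R + 2^-1 : R)^-1); lra.
Unshelve. all: by end_near. Qed.

Definition upa_prod (R : realType) (t : R) (m : nat) : R :=
  \prod_(0 <= j < m) upa_factor (j.+1%:R * t).

Definition upa_main (R : realType) (t : R) : R := Num.sqrt (t / pi) * expR (A R / t).

Lemma upa_prodE (R : realType) (t : R) m : 0 < t ->
  upa_prod t m = expR (\sum_(0 <= j < m) ln (upa_factor (j.+1%:R * t))).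
Proof.
move=> t0; rewrite expR_sum; apply: eq_bigr => j _; rewrite lnK// posrE.
have : 1 < upa_factor (j.+1%:R * t) by apply: upa_factor_gt1; rewrite mulr_gt0// ltr0n.
lra.
Qed.

Lemma upa_prod_cvg (R : realType) (t : nat -> R) : (forall n, 0 < t n) ->
  t @ \oo --> (0 : R) -> (fun n => expR (- (n%:R * t n)) / t n) @ \oo --> (0 : R) ->
  (fun n => upa_prod (t n) n / upa_main (t n)) @ \oo --> (1 : R).
Proof.
move=> t0 tcv ecv; have h := upa_sum_cvg t0 tcv ecv.
have p0 := pi_gt0 R.
have h2 : (fun n => expR (\sum_(0 <= j < n) ln (upa_factor (j.+1%:R * t n)) - A R / t n
     - 2^-1 * ln (t n)) * Num.sqrt pi) @ \oo --> (1 : R).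
  rewrite [X in _ --> X](_ : _ = expR (- (ln pi / 2)) * Num.sqrt pi).
    by apply: cvgMr_tmp; apply: cvgn_comp => //; exact: continuous_expR.
  rewrite -powR12_sqrt ?ltW// /powR gt_eqF// -expRD.
  by rewrite (_ : - (ln pi / 2) + 2^-1 * ln pi = 0 :> R) ?expR0//; field.
apply: cvg_trans h2; apply: near_eq_cvg; apply: nearW => n /=.
rewrite upa_prodE// /upa_main sqrtrM ?ltW// sqrtrV ?ltW// !expRB.
have -> : expR (2^-1 * ln (t n)) = Num.sqrt (t n).
  by rewrite -powR12_sqrt ?ltW// /powR gt_eqF.
by field; rewrite !gt_eqF ?expR_gt0 ?sqrtr_gt0.
Qed.

Section real_bounds.
Context {R : realType}.

Lemma odd_factor_pow n (x : R) j : odd_factor n x j = odd_factor n (x ^+ j.+1) 0.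
Proof. by apply: eq_bigr => k _; rewrite mul1n exprM. Qed.

Lemma top_factor_pow n (x : R) j : top_factor n x j = top_factor n (x ^+ j.+1) 0.
Proof. by apply: eq_bigr => k _; rewrite mul1n exprM. Qed.

Lemma odd_factor_tail n (y : R) : 0 < y < 1 ->
  1 + y / (1 - y ^+ 2) - odd_factor n y 0 = y ^+ (n.+1 + odd n) / (1 - y ^+ 2).
Proof.
move=> y01; have y2 : 0 < 1 - y ^+ 2 by nra.
rewrite /odd_factor; elim: n => [|n IHn].
  by rewrite big_mkcond big_ord_recr big_ord0/= !expr0 add0r addn0 expr1; ring.
rewrite big_mkcond big_ord_recr/= -big_mkcond/= opprD addrA IHn.
rewrite /odd_or_zero /= mul1n; case: (odd n); rewrite /= ?addn0 ?addn1 ?subr0//.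
rewrite (_ : y ^+ n.+3 = y ^+ n.+1 * y ^+ 2); last by rewrite -exprD addn2.
by field; rewrite gt_eqF.
Qed.

Lemma odd_factor_bounds n (y : R) : 0 < y < 1 ->
  1 <= odd_factor n y 0 /\ odd_factor n y 0 <= 1 + y / (1 - y ^+ 2) /\
  1 + y / (1 - y ^+ 2) - odd_factor n y 0 <= y ^+ n / (1 - y).
Proof.
move=> y01; have /andP[y0 y1] := y01; have y2 : 0 < 1 - y ^+ 2 by nra.
have h := odd_factor_tail n y01; split; last split.
- rewrite /odd_factor (bigD1 ord0)//= muln0 expr0 lerDl sumr_ge0// => k _.
  by rewrite exprn_ge0// ltW.
- by rewrite -subr_ge0 h divr_ge0 ?exprn_ge0 ?(ltW y0) ?(ltW y2).
- rewrite h; apply: ler_pM; rewrite ?exprn_ge0 ?invr_ge0 ?(ltW y0) ?(ltW y2)//.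
    by apply: ler_wiXn2l; rewrite ?(ltW y0) ?(ltW y1)// addSn -addnS leq_addr.
  by rewrite lef_pV2 ?posrE//; nra.
Qed.

(** The upper bound is y/(1-y), written as 1+y times the increment of the limiting odd factor above
    1; both bounds are shaped for telescoping over the index of the top factor. *)
Lemma top_factor_bounds n (y : R) : 0 < y < 1 ->
  odd_factor n y 0 - 1 <= top_factor n y 0 <= (1 + y) * (y / (1 - y ^+ 2)).
Proof.
move=> y01; have /andP[y0 y1] := y01; have y2 : 0 < 1 - y ^+ 2 by nra.
apply/andP; split.
  rewrite /odd_factor (bigD1 ord0)//= muln0 expr0 addrAC subrr add0r /top_factor.
  rewrite [leLHS]big_mkcond [leRHS]big_mkcond; apply: ler_sum => k _ /=.
  rewrite -[k != ord0]/(nat_of_ord k != 0) -lt0n.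
  by case: ifP => [/andP[_ ->]//|_]; case: ifP => // _; rewrite exprn_ge0// ltW.
have -> : (1 + y) * (y / (1 - y ^+ 2)) = y / (1 - y).
  by field; rewrite !gt_eqF//; lra.
suff -> : top_factor n y 0 = y / (1 - y) - y ^+ n.+1 / (1 - y).
  by rewrite lerBlDr lerDl divr_ge0 ?exprn_ge0//; lra.
rewrite /top_factor; elim: n => [|n IHn].
  by rewrite big_mkcond big_ord_recr big_ord0/= addr0 expr1 subrr.
rewrite big_mkcond big_ord_recr/= -big_mkcond/= IHn mul1n [y ^+ n.+2]exprS.
by field; rewrite gt_eqF//; lra.
Qed.

Lemma upa_factorE (t : R) j :
  upa_factor (j.+1%:R * t) = 1 + expR (- t) ^+ j.+1 / (1 - (expR (- t) ^+ j.+1) ^+ 2).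
Proof. by rewrite /upa_factor -mulrN expRM_natl. Qed.

Lemma upa_prod_ge1 (t : R) m : 0 < t -> 1 <= upa_prod t m.
Proof.
move=> t0; apply: (@big_ind _ (fun z => 1 <= z)) => // [a b a1 b1|j _].
  by rewrite mulr_ege1.
by apply/ltW/upa_factor_gt1; rewrite mulr_gt0// ltr0n.
Qed.

Lemma upa_prod_le (t : R) m n : 0 < t -> (m <= n)%N -> upa_prod t m <= upa_prod t n.
Proof.
move=> t0 mn; rewrite /upa_prod [leRHS](big_cat_nat (n := m))//=.
rewrite ler_peMr//; first by rewrite (le_trans ler01)// upa_prod_ge1.
apply: (@big_ind _ (fun z => 1 <= z)) => // [a b a1 b1|j _]; first by rewrite mulr_ege1.
by apply/ltW/upa_factor_gt1; rewrite mulr_gt0// ltr0n.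
Qed.

Lemma upa_prodS (t : R) m :
  upa_prod t m.+1 = upa_prod t m * upa_factor (m.+1%:R * t).
Proof. by rewrite /upa_prod big_nat_recr. Qed.

(** About 1/t further indices j keep jt <= K+1, and each contributes a factor at least f(K+1) > 1.
    The division by 2 absorbs rounding: t <= 1/2 gives Lt >= 1/2. *)
Lemma upa_prod_growth (t K : R) M n : 0 < t <= 2^-1 -> 0 < K ->
  M%:R * t <= K -> K + 1 <= n%:R * t ->
  upa_prod t M <= upa_prod t n * expR (- (ln (upa_factor (K + 1)) / 2 / t)).
Proof.
move=> /andP[t0 t2] K0 MK Kn.
pose L := Num.truncn t^-1.
have ti : 0 <= t^-1 by rewrite invr_ge0 ltW.
have /andP[L1 L2] : L%:R <= t^-1 < L.+1%:R by exact: truncn_itv.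
have Lt : L%:R * t <= 1 by rewrite -ler_pdivlMr// mul1r.
have Lt2 : 1 < L.+1%:R * t by rewrite -ltr_pdivrMr// mul1r.
have MLn : (M + L <= n)%N.
  rewrite -(ler_nat R) natrD -(ler_pM2r t0) mulrDl; lra.
have f1 : 1 < upa_factor (K + 1) by apply: upa_factor_gt1; lra.
have h : upa_prod t M * upa_factor (K + 1) ^+ L <= upa_prod t (M + L)%N.
  have : forall l, (l <= L)%N ->
      upa_prod t M * upa_factor (K + 1) ^+ l <= upa_prod t (M + l)%N.
    elim=> [|l IHl] lL; first by rewrite expr0 mulr1 addn0.
    rewrite addnS upa_prodS exprSr mulrA ler_pM ?IHl ?(ltnW lL)//.
    - by rewrite mulr_ge0 ?exprn_ge0 ?(le_trans ler01 (upa_prod_ge1 _ t0))//; lra.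
    - lra.
    - apply: upa_factor_le; first by rewrite mulr_gt0// ltr0n.
      have : (M + l).+1%:R * t <= (M + L)%:R * t by rewrite ler_pM2r// ler_nat -addnS leq_add2l.
      rewrite natrD mulrDl; lra.
  by apply.
have h2 := upa_prod_le t0 MLn.
have fL : expR (ln (upa_factor (K + 1)) / 2 / t) <= upa_factor (K + 1) ^+ L.
  rewrite -[X in _ <= X ^+ _]lnK ?posrE; last lra.
  have SL : L.+1%:R = L%:R + 1 :> R by rewrite natr1.
  have half : 2^-1 <= L%:R * t by move: Lt2; rewrite SL mulrDl mul1r; lra.
  have l0 : 0 <= ln (upa_factor (K + 1)) by apply: ln_ge0; lra.
  rewrite -expRM_natl ler_expR ler_pdivrMr//.
  have : 0 <= ln (upa_factor (K + 1)) * (L%:R * t - 2^-1) by rewrite mulr_ge0//; lra.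
  lra.
rewrite expRN ler_pdivlMr ?expR_gt0//; apply: le_trans h2; apply: le_trans h.
by rewrite ler_pM2l// (lt_le_trans ltr01)// upa_prod_ge1.
Qed.

Lemma expRN_pow_lt1 (t : R) j : 0 < t -> 0 < expR (- t) ^+ j.+1 < 1.
Proof.
by move=> t0; rewrite -expRM_natl mulrN expRN_lt1// mulr_gt0// ltr0n.
Qed.

(** The m-th term is at most (1+y)(P(m+1)-P(m)) with y = e^(-(m+1)t). The part with 1 telescopes to
    P(n); in the other, y <= 1 below M and y <= e^(-Mt) from M on. *)
Lemma upa_poly_le (t : R) n M : 0 < t -> (M <= n)%N ->
  upa_poly n (expR (- t)) <=
  upa_prod t n + upa_prod t M + expR (- (M%:R * t)) * upa_prod t n.
Proof.
move=> t0 Mn; pose P := upa_prod t; pose y m := expR (- t) ^+ m.+1.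
have P1 m : 1 <= P m by exact: upa_prod_ge1.
have h : upa_poly n (expR (- t)) <= \sum_(0 <= m < n) (1 + y m) * (P m.+1 - P m).
  rewrite /upa_poly big_mkord; apply: ler_sum => m _.
  have y01 := expRN_pow_lt1 m t0.
  have /andP[_ t2] := top_factor_bounds n y01.
  have E : (1 + y m) * (P m.+1 - P m) = (1 + y m) * (y m / (1 - y m ^+ 2)) * P m.
    by rewrite /P upa_prodS upa_factorE -/(y m); ring.
  rewrite E top_factor_pow; apply: ler_pM; [| |exact: t2|].
  - by apply: sumr_ge0 => k _; rewrite exprn_ge0//; case/andP: y01 => /ltW.
  - apply: prodr_ge0 => j _; apply: sumr_ge0 => k _; rewrite exprn_ge0// expR_ge0//.
  - rewrite /P /upa_prod big_mkord; apply: ler_prod => j _.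
    have y01' := expRN_pow_lt1 j t0.
    have [h1 [h2 _]] := odd_factor_bounds n y01'.
    by rewrite odd_factor_pow upa_factorE h2 andbT (le_trans ler01 h1).
apply: (le_trans h).
have Pd m : 0 <= P m.+1 - P m by rewrite subr_ge0 upa_prod_le.
have tel a b : (a <= b)%N -> \sum_(a <= m < b) (P m.+1 - P m) = P b - P a.
  by move=> ab; rewrite telescope_sumr.
rewrite (eq_bigr (fun m => (P m.+1 - P m) + y m * (P m.+1 - P m))); last first.
  by move=> m _; rewrite mulrDl mul1r.
rewrite big_split/= tel// (big_cat_nat (n := M))//=.
have s1 : \sum_(0 <= m < M) y m * (P m.+1 - P m) <= P M - P 0%N.
  rewrite -tel//; apply: ler_sum => m _; rewrite ler_piMl//.
  by have /andP[_ /ltW] := expRN_pow_lt1 m t0.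
have s2 : \sum_(M <= m < n) y m * (P m.+1 - P m) <= expR (- (M%:R * t)) * (P n - P M).
  rewrite -tel// mulr_sumr [leLHS]big_nat [leRHS]big_nat.
  apply: ler_sum => m /andP[Mm _]; rewrite ler_wpM2r//.
  rewrite /y -expRM_natl ler_expR mulrN lerN2 ler_pM2r// ler_nat; lia.
have p0 := P1 0%N; have pM := P1 M; have e0 := expR_gt0 (- (M%:R * t)).
rewrite /P in s1 s2 p0 pM *; nra.
Qed.

(** The terms dominate the increments of the truncated product [O], which telescope. Each truncated
    factor is within [del] of a full factor exceeding 1, so truncation costs a relative loss of at
    most n [del]. *)
Lemma upa_poly_ge (t : R) n : 0 < t ->
  upa_prod t n * (1 - n%:R * (expR (- (n%:R * t)) / (1 - expR (- t)))) - 1 <=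
  upa_poly n (expR (- t)).
Proof.
move=> t0; set del := expR (- (n%:R * t)) / _.
have /andP[q0 q1] := expRN_lt1 t0.
have del0 : 0 <= del by rewrite divr_ge0 ?expR_ge0//; lra.
pose O m := \prod_(0 <= j < m) odd_factor n (expR (- t)) j.
have o1 j : 1 <= odd_factor n (expR (- t)) j.
  by rewrite odd_factor_pow; have [] := odd_factor_bounds n (expRN_pow_lt1 j t0).
have od j : upa_factor (j.+1%:R * t) - del <= odd_factor n (expR (- t)) j.
  have y01 := expRN_pow_lt1 j t0; have /andP[y0 y1] := y01.
  have [_ [_ h]] := odd_factor_bounds n y01.
  have yq : expR (- t) ^+ j.+1 <= expR (- t).
    by rewrite exprS ler_piMr ?exprn_ile1 ?(ltW q0) ?(ltW q1).
  have : (expR (- t) ^+ j.+1) ^+ n / (1 - expR (- t) ^+ j.+1) <= del.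
    rewrite /del -mulrN expRM_natl; apply: ler_pM; rewrite ?exprn_ge0 ?invr_ge0 ?(ltW y0)//; try lra.
    - by rewrite lerXn2r ?nnegrE ?(ltW y0) ?(ltW q0).
    - by rewrite lef_pV2 ?posrE; lra.
  by rewrite odd_factor_pow upa_factorE; lra.
have O1 m : 1 <= O m.
  by apply: (@big_ind _ (fun z => 1 <= z)) => // a b a1 b1; rewrite mulr_ege1.
have PO m : upa_prod t m * (1 - m%:R * del) <= O m.
  elim: m => [|m IHm]; first by rewrite mul0r subr0 mulr1 /upa_prod /O !big_geq.
  have f1 : 1 < upa_factor (m.+1%:R * t) by apply: upa_factor_gt1; rewrite mulr_gt0// ltr0n.
  have P1 := upa_prod_ge1 m t0.
  have Sm : m.+1%:R * del = m%:R * del + del by rewrite -natr1; ring.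
  rewrite upa_prodS /O big_nat_recr//= -/(O m) Sm.
  have m0 : 0 <= m%:R * del by rewrite mulr_ge0.
  have [c|c] := leP (1 - m%:R * del) 0.
    apply: (@le_trans _ _ 0); last by rewrite mulr_ge0 ?(le_trans ler01)//.
    have p0 : 0 <= upa_prod t m * upa_factor (m.+1%:R * t) by rewrite mulr_ge0//; lra.
    by rewrite mulr_ge0_le0//; lra.
  apply: (@le_trans _ _ (upa_prod t m * (1 - m%:R * del) * (upa_factor (m.+1%:R * t) - del))); last first.
    apply: (@le_trans _ _ (upa_prod t m * (1 - m%:R * del) * odd_factor n (expR (- t)) m)).
      by rewrite ler_wpM2l ?od// mulr_ge0//; lra.
    by rewrite ler_wpM2r// (le_trans ler01).
  rewrite -!mulrA ler_pM2l; last lra.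
  move: f1; move: (upa_factor _) => f f1.
  have : f * (del * (m%:R * del)) + del * (f - 1) + m%:R * del * del * (1 - f) >= 0.
    have : f * (del * (m%:R * del)) + m%:R * del * del * (1 - f) = m%:R * del * del by ring.
    have : 0 <= m%:R * del * del by rewrite mulr_ge0.
    have : 0 <= del * (f - 1) by rewrite mulr_ge0//; lra.
    lra.
  lra.
apply: (@le_trans _ _ (O n - 1)); first by rewrite lerD2r.
have -> : O n - 1 = \sum_(0 <= m < n) (O m.+1 - O m).
  have O0 : O 0%N = 1 by rewrite /O big_geq.
  by rewrite telescope_sumr// O0.
rewrite big_mkord; apply: ler_sum => m _.
rewrite {1}/O big_nat_recr//= -/(O m) -[X in _ - X]mulr1 -mulrBr mulrC /O big_mkord.
rewrite ler_wpM2r//.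
  by apply: prodr_ge0 => j _; rewrite (le_trans ler01).
rewrite odd_factor_pow top_factor_pow.
by have /andP[] := top_factor_bounds n (expRN_pow_lt1 m t0).
Qed.

End real_bounds.

Lemma expRN_le_inv (R : realType) (x : R) : 0 < x -> expR (- x) <= x^-1.
Proof.
move=> x0; rewrite expRN lef_pV2 ?posrE ?expR_gt0//.
by have := expR_ge1Dx x; lra.
Qed.

Lemma upa_poly_cvg (R : realType) (t : nat -> R) : (forall n, 0 < t n) ->
  t @ \oo --> (0 : R) ->
  (fun n => n%:R * (expR (- (n%:R * t n)) / t n)) @ \oo --> (0 : R) ->
  (forall C : R, \forall n \near \oo, C <= n%:R * t n) ->
  (fun n => upa_poly n (expR (- t n)) / upa_main (t n)) @ \oo --> (1 : R).
Proof.
move=> t0 tcv ncv nt.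
have ecv : (fun n => expR (- (n%:R * t n)) / t n) @ \oo --> (0 : R).
  apply: (@squeeze_cvgn _ (fun=> 0) _ (fun n => n%:R * (expR (- (n%:R * t n)) / t n))) => //.
    near=> n; have n1 : (0 < n)%N by near: n; exact: nbhs_infty_gt.
    have e0 : 0 <= expR (- (n%:R * t n)) / t n by rewrite divr_ge0 ?expR_ge0// ltW.
    by rewrite e0 ler_peMl// ler1n.
  exact: cvg_cst.
have h := upa_prod_cvg t0 tcv ecv.
have P0 n : 0 < upa_prod (t n) n by rewrite (lt_le_trans ltr01)// upa_prod_ge1.
suff h2 : (fun n => upa_poly n (expR (- t n)) / upa_prod (t n) n) @ \oo --> (1 : R).
  have h3 : (fun n => upa_poly n (expR (- t n)) / upa_prod (t n) n *
      (upa_prod (t n) n / upa_main (t n))) @ \oo --> (1 * 1 : R) by exact: cvgM.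
  rewrite mulr1 in h3.
  apply: cvg_trans h3; apply: near_eq_cvg; apply: nearW => n /=.
  by rewrite mulrA divfK// gt_eqF.
apply/cvgrPdist_le => eps eps0.
(* Chosen so that e^-K <= 1/K = eps/3; the split index [M] satisfies K <= Mt <= K+1. *)
pose K : R := 3 / eps.
have K0 : 0 < K by rewrite divr_gt0.
have eK : expR (- K) <= eps / 3 by rewrite (le_trans (expRN_le_inv K0))// /K invf_div.
pose c := ln (upa_factor (K + 1 + 1)) / 2.
have c0 : 0 < c.
  rewrite divr_gt0// ln_gt0// upa_factor_gt1//; lra.
near=> n.
have tn := t0 n.
have t2 : `|t n| <= 2^-1.
  near: n; apply: cvgr0_norm_le tcv _ _; lra.
rewrite (gtr0_norm tn) in t2.
have t3 : `|t n| <= c * (eps / 3).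
  near: n; apply: cvgr0_norm_le tcv _ _; rewrite mulr_gt0//; lra.
rewrite (gtr0_norm tn) in t3.
have nK : K + 1 + 1 <= n%:R * t n by near: n; exact: nt.
have ne : `|n%:R * (expR (- (n%:R * t n)) / t n)| <= eps / 6.
  near: n; apply: cvgr0_norm_le ncv _ _; lra.
have {}ne := le_trans (ler_norm _) ne.
have ect : expR (- (c / t n)) <= eps / 3.
  have ct : 0 < c / t n by rewrite divr_gt0.
  by apply: (le_trans (expRN_le_inv ct)); rewrite invf_div ler_pdivrMr// mulrC.
have t12 : 0 < t n <= 2^-1 by rewrite tn.
have K1 : 0 < K + 1 by lra.
pose M := (Num.truncn (K / t n)).+1.
have /andP[M1 M2] : (Num.truncn (K / t n))%:R <= K / t n < M%:R.
  by apply: truncn_itv; rewrite divr_ge0// ltW.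
have MK : K <= M%:R * t n by rewrite ltW// -ltr_pdivrMr.
have MK1 : M%:R * t n <= K + 1.
  rewrite ler_pdivlMr// in M1.
  by rewrite /M -natr1 mulrDl mul1r; lra.
have Mn : (M <= n)%N by rewrite -(ler_nat R) -(ler_pM2r tn); lra.
have gM := upa_prod_growth t12 K1 MK1 nK.
have g0 : upa_prod (t n) 0%N <= upa_prod (t n) n * expR (- (c / t n)).
  by apply: (upa_prod_growth t12 K1) => //; rewrite mul0r ltW.
rewrite -/c in gM; rewrite /upa_prod big_geq// -/(upa_prod _ _) in g0.
have u := upa_poly_le tn Mn; have l := upa_poly_ge n tn.
have eM : expR (- (M%:R * t n)) <= eps / 3.
  by apply: (le_trans _ eK); rewrite ler_expR lerN2.
have dl : n%:R * (expR (- (n%:R * t n)) / (1 - expR (- t n))) <= eps / 3.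
  have q : t n / 2 <= 1 - expR (- t n).
    have h1 : expR (- t n) * (1 + t n) <= 1.
      by rewrite expRN mulrC ler_pdivrMr ?expR_gt0// mul1r expR_ge1Dx.
    have := expR_gt0 (- t n); nra.
  apply: (@le_trans _ _ (2 * (n%:R * (expR (- (n%:R * t n)) / t n)))); last lra.
  rewrite [leRHS]mulrCA ler_wpM2l// [leRHS]mulrCA ler_wpM2l ?expR_ge0//.
  have -> : 2 / t n = (t n / 2)^-1 by rewrite invf_div.
  by rewrite lef_pV2 ?posrE//; lra.
have Pn := P0 n; set P := upa_prod (t n) n in u l gM g0 Pn *.
rewrite ler_norml lerBlDr lerBrDr; apply/andP; split.
  rewrite -(ler_pM2r Pn) mulrDl divfK ?gt_eqF// mul1r.
  apply: (@le_trans _ _ (- eps * P + (P + upa_prod (t n) M + expR (- (M%:R * t n)) * P))).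
    by rewrite lerD2l.
  have : P * expR (- (c / t n)) <= P * (eps / 3) by rewrite ler_pM2l.
  have : expR (- (M%:R * t n)) * P <= eps / 3 * P by rewrite ler_pM2r.
  lra.
rewrite -(ler_pM2r Pn) mulrDl divfK ?gt_eqF// mul1r.
have : P * expR (- (c / t n)) <= P * (eps / 3) by rewrite ler_pM2l.
have : P * (n%:R * (expR (- (n%:R * t n)) / (1 - expR (- t n)))) <= P * (eps / 3).
  by rewrite ler_pM2l.
move: l; set X := n%:R * (_ / _); lra.
Unshelve. all: by end_near. Qed.

(** * Bounds off the real axis *)

Section complex_bounds.
Context {R : realType}.
Import Normc.

Definition cis (x : R) : R[i] := Complex (cos x) (sin x).

Lemma cisD x y : cis (x + y) = cis x * cis y.
Proof. by rewrite /cis cosD sinD addrC [X in Complex _ X]addrC addrC. Qed.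

Lemma cisX x k : cis x ^+ k = cis (k%:R * x).
Proof.
elim: k => [|k IHk]; first by rewrite mul0r /cis cos0 sin0.
by rewrite exprS IHk -cisD -natr1; congr cis; ring.
Qed.

Lemma normc_cis x : normc (cis x) = 1.
Proof. by rewrite /= cos2Dsin2 sqrtr1. Qed.

Lemma normc_real (r : R) : 0 <= r -> normc (real_complex R r) = r.
Proof. by move=> r0; rewrite /= expr0n addr0 sqrtr_sqr ger0_norm. Qed.

Lemma normcX (z : R[i]) k : normc (z ^+ k) = normc z ^+ k.
Proof. by elim: k => [|k IHk]; rewrite ?expr0 ?normc1// !exprS normcM IHk. Qed.

Lemma normc_ge0 (z : R[i]) : 0 <= normc z.
Proof. by case: z => a b; exact: sqrtr_ge0. Qed.

Lemma normc_sum_le (I : Type) (r : seq I) (P : pred I) (f : I -> R[i]) :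
  normc (\sum_(i <- r | P i) f i) <= \sum_(i <- r | P i) normc (f i).
Proof.
elim/big_rec2: _ => [|i a b _ h]; first by rewrite normc0.
by rewrite (le_trans (le_normcD _ _))// lerD2l.
Qed.

Lemma normc_prod (I : Type) (r : seq I) (f : I -> R[i]) :
  normc (\prod_(i <- r) f i) = \prod_(i <- r) normc (f i).
Proof. by elim/big_rec2: _ => [|i a b _ <-]; rewrite ?normc1 ?normcM. Qed.

Lemma Re_le_normc (z : R[i]) : `|complex.Re z| <= normc z.
Proof.
case: z => a b /=; rewrite -sqrtr_sqr ler_sqrt ?addr_ge0 ?sqr_ge0//.
by rewrite lerDl sqr_ge0.
Qed.

Definition polar (q th : R) : R[i] := real_complex R q * cis th.

Lemma normc_polarX q th k : 0 <= q -> normc (polar q th ^+ k) = q ^+ k.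
Proof. by move=> q0; rewrite normcX normcM normc_cis mulr1 normc_real. Qed.

Lemma polarX q th k : polar q th ^+ k = polar (q ^+ k) (k%:R * th).
Proof. by rewrite /polar exprMn cisX -rmorphXn. Qed.

(** Multiplying by e^(-i n th) centres the frequencies at n, which matches the cosine transform of
    [local_limit] with a polynomial value on a circle. *)
Lemma sum_cos_Re q th (N n : nat) (c : nat -> nat) :
  \sum_(k < N) (c k)%:R * q ^+ k * cos (th * (k%:R - n%:R)) =
  complex.Re ((\sum_(k < N) (c k)%:R * polar q th ^+ k) * cis (- (n%:R * th))).
Proof.
have ReD (u v : R[i]) : complex.Re (u + v) = complex.Re u + complex.Re v.
  by case: u v => [a b] [a' b'].
rewrite mulr_suml; elim/big_rec2: _ => [//|k a b _ ->]; rewrite ReD; congr (_ + _).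
have natE : (c k)%:R = real_complex R (c k)%:R by rewrite (rmorph_nat (real_complex R)).
rewrite polarX /polar natE [in RHS]mulrA -(rmorphM (real_complex R)) -[in RHS]mulrA -cisD /=.
rewrite mul0r subr0; congr (_ * cos _); ring.
Qed.

Lemma sin_ge_half (x : R) : 0 < x <= pi / 2 -> x / 2 <= sin x.
Proof.
move=> /andP[x0 x1]; have p := pi_gt0 R.
have h : 0 < x / 2 < pi / 2 by lra.
have := id_le_tan h; have c0 : 0 < cos (x / 2) by apply: cos_gt0_pihalf; lra.
rewrite /tan ler_pdivlMr// => h1.
have cx : 0 <= cos x by apply: cos_ge0_pihalf; lra.
have e : x = (x / 2) *+ 2 by rewrite -mulr_natr; field.
have e1 : sin x = 2 * (cos (x / 2) * sin (x / 2)) by rewrite {1}e sin_mulr2n mulr_natl.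
have e2 : cos x = 2 * cos (x / 2) ^+ 2 - 1 by rewrite {1}e cos_mulr2n mulr_natl.
rewrite e1; have : 2^-1 <= cos (x / 2) ^+ 2 by lra.
have : cos (x / 2) * (x / 2 * cos (x / 2)) <= cos (x / 2) * sin (x / 2) by rewrite ler_pM2l.
nra.
Qed.

Lemma onem_cos_ge (x : R) : 0 <= x <= pi -> x ^+ 2 / 8 <= 1 - cos x.
Proof.
rewrite le_eqVlt => /andP[/predU1P[<- _|x0 x1]].
  by rewrite cos0 subrr expr0n mul0r.
have h : 0 < x / 2 <= pi / 2 by lra.
have s := sin_ge_half h.
have e : x = (x / 2) *+ 2 by rewrite -mulr_natr; field.
rewrite {2}e cos_mulr2n cos2sin2 -mulr_natl; nra.
Qed.

(** Dirichlet kernel: multiplication by 2 sin(th/2) telescopes the sum to at most 2, and sin(th/2)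
    >= th/4. *)
Lemma sum_cos_le (th : R) a l : 0 < th <= pi ->
  \sum_(a <= j < a + l) cos (j.+1%:R * th) <= 4 / th.
Proof.
move=> /andP[th0 thp].
have h : 0 < th / 2 <= pi / 2 by lra.
have s := sin_ge_half h.
have s0 : 0 < sin (th / 2) by lra.
have E : 2 * sin (th / 2) * \sum_(a <= j < a + l) cos (j.+1%:R * th) =
    sin (((a + l)%:R + 2^-1) * th) - sin ((a%:R + 2^-1) * th).
  elim: l => [|l IHl]; first by rewrite addn0 big_geq// mulr0 subrr.
  rewrite addnS big_nat_recr ?leq_addr//= mulrDr IHl.
  have -> : ((a + l).+1%:R + 2^-1) * th = (a + l).+1%:R * th + th / 2 by field.
  have -> : ((a + l)%:R + 2^-1) * th = (a + l).+1%:R * th - th / 2.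
    by rewrite -[(a + l).+1%:R]natr1; field.
  by rewrite sinB sinD; ring.
have : 2 * sin (th / 2) * \sum_(a <= j < a + l) cos (j.+1%:R * th) <= 2.
  by rewrite E; have := sin_le1 (((a + l)%:R + 2^-1) * th);
     have := sin_geN1 ((a%:R + 2^-1) * th); lra.
set S := \sum_(_ <= _ < _) _ => hS.
rewrite ler_pdivlMr//; have [S0|S0] := leP S 0; first by nra.
have : th / 4 * S <= sin (th / 2) * S by rewrite ler_pM2r//; lra.
lra.
Qed.

(** The square of the right side is the squared modulus (1+y)^2 - 2y(1-cos psi) plus a square. *)
Lemma normc_onep (y psi : R) : 0 < y ->
  normc (1 + polar y psi) <= 1 + y - y * (1 - cos psi) / (1 + y).
Proof.
move=> y0.
have c1 := cos_le1 psi; have c2 := cos_geN1 psi; have cs := cos2Dsin2 psi.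
have y1 : 0 < 1 + y by lra.
have r0 : 0 <= 1 + y - y * (1 - cos psi) / (1 + y).
  rewrite subr_ge0 ler_pdivrMr//; nra.
rewrite -[leRHS]gtr0_norm; last first.
  rewrite lt_neqAle r0 andbT eq_sym subr_eq0; apply/eqP => e.
  have : (1 + y) * (1 + y) = y * (1 - cos psi) by rewrite {1}e divfK// gt_eqF.
  nra.
rewrite -sqrtr_sqr /= !mul0r subr0 addr0 add0r ler_sqrt ?sqr_ge0//.
rewrite [leRHS](_ : _ = (1 + y) ^+ 2 - 2 * y * (1 - cos psi) +
  (y * (1 - cos psi) / (1 + y)) ^+ 2); last by field; rewrite gt_eqF.
have := sqr_ge0 (y * (1 - cos psi) / (1 + y)).
have -> : (1 + y * cos psi) ^+ 2 + (y * sin psi) ^+ 2 =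
  1 + 2 * y * cos psi + y ^+ 2 * (cos psi ^+ 2 + sin psi ^+ 2) by ring.
rewrite cs; nra.
Qed.

(** Only the interference of the terms k = 0 and k = 1 is exploited, the others being bounded by
    their moduli; 1-x <= e^-x makes the gain multiplicative. *)
Lemma normc_odd_factor_le n (t th : R) j : 0 < t -> (0 < n)%N ->
  normc (odd_factor n (polar (expR (- t)) th) j) <=
  upa_factor (j.+1%:R * t) * expR (- (expR (- t) ^+ j.+1 * (1 - cos (j.+1%:R * th)) /
    (2 * upa_factor (j.+1%:R * t)))).
Proof.
move=> t0 n0; have q0 := expR_ge0 (- t).
have y01 := expRN_pow_lt1 j t0; have /andP[y0 y1] := y01.
set y := expR (- t) ^+ j.+1 in y0 y1 y01 *.
set f := upa_factor _; set C := 1 - cos _.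
have c0 : 0 <= C by rewrite subr_ge0 cos_le1.
have f1 : 1 < f by apply: upa_factor_gt1; rewrite mulr_gt0// ltr0n.
have [_ [hob _]] := odd_factor_bounds n y01.
have i1 : (1 < n.+1)%N by [].
have h : normc (odd_factor n (polar (expR (- t)) th) j) <= odd_factor n y 0 - y * C / (1 + y).
  rewrite /odd_factor (bigD1 ord0)//= (bigD1 (Ordinal i1))//= [in leRHS](bigD1 ord0)//=.
  rewrite [in leRHS](bigD1 (Ordinal i1))//= !muln0 !muln1 !expr0 !addrA expr1.
  apply: (le_trans (le_normcD _ _)); rewrite [leRHS]addrAC lerD//.
    by rewrite polarX; exact: normc_onep.
  apply: (le_trans (normc_sum_le _ _ _)); apply: ler_sum => k _.
  by rewrite normc_polarX// mul1n exprM.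
apply: (le_trans h).
apply: (@le_trans _ _ (f - y * C / 2)).
  rewrite lerB//; first by rewrite /f upa_factorE.
  by rewrite ler_wpM2l ?mulr_ge0 ?(ltW y0)// lef_pV2 ?posrE; lra.
have := expR_ge1Dx (- (y * C / (2 * f))).
rewrite -(ler_pM2l (lt_trans ltr01 f1)); apply: le_trans.
rewrite le_eqVlt; apply/orP; left; apply/eqP; field; rewrite gt_eqF//; lra.
Qed.

(** Uniform lower bound for the gain e^-x/(2 f(x)) of a factor with 1 <= x <= 7. *)
Definition kap : R := expR (- 7) / (2 * upa_factor 1).

Lemma kap_gt0 : 0 < kap.
Proof.
have := upa_factor_gt1 (@ltr01 R) => h.
by rewrite divr_gt0 ?expR_gt0// mulr_gt0//; lra.
Qed.

Lemma normc_odd_prod_le n m a b (t th : R) : 0 < t -> (0 < n)%N ->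
  (a <= b)%N -> (b <= m)%N ->
  (forall j, (a <= j < b)%N -> 1 <= j.+1%:R * t <= 7) ->
  \prod_(0 <= j < m) normc (odd_factor n (polar (expR (- t)) th) j) <=
  upa_prod t m * expR (- (kap * \sum_(a <= j < b) (1 - cos (j.+1%:R * th)))).
Proof.
move=> t0 n0 ab bm hab.
pose k j := expR (- t) ^+ j.+1 * (1 - cos (j.+1%:R * th)) /
    (2 * upa_factor (j.+1%:R * t)).
have f1 j : 1 < upa_factor (j.+1%:R * t) by apply: upa_factor_gt1; rewrite mulr_gt0// ltr0n.
have k0 j : 0 <= k j.
  rewrite divr_ge0 ?mulr_ge0 ?exprn_ge0 ?expR_ge0 ?subr_ge0 ?cos_le1//.
  by have := f1 j; lra.
apply: (@le_trans _ _ (\prod_(0 <= j < m) (upa_factor (j.+1%:R * t) * expR (- k j)))).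
  by apply: ler_prod => j _; rewrite normc_ge0/=; exact: normc_odd_factor_le.
have P0 : 0 <= upa_prod t m by rewrite (le_trans ler01)// upa_prod_ge1.
rewrite big_split/= -/(upa_prod t m) -expR_sum ler_wpM2l//.
rewrite ler_expR sumrN lerN2 mulr_sumr.
rewrite [leRHS](big_cat_nat (n := a))//=; last exact: leq_trans bm.
rewrite [X in _ + X](big_cat_nat (n := b))//=.
apply: (@le_trans _ _ (\sum_(a <= j < b) k j)); last first.
  rewrite addrCA lerDl addr_ge0// sumr_ge0//.
rewrite [leLHS]big_nat [leRHS]big_nat; apply: ler_sum => j /hab/andP[h1 h2].
have c0 : 0 <= 1 - cos (j.+1%:R * th) by rewrite subr_ge0 cos_le1.
rewrite /k [leRHS]mulrAC ler_wpM2r// /kap.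
have q : upa_factor (j.+1%:R * t) <= upa_factor 1 by exact: upa_factor_le.
apply: ler_pM; rewrite ?expR_ge0 ?invr_ge0//.
- by have := upa_factor_gt1 (@ltr01 R); lra.
- by rewrite -expRM_natl ler_expR mulrN lerN2.
- rewrite lef_pV2 ?posrE ?mulr_gt0//; have := f1 j; lra.
Qed.

(** Two regimes. If th <= t, at least 1/(2t) indices j have jt in [1, 2]; there j th <= 2 < pi and
    1-cos(j th) >= (th/t)^2/8. If th > t, the 6a indices up to 7a give at least 6(1/t-1) minus the
    cosine sum, itself at most 4/t; what remains, 2/t-6, is at least 1/t because t <= 1/6. *)
Lemma normc_odd_prod_decay n m a (t th : R) : 0 < t <= 6^-1 -> (0 < n)%N ->
  0 <= th <= pi -> a%:R * t <= 1 < a.+1%:R * t -> (7 * a <= m)%N ->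
  \prod_(0 <= j < m) normc (odd_factor n (polar (expR (- t)) th) j) <=
  upa_prod t m * (expR (- (kap / t)) + expR (- (kap / 16 * (th ^+ 2 / t ^+ 3)))).
Proof.
move=> /andP[t0 t6] n0 /andP[th0 thp] /andP[a1 a2] am.
have kp := kap_gt0.
have Sa : a.+1%:R * t = a%:R * t + t by rewrite -natr1; ring.
have P0 : 0 <= upa_prod t m by rewrite (le_trans ler01)// upa_prod_ge1.
have lo j : (a <= j)%N -> 1 <= j.+1%:R * t.
  by move=> aj; rewrite (le_trans (ltW a2))// ler_pM2r// ler_nat.
have hi j c : (j < c * a)%N -> j.+1%:R * t <= c%:R.
  move=> jc; apply: (@le_trans _ _ ((c * a)%:R * t)); first by rewrite ler_pM2r// ler_nat.
  by rewrite natrM -mulrA ler_piMr.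
have [tht|tht] := leP th t.
  have h : forall j, (a <= j < 2 * a)%N -> 1 <= j.+1%:R * t <= 7.
    by move=> j /andP[aj ja]; rewrite lo//=; have := hi _ _ ja; lra.
  have aa : (a <= 2 * a)%N by rewrite mul2n -addnn leq_addr.
  have am2 : (2 * a <= m)%N by rewrite (leq_trans _ am)// leq_mul2r orbT.
  apply: (le_trans (normc_odd_prod_le th t0 n0 aa am2 h)); rewrite ler_wpM2l//.
  apply: (@le_trans _ _ (expR (- (kap / 16 * (th ^+ 2 / t ^+ 3))))); last first.
    by rewrite lerDr expR_ge0.
  rewrite ler_expR lerN2 -mulrA ler_pM2l//.
  apply: (@le_trans _ _ (\sum_(a <= j < 2 * a) ((th / t) ^+ 2 / 8))).
    rewrite sumr_const_nat mul2n -addnn addnK -[leRHS]mulr_natl.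
    rewrite [leLHS](_ : _ = (2 * t)^-1 * ((th / t) ^+ 2 / 8)); last first.
      by field; rewrite gt_eqF.
    rewrite ler_wpM2r ?divr_ge0 ?sqr_ge0//.
    by rewrite -[leLHS]div1r ler_pdivrMr ?mulr_gt0//; lra.
  rewrite [leLHS]big_nat [leRHS]big_nat; apply: ler_sum => j /andP[aj ja].
  have l1 := lo _ aj; have l2 := hi _ _ ja.
  have r1 : th / t <= j.+1%:R * th by rewrite ler_pdivrMr// mulrAC ler_peMl.
  have r2 : j.+1%:R * th <= 2.
    by apply: (le_trans _ l2); rewrite ler_wpM2l.
  have r0 : 0 <= th / t by rewrite divr_ge0// ltW.
  have rp : 0 <= j.+1%:R * th <= pi by have := pi_ge2 R; lra.
  apply: (le_trans _ (onem_cos_ge rp)).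
  by rewrite ler_pM2r// lerXn2r ?nnegrE//; lra.
have h : forall j, (a <= j < 7 * a)%N -> 1 <= j.+1%:R * t <= 7.
  by move=> j /andP[aj ja]; rewrite lo//=; exact: hi ja.
have aa : (a <= 7 * a)%N by rewrite leq_pmull.
apply: (le_trans (normc_odd_prod_le th t0 n0 aa am h)); rewrite ler_wpM2l//.
apply: (@le_trans _ _ (expR (- (kap / t)))); last by rewrite lerDl expR_ge0.
rewrite ler_expR lerN2 ler_pM2l// sumrB sumr_const_nat.
have thp0 : 0 < th <= pi by rewrite thp andbT; lra.
have := @sum_cos_le th a (6 * a) thp0; rewrite -mulSn.
have : 4 / th <= 4 / t by rewrite ler_pM2l// lef_pV2 ?posrE//; lra.
have -> : (7 * a - a = 6 * a)%N by rewrite mulSn addKn.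
have : 6 * (t^-1 - 1) <= (6 * a)%:R :> R.
  by rewrite natrM ler_pM2l// lerBlDr -[leLHS]div1r ler_pdivrMr// mulrDl mul1r; lra.
have : 6 <= t^-1 by rewrite -[leLHS]invrK lef_pV2 ?posrE ?invr_gt0.
lra.
Qed.

(** Split at m = 7a. Earlier terms total at most 2 P(7a), exponentially smaller than P(n) by
    [upa_prod_growth]; later ones all carry the decay of the odd product. Top factors are at most
    2(f-1), so both pieces telescope. *)
Lemma normc_upa_poly_le n (t th : R) : 0 < t <= 6^-1 -> 0 <= th <= pi ->
  7 + 1 <= n%:R * t ->
  normc (upa_poly n (polar (expR (- t)) th)) <=
  2 * upa_prod t n * (expR (- (ln (upa_factor (7 + 1)) / 2 / t)) +
    (expR (- (kap / t)) + expR (- (kap / 16 * (th ^+ 2 / t ^+ 3))))).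
Proof.
move=> t06 thp nt; have /andP[t0 t6] := t06.
have n0 : (0 < n)%N by case: n nt => //; rewrite mul0r; lra.
have ti : 0 <= t^-1 by rewrite invr_ge0 ltW.
pose a := Num.truncn t^-1.
have /andP[a1 a2] : a%:R <= t^-1 < a.+1%:R by exact: truncn_itv.
have at1 : a%:R * t <= 1 < a.+1%:R * t.
  by rewrite -ler_pdivlMr// -ltr_pdivrMr// mul1r a1.
have at7 : (7 * a)%:R * t <= 7.
  by rewrite natrM -mulrA ler_piMr//; case/andP: at1.
have an : (7 * a <= n)%N by rewrite -(ler_nat R) -(ler_pM2r t0); lra.
have t2 : 0 < t <= 2^-1 by lra.
have g := upa_prod_growth t2 (ltr0n R 7) at7 nt.
set E := expR (- (kap / t)) + _.
have E0 : 0 <= E by rewrite addr_ge0 ?expR_ge0.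
pose P := upa_prod t.
have Pd m : 0 <= P m.+1 - P m by rewrite subr_ge0 upa_prod_le.
have tel b c : (b <= c)%N -> \sum_(b <= m < c) (P m.+1 - P m) = P c - P b.
  by move=> bc; rewrite telescope_sumr.
have P1 m : 1 <= P m by exact: upa_prod_ge1.
have top m : normc (top_factor n (polar (expR (- t)) th) m) <= 2 * (upa_factor (m.+1%:R * t) - 1).
  have y01 := expRN_pow_lt1 m t0; have /andP[y0 y1] := y01.
  apply: (@le_trans _ _ (top_factor n (expR (- t)) m)).
    apply: (le_trans (normc_sum_le _ _ _)); apply: ler_sum => k _.
    by rewrite normc_polarX ?expR_ge0.
  have /andP[_ h] := top_factor_bounds n y01.
  rewrite top_factor_pow (le_trans h)// upa_factorE addrAC subrr add0r ler_wpM2r//.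
    by rewrite divr_ge0 ?(ltW y0)//; nra.
  lra.
have od m : \prod_(0 <= j < m) normc (odd_factor n (polar (expR (- t)) th) j) <= P m.
  have h j : (0 <= j < 0)%N -> 1 <= j.+1%:R * t <= 7 by rewrite ltn0 andbF.
  have := normc_odd_prod_le th t0 n0 (leqnn 0) (leq0n m) h.
  by rewrite [X in kap * X]big_geq// mulr0 oppr0 expR0 mulr1.
have od0 m : 0 <= \prod_(0 <= j < m) normc (odd_factor n (polar (expR (- t)) th) j).
  by apply: prodr_ge0 => j _; exact: normc_ge0.
have term m : (P m.+1 - P m) = (upa_factor (m.+1%:R * t) - 1) * P m.
  by rewrite /P upa_prodS; ring.
apply: (le_trans (normc_sum_le _ _ _)).
rewrite -(big_mkord predT (fun m => normc (top_factor n (polar (expR (- t)) th) m *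
  \prod_(j < m) odd_factor n (polar (expR (- t)) th) j))).
rewrite (big_cat_nat (n := (7 * a)%N))//=.
have s1 : \sum_(0 <= m < 7 * a) normc (top_factor n (polar (expR (- t)) th) m *
    \prod_(j < m) odd_factor n (polar (expR (- t)) th) j) <= 2 * (P (7 * a)%N - P 0%N).
  rewrite -tel// mulr_sumr; apply: ler_sum => m _.
  rewrite normcM normc_prod -(big_mkord predT (fun j => normc (odd_factor n _ j))) term mulrA.
  by apply: ler_pM => //; exact: normc_ge0.
have s2 : \sum_(7 * a <= m < n) normc (top_factor n (polar (expR (- t)) th) m *
    \prod_(j < m) odd_factor n (polar (expR (- t)) th) j) <= 2 * E * (P n - P (7 * a)%N).
  rewrite -tel// mulr_sumr [leLHS]big_nat [leRHS]big_nat; apply: ler_sum => m /andP[am _].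
  rewrite normcM normc_prod -(big_mkord predT (fun j => normc (odd_factor n _ j))) term.
  have d := normc_odd_prod_decay t06 n0 thp at1 am.
  rewrite (_ : 2 * E * _ = 2 * (upa_factor (m.+1%:R * t) - 1) * (P m * E)); last by ring.
  by apply: ler_pM => //; exact: normc_ge0.
have p0 := P1 0%N; have pa := P1 (7 * a)%N; have pn := P1 n.
rewrite -/(P _) -/(P _) in g *.
have EP : 0 <= E * P (7 * a)%N by rewrite mulr_ge0//; lra.
lra.
Qed.

End complex_bounds.

(** * The saddle point *)

Lemma A_gt0 (R : realType) : 0 < A R.
Proof.
have h1 : 0 < (pi : R) ^+ 2 / 12 by rewrite divr_gt0// exprn_gt0// pi_gt0.
by apply: ltr_wpDr h1; rewrite mulr_ge0// sqr_ge0.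
Qed.

(** Minimiser of A/t + nt; [maxn n 1] only keeps it positive at n = 0. *)
Definition saddle (R : realType) (n : nat) : R := Num.sqrt (A R / (maxn n 1)%:R).

(** The second derivative of A/t at the saddle point is 2A/t^3 = 2/[width]^2, so multiplying by
    [width] normalises the limiting variance to 2, that of the transform e^(s^2). *)
Definition width (R : realType) (n : nat) : R :=
  saddle R n * Num.sqrt (saddle R n) / Num.sqrt (A R).

Lemma saddle_gt0 (R : realType) n : 0 < saddle R n.
Proof.
by rewrite sqrtr_gt0 divr_gt0 ?A_gt0// ltr0n leq_max orbT.
Qed.

Lemma width_gt0 (R : realType) n : 0 < width R n.
Proof.
have s0 := saddle_gt0 R n; have a0 := A_gt0 R.
by rewrite /width divr_gt0 ?sqrtr_gt0// mulr_gt0// sqrtr_gt0.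
Qed.

Lemma saddle_sqr (R : realType) n : (0 < n)%N -> n%:R * saddle R n ^+ 2 = A R.
Proof.
move=> n0; rewrite /saddle (maxn_idPl n0) sqr_sqrtr ?divr_ge0 ?(ltW (A_gt0 R))//.
by rewrite mulrC divfK// pnatr_eq0 -lt0n.
Qed.

Lemma cvg_sqrt0 (R : realType) (u : nat -> R) :
  u @ \oo --> (0 : R) -> (fun n => Num.sqrt (u n)) @ \oo --> (0 : R).
Proof.
move=> u0; rewrite -[X in _ --> X]sqrtr0.
by apply: cvgn_comp => //; exact: sqrt_continuous.
Qed.

Lemma saddle_cvg0 (R : realType) : saddle R @ \oo --> (0 : R).
Proof.
apply: cvg_sqrt0; rewrite -(mulr0 (A R)); apply: cvgMl_tmp.
rewrite -cvg_shiftS; apply: cvg_trans (@cvg_invn R).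
by apply: near_eq_cvg; apply: nearW => n /=; rewrite (maxn_idPl _).
Qed.

(** Within a factor 2 of the saddle point, n t(n) >= A/(2 [saddle]) tends to infinity and e^(-n
    t(n)) beats every power; these are the hypotheses of [upa_poly_cvg]. *)
Lemma saddle_perturb (R : realType) (t : nat -> R) :
  (forall n, saddle R n / 2 <= t n <= 2 * saddle R n) ->
  (forall n, 0 < t n) /\ t @ \oo --> (0 : R) /\
  (fun n => n%:R * (expR (- (n%:R * t n)) / t n)) @ \oo --> (0 : R) /\
  (forall C : R, \forall n \near \oo, C <= n%:R * t n).
Proof.
move=> ts; have s0 := saddle_gt0 R; have scv := @saddle_cvg0 R; have a0 := A_gt0 R.
have t0 n : 0 < t n by have := s0 n; have := ts n; lra.
have nt n : (0 < n)%N -> A R / (2 * saddle R n) <= n%:R * t n.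
  move=> n0; rewrite -(saddle_sqr R n0) invfM [X in X <= _](_ : _ = n%:R * (saddle R n / 2)).
    by rewrite ler_wpM2l//; have /andP[] := ts n.
  by field; rewrite gt_eqF.
split=> //; split; last split.
- apply: (@squeeze_cvgn _ (fun=> 0) _ (fun n => 2 * saddle R n)).
  + by apply: nearW => n; rewrite ltW//=; have /andP[] := ts n.
  + exact: cvg_cst.
  + by rewrite -(mulr0 2); exact: cvgMl_tmp.
(* 768 = 24 * 16 * 2: from e^-x <= 24/x^4 at x = A/(2 [saddle]) and 1/t <= 2/[saddle], with n =
   A/[saddle]^2. *)
- apply: (@squeeze_cvgn _ (fun=> 0) _ (fun n => 768 / A R ^+ 3 * saddle R n)).
  + near=> n; have n0 : (0 < n)%N by near: n; exact: nbhs_infty_gt.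
    have tn := t0 n; have sn := s0 n; have /andP[ts1 _] := ts n.
    rewrite mulr_ge0 ?divr_ge0 ?expR_ge0 ?(ltW tn)//=.
    set x := A R / (2 * saddle R n).
    have x0 : 0 < x by rewrite divr_gt0// mulr_gt0.
    have e1 : expR (- (n%:R * t n)) <= 24 / x ^+ 4.
      apply: (@le_trans _ _ (expR (- x))); first by rewrite ler_expR lerN2 nt.
      rewrite expRN -[24 / _]invf_div lef_pV2 ?posrE ?expR_gt0 ?divr_gt0 ?exprn_gt0//.
      have := @expR_ge1Dxn R x 3 (ltW x0).
      by rewrite (_ : 4`!%:R = 24 :> R)//; lra.
    have e2 : (t n)^-1 <= (saddle R n / 2)^-1 by rewrite lef_pV2 ?posrE//; lra.
    apply: (@le_trans _ _ (n%:R * (24 / x ^+ 4 * (saddle R n / 2)^-1))).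
      rewrite ler_wpM2l// ler_pM ?expR_ge0 ?invr_ge0 ?(ltW tn)//.
    have nE : n%:R = A R / saddle R n ^+ 2 :> R.
      by rewrite -(saddle_sqr R n0) mulfK// gt_eqF// exprn_gt0.
    rewrite nE /x le_eqVlt; apply/orP; left; apply/eqP.
    by move: a0 sn; move: (A R) (saddle R n) => al sg al0 sg0; field; rewrite !gt_eqF.
  + exact: cvg_cst.
  + by rewrite -(mulr0 (768 / A R ^+ 3)); exact: cvgMl_tmp.
move=> C; pose D := `|C| + 1.
have D0 : 0 < D by rewrite ltr_wpDl.
near=> n; have n0 : (0 < n)%N by near: n; exact: nbhs_infty_gt.
apply: (le_trans _ (nt n n0)); apply: (@le_trans _ _ D).
  by rewrite /D; have := ler_norm C; lra.
have sn := s0 n.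
have h : `|saddle R n| <= A R / (2 * D).
  by near: n; apply: cvgr0_norm_le scv _ _; rewrite divr_gt0// mulr_gt0.
rewrite (gtr0_norm sn) ler_pdivlMr ?mulr_gt0// in h.
by rewrite ler_pdivlMr ?mulr_gt0//; lra.
Unshelve. all: by end_near. Qed.

(** Tilting by s moves the evaluation point from the saddle point to t = [saddle] (1-b) with b = s
    sqrt([saddle]/A), still on the real axis, where [upa_poly_cvg] applies. *)
Lemma mgf_cvg (R : realType) (s : R) :
  (fun n => \sum_(k < (n * (n * n)).+1)
     ((cnt n k)%:R * expR (- saddle R n) ^+ k / upa_main (saddle R n)) *
     expR (s * (width R n * (k%:R - n%:R)))) @ \oo --> expR (s ^+ 2).
Proof.
have s0 := saddle_gt0 R; have a0 := A_gt0 R; have w0 := width_gt0 R.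
pose b n := s * Num.sqrt (saddle R n) / Num.sqrt (A R).
have bcv : b @ \oo --> (0 : R).
  rewrite [X in _ --> X](_ : _ = s * 0 / Num.sqrt (A R)); last by rewrite mulr0 mul0r.
  by apply: cvgMr_tmp; apply: cvgMl_tmp; apply: cvg_sqrt0; exact: saddle_cvg0.
(* Agrees with [b] for large n; the cut-off keeps t within a factor 2 of the saddle point for every
   n. *)
pose b' n := if `|b n| <= 2^-1 then b n else 0.
have bb n : `|b' n| <= 2^-1 by rewrite /b'; case: ifP => //; rewrite normr0.
have bE : \forall n \near \oo, b' n = b n.
  have h : 0 < 2^-1 :> R by lra.
  near=> n; rewrite /b' ifT//; near: n; exact: cvgr0_norm_le bcv _ h.
have b'cv : b' @ \oo --> (0 : R).
  by apply: cvg_trans bcv; apply: near_eq_cvg; apply: filterS bE => n ->.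
pose t n := saddle R n * (1 - b' n).
have ts n : saddle R n / 2 <= t n <= 2 * saddle R n.
  have := bb n; rewrite ler_norml => /andP[h1 h2].
  by have := s0 n; rewrite /t; nra.
have [t0 [tcv [ncv ntc]]] := saddle_perturb ts.
have P := upa_poly_cvg t0 tcv ncv ntc.
have b1 n : 0 < 1 - b' n by have := bb n; rewrite ler_norml => /andP[h1 h2]; lra.
have cv1 : (fun n => Num.sqrt (1 - b' n)) @ \oo --> (1 : R).
  rewrite -[X in _ --> X]sqrtr1 -[X in Num.sqrt X]subr0.
  apply: cvgn_comp; first exact: sqrt_continuous.
  by apply: cvgB => //; exact: cvg_cst.
have cv2 : (fun n => expR (s ^+ 2 / (1 - b' n))) @ \oo --> expR (s ^+ 2).
  rewrite -[X in _ --> expR X](_ : s ^+ 2 / (1 - 0) = _); last by rewrite subr0 divr1.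
  apply: cvgn_comp; first exact: continuous_expR.
  apply: cvgMl_tmp; apply: cvgV; first by rewrite subr0 oner_eq0.
  by apply: cvgB => //; exact: cvg_cst.
have h : (fun n => upa_poly n (expR (- t n)) / upa_main (t n) *
    (Num.sqrt (1 - b' n) * expR (s ^+ 2 / (1 - b' n)))) @ \oo --> 1 * (1 * expR (s ^+ 2)).
  by apply: cvgM => //; exact: cvgM.
rewrite !mul1r in h; apply: cvg_trans h; apply: near_eq_cvg; near=> n.
have n0 : (0 < n)%N by near: n; exact: nbhs_infty_gt.
have be : b' n = b n by near: n.
have sn := s0 n; have B1 := b1 n.
have r0 : 0 < Num.sqrt (saddle R n) by rewrite sqrtr_gt0.
have ra0 : 0 < Num.sqrt (A R) by rewrite sqrtr_gt0.
have sw : s * width R n = saddle R n * b n by rewrite /width /b; ring.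
have tE : t n = saddle R n - s * width R n by rewrite /t be sw; ring.
have nE : n%:R = A R / saddle R n ^+ 2 :> R.
  by rewrite -(saddle_sqr R n0) mulfK// gt_eqF// exprn_gt0.
have sumE : \sum_(k < (n * (n * n)).+1)
     ((cnt n k)%:R * expR (- saddle R n) ^+ k / upa_main (saddle R n)) *
     expR (s * (width R n * (k%:R - n%:R))) =
   upa_poly n (expR (- t n)) * expR (- (s * width R n * n%:R)) / upa_main (saddle R n).
  rewrite upa_polyE !mulr_suml; apply: eq_bigr => k _.
  rewrite -!expRM_natl tE.
  have -> : s * (width R n * (k%:R - n%:R)) = k%:R * (s * width R n) - s * width R n * n%:R.
    by ring.
  rewrite (_ : k%:R * - (saddle R n - s * width R n) =
    k%:R * - saddle R n + k%:R * (s * width R n)); last by ring.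
  by rewrite !expRD; ring.
rewrite sumE /upa_main.
have -> : Num.sqrt (t n / pi) = Num.sqrt (saddle R n / pi) * Num.sqrt (1 - b' n).
  rewrite -sqrtrM ?divr_ge0 ?pi_ge0 ?(ltW sn)//; congr Num.sqrt; rewrite /t; ring.
have q0 : 0 < Num.sqrt (saddle R n / pi) by rewrite sqrtr_gt0 divr_gt0 ?pi_gt0.
have q1 : 0 < Num.sqrt (1 - b' n) by rewrite sqrtr_gt0.
have b2 : s ^+ 2 = A R / saddle R n * b' n ^+ 2.
  rewrite be /b !expr_div_n exprMn !sqr_sqrtr ?(ltW sn) ?(ltW a0)//.
  by field; rewrite !gt_eqF.
(* Writing r for the saddle point, nr = A/r, so A/t - A/r - nrb = (A/r)(1/(1-b) - 1 - b) = (A/r)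
   b^2/(1-b), which is s^2/(1-b). *)
have ex : expR (s ^+ 2 / (1 - b' n)) * expR (A R / saddle R n) =
    expR (- (s * width R n * n%:R)) * expR (A R / t n).
  rewrite -!expRD; congr expR; rewrite b2 sw nE /t -be.
  by move: a0 sn B1; move: (A R) (saddle R n) (b' n) => al sg be' h1 h2 h3; field; rewrite !gt_eqF.
have e1 := expR_gt0 (A R / t n); have e2 := expR_gt0 (A R / saddle R n).
have -> : expR (- (s * width R n * n%:R)) =
    expR (s ^+ 2 / (1 - b' n)) * expR (A R / saddle R n) / expR (A R / t n).
  by rewrite ex mulfK// gt_eqF.
move: e1 e2 q0 q1; move: (expR (A R / t n)) (expR (A R / saddle R n)) => E1 E2.
move: (expR (s ^+ 2 / (1 - b' n))) (Num.sqrt (saddle R n / pi)) (Num.sqrt (1 - b' n)) => E3 S1 S2.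
by move: (upa_poly _ _) => U e1 e2 q0 q1; field; rewrite !gt_eqF.
Unshelve. all: by end_near. Qed.

(** From x^3/6 <= e^x, e^(-c/t) is O(t^3), which compensates the largest value, of order t^-3, that
    1+u^2 takes on the range of integration. *)
Lemma expRN_inv_le_oneDsqr (R : realType) (c t u D : R) : 0 < c -> 0 < t <= 1 ->
  0 <= D -> u ^+ 2 <= D / t ^+ 3 ->
  expR (- (c / t)) <= 6 * (1 + D) / c ^+ 3 / oneDsqr u.
Proof.
move=> c0 /andP[t0 t1] D0 uD.
have u1 : 0 < oneDsqr u by rewrite /oneDsqr; have := sqr_ge0 u; lra.
have x0 : 0 < c / t by rewrite divr_gt0.
have t3 : 0 < t ^+ 3 by rewrite exprn_gt0.
have c3 : 0 < c ^+ 3 by rewrite exprn_gt0.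
have e : expR (- (c / t)) <= 6 * t ^+ 3 / c ^+ 3.
  rewrite expRN (_ : 6 * t ^+ 3 / c ^+ 3 = ((c / t) ^+ 3 / 6)^-1); last first.
    by field; rewrite !gt_eqF.
  rewrite lef_pV2 ?posrE ?expR_gt0 ?divr_gt0 ?exprn_gt0//.
  have := @expR_ge1Dxn R (c / t) 2 (ltW x0).
  by rewrite (_ : 3`!%:R = 6 :> R)//; lra.
rewrite ler_pdivlMr//.
apply: (@le_trans _ _ (6 * t ^+ 3 / c ^+ 3 * (1 + D / t ^+ 3))).
  by apply: ler_pM; rewrite ?expR_ge0 ?(ltW u1)// /oneDsqr lerD2l.
rewrite (_ : 6 * t ^+ 3 / c ^+ 3 * (1 + D / t ^+ 3) = 6 * (t ^+ 3 + D) / c ^+ 3); last first.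
  by field; rewrite !gt_eqF.
rewrite ler_pM2r ?invr_gt0// ler_pM2l// lerD2r.
by rewrite exprn_ile1// ltW.
Qed.

Lemma expRN_sqr_le_oneDsqr (R : realType) (k u : R) : 0 < k ->
  expR (- (k * u ^+ 2)) <= (1 + k^-1) / oneDsqr u.
Proof.
move=> k0; have u0 := sqr_ge0 u.
have u1 : 0 < oneDsqr u by rewrite /oneDsqr; lra.
rewrite ler_pdivlMr// expRN mulrC ler_pdivrMr ?expR_gt0//.
have ki : 0 < k^-1 by rewrite invr_gt0.
apply: (@le_trans _ _ ((1 + k^-1) * (1 + k * u ^+ 2))); last first.
  by rewrite ler_wpM2l ?expR_ge1Dx//; lra.
rewrite /oneDsqr mulrDr mulr1 [(1 + k^-1) * _]mulrDl mul1r mulKf ?gt_eqF//.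
have : 0 <= k * u ^+ 2 by rewrite mulr_ge0// ltW.
lra.
Qed.

Lemma saddle_bound (R : realType) : exists B : R,
  \forall n \near \oo, forall u, 0 <= u <= pi / width R n ->
  `|\sum_(k < (n * (n * n)).+1)
     ((cnt n k)%:R * expR (- saddle R n) ^+ k / upa_main (saddle R n)) *
     cos (u * (width R n * (k%:R - n%:R)))| <= B / oneDsqr u.
Proof.
have s0 := saddle_gt0 R; have a0 := A_gt0 R; have w0 := width_gt0 R.
have scv := @saddle_cvg0 R; have p0 := pi_gt0 R.
pose c : R := ln (upa_factor (7 + 1)) / 2.
have c0 : 0 < c.
  rewrite divr_gt0// ln_gt0// upa_factor_gt1//; lra.
have k0 := @kap_gt0 R.
pose D : R := pi ^+ 2 * A R.
have D0 : 0 <= D by rewrite mulr_ge0 ?sqr_ge0// ltW.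
pose k := kap / 16 / A R : R.
have kp : 0 < k by rewrite divr_gt0// divr_gt0.
(* One summand per exponential in [normc_upa_poly_le]. The 4 is the 2 of that lemma times the 2 in
   the eventual bound of the product by twice [upa_main]. *)
pose B : R := 4 * (6 * (1 + D) / c ^+ 3 + (6 * (1 + D) / kap ^+ 3 + (1 + k^-1))).
exists B.
have ts n : saddle R n / 2 <= saddle R n <= 2 * saddle R n by have := s0 n; lra.
have [_ [_ [ncv ntc]]] := saddle_perturb ts.
have ecv : (fun n => expR (- (n%:R * saddle R n)) / saddle R n) @ \oo --> (0 : R).
  apply: (@squeeze_cvgn _ (fun=> 0) _
    (fun n => n%:R * (expR (- (n%:R * saddle R n)) / saddle R n))) => //.
    near=> n; have n1 : (0 < n)%N by near: n; exact: nbhs_infty_gt.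
    have e0 : 0 <= expR (- (n%:R * saddle R n)) / saddle R n.
      by rewrite divr_ge0 ?expR_ge0// ltW.
    by rewrite e0 ler_peMl// ler1n.
  exact: cvg_cst.
have Pcv := upa_prod_cvg s0 scv ecv.
near=> n => u /andP[u0 uw].
have sn := s0 n; have wn := w0 n.
have m0 : 0 < upa_main (saddle R n).
  by rewrite mulr_gt0 ?expR_gt0// sqrtr_gt0 divr_gt0.
have s6 : `|saddle R n| <= 6^-1.
  near: n; apply: cvgr0_norm_le scv _ _; lra.
rewrite (gtr0_norm sn) in s6.
have n8 : 7 + 1 <= n%:R * saddle R n by near: n; exact: ntc.
have P2 : `|1 - upa_prod (saddle R n) n / upa_main (saddle R n)| <= 1.
  near: n; exact: cvgr_dist_le Pcv _ ltr01.
have {}P2 : upa_prod (saddle R n) n <= 2 * upa_main (saddle R n).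
  move: P2; rewrite ler_norml => /andP[h _].
  by rewrite -ler_pdivrMr//; lra.
pose th := u * width R n.
have th1 : 0 <= th <= pi by rewrite mulr_ge0 ?(ltW wn)//= -ler_pdivlMr.
have s06 : 0 < saddle R n <= 6^-1 by rewrite sn.
have h := normc_upa_poly_le s06 th1 n8.
have -> : \sum_(k < (n * (n * n)).+1)
     ((cnt n k)%:R * expR (- saddle R n) ^+ k / upa_main (saddle R n)) *
     cos (u * (width R n * (k%:R - n%:R))) =
   complex.Re (upa_poly n (polar (expR (- saddle R n)) th) * cis (- (n%:R * th))) /
     upa_main (saddle R n).
  rewrite upa_polyE -sum_cos_Re mulr_suml; apply: eq_bigr => i _.
  by rewrite /th mulrA mulrAC.
rewrite normrM [X in _ * X](gtr0_norm _) ?invr_gt0// ler_pdivrMr//.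
apply: (le_trans (Re_le_normc _)); rewrite Normc.normcM normc_cis mulr1.
apply: (le_trans h).
have u1 : 0 < oneDsqr u by rewrite /oneDsqr; have := sqr_ge0 u; lra.
have wE : width R n ^+ 2 = saddle R n ^+ 3 / A R.
  rewrite /width expr_div_n exprMn [Num.sqrt (saddle R n) ^+ 2]sqr_sqrtr ?(ltW sn)//.
  by rewrite [Num.sqrt (A R) ^+ 2]sqr_sqrtr ?(ltW a0)//; ring.
have uD : u ^+ 2 <= D / saddle R n ^+ 3.
  have -> : D / saddle R n ^+ 3 = (pi / width R n) ^+ 2.
    rewrite expr_div_n wE /D; field.
    by rewrite !gt_eqF.
  have pw : 0 <= pi / width R n by rewrite divr_ge0 ?(ltW p0) ?(ltW wn).
  by rewrite lerXn2r ?nnegrE.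
have s1 : 0 < saddle R n <= 1 by rewrite sn; lra.
have thE : kap / 16 * (th ^+ 2 / saddle R n ^+ 3) = k * u ^+ 2.
  rewrite /th exprMn wE /k; field.
  by rewrite !gt_eqF.
rewrite thE.
have E1 := expRN_inv_le_oneDsqr c0 s1 D0 uD.
have E2 := expRN_inv_le_oneDsqr k0 s1 D0 uD.
have E3 := expRN_sqr_le_oneDsqr u kp.
rewrite -/c.
set X := expR _ + _.
have X0 : 0 <= X by rewrite /X !addr_ge0 ?expR_ge0.
have XB : X <= B / 4 / oneDsqr u.
  have -> : B / 4 / oneDsqr u = 6 * (1 + D) / c ^+ 3 / oneDsqr u +
     (6 * (1 + D) / kap ^+ 3 / oneDsqr u + (1 + k^-1) / oneDsqr u).
    rewrite /B -!mulrDl; congr (_ / _); rewrite mulrAC mulfV ?mul1r// pnatr_eq0.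
  by rewrite /X; lra.
apply: (@le_trans _ _ (4 * upa_main (saddle R n) * X)).
  by rewrite ler_wpM2r//; lra.
rewrite (_ : B / oneDsqr u * _ = 4 * upa_main (saddle R n) * (B / 4 / oneDsqr u)).
  by rewrite ler_pM2l// mulr_gt0.
by field; rewrite gt_eqF.
Unshelve. all: by end_near. Qed.

Theorem theorem1p1 (R : realType) :
  (fun n : nat => (pa n)%:R : R) ~_ \oo
  (fun n : nat =>
     Num.sqrt (A R) / (2 * pi * n%:R) * expR (2 * Num.sqrt (A R * n%:R))).
Proof.
have s0 := saddle_gt0 R; have a0 := A_gt0 R; have w0 := width_gt0 R.
have p0 := pi_gt0 R.
have [B HB] := saddle_bound R.
have m0 n : 0 < upa_main (saddle R n).
  by rewrite mulr_gt0 ?expR_gt0// sqrtr_gt0 divr_gt0.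
have W0 n k : 0 <= (cnt n k)%:R * expR (- saddle R n) ^+ k / upa_main (saddle R n).
  by rewrite divr_ge0 ?mulr_ge0 ?exprn_ge0 ?expR_ge0 ?(ltW (m0 n)).
have wcv : width R @ \oo --> (0 : R).
  rewrite [X in _ --> X](_ : _ = 0 * 0 / Num.sqrt (A R)); last by rewrite !mul0r.
  have h := @saddle_cvg0 R.
  by apply: cvgMr_tmp; apply: cvgM => //; exact: cvg_sqrt0.
have nN : \forall n \near \oo, (n < (n * (n * n)).+1)%N.
  apply: nearW => n; rewrite ltnS; case: n => // n.
  by rewrite leq_pmulr// muln_gt0.
have L := local_limit W0 w0 wcv nN (@mgf_cvg R) HB.
have r : (fun n => (pa n)%:R / (Num.sqrt (A R) / (2 * pi * n%:R) *
    expR (2 * Num.sqrt (A R * n%:R)))) @ \oo --> (1 : R).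
  have rp : 0 < Num.sqrt (pi : R) by rewrite sqrtr_gt0.
  have h : (fun n => (cnt n n)%:R * expR (- saddle R n) ^+ n / upa_main (saddle R n) /
      width R n * (2 * Num.sqrt pi)) @ \oo --> (1 : R).
    rewrite [X in _ --> X](_ : _ = (2 * Num.sqrt pi)^-1 * (2 * Num.sqrt pi)).
      exact: cvgMr_tmp.
    by rewrite mulVf// gt_eqF// mulr_gt0.
  apply: cvg_trans h; apply: near_eq_cvg; near=> n.
  have n0 : (0 < n)%N by near: n; exact: nbhs_infty_gt.
  have sn := s0 n; have ss := saddle_sqr R n0.
  have nr : (0 : R) < n%:R by rewrite ltr0n.
  have -> : Num.sqrt (A R * n%:R) = n%:R * saddle R n.
    rewrite -[RHS]ger0_norm ?mulr_ge0 ?(ltW sn)// -sqrtr_sqr; congr Num.sqrt.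
    by rewrite -ss; ring.
  have e1 : A R / saddle R n = n%:R * saddle R n.
    by rewrite -ss; field; rewrite gt_eqF.
  rewrite (pa_cnt n0) /upa_main e1 -expRM_natl mulrN expRN.
  have -> : expR (2 * (n%:R * saddle R n)) = expR (n%:R * saddle R n) ^+ 2.
    by rewrite -expRM_natl.
  have ex := expR_gt0 (n%:R * saddle R n).
  have q : 0 < Num.sqrt (saddle R n) by rewrite sqrtr_gt0.
  have qa : 0 < Num.sqrt (A R) by rewrite sqrtr_gt0.
  rewrite /width sqrtrM ?(ltW sn)// sqrtrV ?(ltW p0)//.
  have nE : n%:R = Num.sqrt (A R) ^+ 2 / saddle R n ^+ 2 :> R.
    by rewrite sqr_sqrtr ?(ltW a0)// -ss mulfK// gt_eqF// exprn_gt0.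
  have sE : saddle R n = Num.sqrt (saddle R n) ^+ 2 by rewrite sqr_sqrtr// ltW.
  have pE : pi = Num.sqrt pi ^+ 2 :> R by rewrite sqr_sqrtr// ltW.
  (* E, S1, S2, S3 stand for e^(n [saddle]) and the square roots of [saddle], A and pi. The identity
     says that [width] * [upa_main] * E / (2 sqrt(pi)) is the claimed asymptotic, as n =
     A/[saddle]^2. *)
  have id (C E S1 S2 S3 : R) : 0 < E -> 0 < S1 -> 0 < S2 -> 0 < S3 ->
      C * E^-1 / (S1 * S3^-1 * E) / (S1 ^+ 2 * S1 / S2) * (2 * S3) =
      C / (S2 / (2 * S3 ^+ 2 * (S2 ^+ 2 / (S1 ^+ 2) ^+ 2)) * E ^+ 2).
    by move=> E0 S10 S20 S30; field; rewrite !gt_eqF.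
  by have := id (cnt n n)%:R _ _ _ _ ex q qa rp; rewrite -sE -pE -nE.
apply/eqaddoP => eps eps0; near=> n.
have n0 : (0 < n)%N by near: n; exact: nbhs_infty_gt.
have h : `|1 - (pa n)%:R / (Num.sqrt (A R) / (2 * pi * n%:R) *
    expR (2 * Num.sqrt (A R * n%:R)))| <= eps.
  by near: n; exact: cvgr_dist_le r _ eps0.
set g := Num.sqrt (A R) / _ * _ in h *.
have g0 : 0 < g.
  by rewrite mulr_gt0 ?expR_gt0// divr_gt0 ?sqrtr_gt0// !mulr_gt0// ltr0n.
change (`|(pa n)%:R - g| <= eps * `|g|).
rewrite distrC (_ : g - (pa n)%:R = (1 - (pa n)%:R / g) * g); last first.
  by rewrite mulrBl mul1r divfK// gt_eqF.
by rewrite normrM ler_pM2r// normr_gt0 gt_eqF.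
Unshelve. all: by end_near. Qed.
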